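(* Let $d\ge 1$ and let $\ell(x)=\frac12\langle x,Mx\rangle-\langle q,x\rangle+c$ for $x\in\mathbb{R}^d$, where $M\in\mathbb{R}^{d\times d}$ is symmetric positive semidefinite, $q\in\operatorname{Span}M$ and $c\in\mathbb{R}$. Let $h\in\Gamma_0(\mathbb{R}^d)$ be such that $C:=\operatorname{dom}h$ is closed and $\operatorname{dom}h^*=\mathbb{R}^d$. For each $\varepsilon>0$ let $w_0^\varepsilon\in\mathbb{R}^d$, let $w^\varepsilon:\mathbb{R}_{\ge0}\to\mathbb{R}^d$ be the unique Lipschitz solution of the mirror flow with mirror potential $h$ and loss $\ell$ with $w^\varepsilon(0)=w_0^\varepsilon$, and let $x^\varepsilon$ be an associated primal variable. Assume that $\mu^\varepsilon:=\|w_0^\varepsilon\|\to+\infty$ as $\varepsilon\to0$. For $s\ge0$ (and $\varepsilon$ small enough that $\mu^\varepsilon>0$) set $$\overline{w}^\varepsilon(s)=\frac{1}{\mu^\varepsilon}w^\varepsilon(\mu^\varepsilon s),\qquad \overline{x}^\varepsilon(s)=x^\varepsilon(\mu^\varepsilon s),\qquad \overline{w}_0^\varepsilon=\overline{w}^\varepsilon(0)=\frac{1}{\mu^\varepsilon}w_0^\varepsilon .$$ Assume that: (i) as $\varepsilon\to0$, $\overline{w}_0^\varepsilon$ converges to some $\overline{w}_0\in\operatorname{dom}\partial\sigma_C\cap(\operatorname{ri}\operatorname{dom}\sigma_C+\operatorname{Span}M)$; (ii) for $\varepsilon>0$ small enough, $\overline{w}_0^\varepsilon-\overline{w}_0\in\operatorname{aff}\operatorname{dom}\sigma_C$.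 Then there exists a unique Lipschitz solution $\overline{w}:\mathbb{R}_{\ge0}\to\mathbb{R}^d$ of the mirror flow with mirror potential $\iota_C$ and loss $\ell$ such that $\overline{w}(0)=\overline{w}_0$. Let $\overline{x}$ be an associated primal variable, and let $S>0$. Then: (a) $\overline{w}^\varepsilon\to\overline{w}$ uniformly on $[0,S]$ as $\varepsilon\to0$. (b) As $\varepsilon\to0$, $\nabla\ell(\overline{x}^\varepsilon(s))\to\nabla\ell(\overline{x}(s))$ in $L^2([0,S],\mathbb{R}^d,s\,\mathrm{d}s)$, and $$\ell(\overline{x}^\varepsilon(s))\to\ell(\overline{x}(s))=\min_{y\in\partial\sigma_C(\overline{w}(s))}\ell(y)\quad\text{in }L^1([0,S],\mathbb{R},s\,\mathrm{d}s)$$ (the equality holding for a.e. $s\in[0,S]$). (c) Let $\overline{y}:[0,S]\to\mathbb{R}^d$ be such that there exists a sequence $\varepsilon_k\to0$ with $\overline{x}^{\varepsilon_k}(s)\to\overline{y}(s)$ as $k\to\infty$ for a.e. $s\in[0,S]$. Then for a.e. $s\in[0,S]$, $\overline{y}(s)\in\operatorname{Argmin}_{y\in\partial\sigma_C(\overline{w}(s))}\ell(y)$.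
   Context: $\Gamma_0(\mathbb{R}^d)$ is the set of proper, convex, lower semicontinuous functions $\mathbb{R}^d\to\mathbb{R}\cup\{+\infty\}$. $\operatorname{dom}f=\{f<+\infty\}$; $\partial f$ is the convex subdifferential; $\operatorname{dom}\partial f=\{x:\partial f(x)\ne\emptyset\}$; $f^*$ is the Fenchel conjugate. $\operatorname{ri}$ and $\operatorname{aff}$ denote relative interior and affine hull. $\operatorname{Span}M$ is the column span of $M$. For a nonempty closed convex set $C$, $\iota_C$ is its indicator function ($0$ on $C$, $+\infty$ elsewhere) and $\sigma_C(w)=\sup_{x\in C}\langle w,x\rangle$ its support function. $\operatorname{Argmin}$ denotes the set of minimizers. $L^p(I,\mathbb{R}^m,s\,\mathrm{d}s)$ is the $L^p$ space with respect to the measure of density $s$ with respect to Lebesgue measure. Mirror flow: for $g\in\Gamma_0(\mathbb{R}^d)$, a function $w:\mathbb{R}_{\ge0}\to\mathbb{R}^d$ is a solution of the mirror flow with mirror potential $g$ and loss $\ell$ if there exists $x:\mathbb{R}_{\ge0}\to\mathbb{R}^d$ such that for a.e. $t\ge0$, $w$ is differentiable at $t$ and $\frac{\mathrm{d}w}{\mathrm{d}t}(t)=-\nabla\ell(x(t))$, $w(t)\in\partial g(x(t))$. Any such $x$ is called an associated primal variable. When $\operatorname{dom}h^*=\mathbb{R}^d$, for every initial value in $\mathbb{R}^d$ there is a unique Lipschitz solution of the mirror flow with mirror potential $h$ and loss $\ell$, so $w^\varepsilon$ is well defined. *)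

(* Defs.v *)
From HB Require Import structures.
From mathcomp Require Import all_boot all_order all_algebra.
From mathcomp Require Import all_classical all_reals all_analysis.

Set Implicit Arguments.
Unset Strict Implicit.
Unset Printing Implicit Defensive.

Import Order.TTheory GRing.Theory Num.Theory.
Import numFieldNormedType.Exports.

Local Open Scope classical_set_scope.
Local Open Scope ring_scope.

(* Vectors of R^d are columns. The norm `|x| of the library on 'cV[R]_d is the
   sup norm: it induces the usual topology and uniformity and the usual class
   of Lipschitz functions, and is used for these only. The Euclidean norm is
   enorm. *)

Section EuclideanSpace.
Context {R : realType} {d : nat}.
Implicit Types (x y u : 'cV[R]_d) (A : set 'cV[R]_d).

Definition dot x y : R := \sum_(i < d) x i 0 * y i 0.

Definition enorm x : R := Num.sqrt (dot x x).

Definition grad (f : 'cV[R]_d -> R) x : 'cV[R]_d :=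
  \col_(i < d) 'D_(delta_mx i 0) f x.

Definition colspan (M : 'M[R]_d) : set 'cV[R]_d := range (fun u => M *m u).

Definition psd_mx (M : 'M[R]_d) : Prop :=
  M^T = M /\ forall x, 0 <= dot x (M *m x).

Definition quad (M : 'M[R]_d) (q : 'cV[R]_d) (c : R) x : R :=
  2^-1 * dot x (M *m x) - dot q x + c.

Definition affine_set A : Prop :=
  forall x y (t : R), A x -> A y -> A ((1 - t) *: x + t *: y).

Definition aff A : set 'cV[R]_d := smallest affine_set A.

Definition ri A : set 'cV[R]_d :=
  [set x | A x /\ \forall y \near x, aff A y -> A y].

Definition argmin A (f : 'cV[R]_d -> R) : set 'cV[R]_d :=
  [set y | A y /\ forall z, A z -> f y <= f z].

(* v = min_{y in A} f y, including that the minimum is attained *)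
Definition is_min A (f : 'cV[R]_d -> R) (v : R) : Prop :=
  (f @` A) v /\ lbound (f @` A) v.

End EuclideanSpace.

Section ConvexAnalysis.
Context {R : realType} {d : nat}.
Local Open Scope ereal_scope.
Implicit Types (f : 'cV[R]_d -> \bar R) (x y w : 'cV[R]_d) (C : set 'cV[R]_d).

Definition dom f : set 'cV[R]_d := [set x | f x < +oo].

Definition proper_efun f : Prop := (forall x, -oo < f x) /\ dom f !=set0.

Definition convex_efun f : Prop :=
  forall x y (t : R), (0 < t < 1)%R ->
    f ((1 - t) *: x + t *: y)%R <= (1 - t)%:E * f x + t%:E * f y.

Definition Gamma0 f : Prop :=
  [/\ proper_efun f, convex_efun f & lower_semicontinuous f].

(* If f is proper, then subdiff f x is empty outside dom f. *)
Definition subdiff f x : set 'cV[R]_d :=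
  [set w | forall y, f x + (dot w (y - x)%R)%:E <= f y].

Definition dom_subdiff f : set 'cV[R]_d := [set x | subdiff f x !=set0].

Definition conjugate f w : \bar R :=
  ereal_sup [set (dot w x)%:E - f x | x in [set: 'cV[R]_d]].

Definition indicator_fun C x : \bar R := if `[< C x >] then 0 else +oo.

Definition support_fun C w : \bar R := ereal_sup [set (dot w x)%:E | x in C].

End ConvexAnalysis.

(* Functions on R_{>= 0} are represented by functions on R, whose values at
   negative times are irrelevant. Since {0} is negligible, the two-sided
   derivative of w is only used at times t > 0. *)
Section MirrorFlow.
Context {R : realType} {d : nat}.
Implicit Types (g : 'cV[R]_d -> \bar R) (l : 'cV[R]_d -> R)
  (w x : R -> 'cV[R]_d).

Definition primal_variable g l w x : Prop :=
  {ae (@lebesgue_measure R), forall t : R, 0 <= t ->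
    is_derive t (1 : R) w (- grad l (x t)) /\ subdiff g (x t) (w t)}.

Definition mirror_flow g l w : Prop := exists x, primal_variable g l w x.

Definition lipschitz_mirror_flow g l w : Prop :=
  [lipschitz w t | t in `[0, +oo[%classic] /\ mirror_flow g l w.

End MirrorFlow.

(* L^p([0, S], R^m, s ds) *)
Section WeightedLp.
Context {R : realType} {m : nat}.
Implicit Types (p S : R) (f : R -> 'cV[R]_m).

Definition wLnorm p S f : \bar R :=
  ((\int[lebesgue_measure]_(s in `[0%R, S]%classic) (enorm (f s) `^ p * s)%:E)
    `^ p^-1)%E.

(* Lebesgue measurability of f on [0, S]: the sigma-algebra of the library on R
   is the Borel one, whence the a.e. equal representative. *)
Definition ae_measurable S f : Prop :=
  exists g : R -> 'cV[R]_m,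
    (forall i, measurable_fun `[0, S]%classic (fun s : R => g s i 0 : R)) /\
    f = g %[ae (@lebesgue_measure R) in `[0, S]%classic].

Definition in_wLp p S f : Prop := ae_measurable S f /\ (wLnorm p S f < +oo)%E.

Definition cvg_wLp p S (F : set_system R) (f_ : R -> R -> 'cV[R]_m) f : Prop :=
  [/\ \forall e \near F, in_wLp p S (f_ e), in_wLp p S f
    & wLnorm p S (fun s => f_ e s - f s) @[e --> F] --> 0%E].

End WeightedLp.

(* Main.v *)
Require Import Defs.
From HB Require Import structures.
From mathcomp Require Import all_boot all_order all_algebra.
From mathcomp Require Import all_classical all_reals all_analysis.
From mathcomp Require Import measurable_realfun ring lra.

Set Implicit Arguments.
Unset Strict Implicit.
Unset Printing Implicit Defensive.

Import Order.TTheory GRing.Theory Num.Theory.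
Import numFieldNormedType.Exports.

Local Open Scope classical_set_scope.
Local Open Scope ring_scope.

(* Write q = M u0, so that grad l (x) = M (x - u0), and let P be positive
   semidefinite with M P M = M: then l = 1/2 <P grad l, grad l> + l(u0). The
   rescaled mirror flow is the gradient flow, for the form P on the affine space
   w(0) + colspan M, of E(v) = sup_{x in C} (<v, x - u0> - h(x)/mu). It satisfies
   an evolution variational inequality (EVI), which passes to the limit mu -> +oo
   because competitors can be pushed into the domain of the support function
   with the relative interior point. EVI curves contract, whence uniqueness and,
   with wb0 in the domain of the subdifferential, Lipschitz continuity of the
   limit; differentiating the EVI gives back a flow, and a chain rule for
   subdifferentials gives its primal variable. Velocities converge strongly
   because the energy of the limit, int t |w'|_P^2 + [t E(w)], bounds from above
   the limit of the energies, which combined with weak convergence gives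
   convergence in norm. The loss is quadratic in the velocity, and the primal
   variable of the limit minimizes it because E' = <y - u0, w'> for all
   subgradients y. *)

(** * Euclidean vectors and semidefinite forms *)

(** No common Lipschitz constant is available for the rescaled curves: hypothesis (ii) only places
    [wb e 0 - wb0] in a subspace, and nothing bounds the energy of [wb e 0]. This shapes two
    choices. Compactness is taken along ultrafilters: boundedness alone yields limits at all times
    simultaneously, each such limit is an EVI curve issued from [wb0], and contraction makes them
    all the same curve; uniformity in time is recovered afterwards from the Lipschitz continuity of
    the limit alone. And energies carry the weight [t]: when [(t E)'] is integrated the boundary
    term at time 0 vanishes, which is the origin of the measure [s ds]. The vector [u] of a velocity
    [- M u] is determined only modulo the kernel of [M], so subgradient inequalities are kept in
    directions of [colspan M], where [P] inverts [M]. Turning such a partial subgradient back into a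
    point of C is the difficult half of the equivalence with mirror flows, and the place where the
    relative interior point makes a minimum attained. *)

#[global] Instance col_nbhs_filter {R : realType} {d : nat} (x : 'cV[R]_d) :
  Filter (nbhs x) := nbhs_filter x.

Section EuclideanVectors.
Context {R : realType} {d : nat}.
Implicit Types (x y z u v : 'cV[R]_d) (A : 'M[R]_d).

Lemma dotE x y : dot x y = (x^T *m y) 0 0.
Proof. by rewrite mxE /dot; apply: eq_bigr => i _; rewrite mxE. Qed.

Lemma dotC x y : dot x y = dot y x.
Proof. by apply: eq_bigr => i _; rewrite mulrC. Qed.

Lemma dotDr x y z : dot x (y + z) = dot x y + dot x z.
Proof. by rewrite !dotE mulmxDr mxE. Qed.

Lemma dotDl x y z : dot (x + y) z = dot x z + dot y z.
Proof. by rewrite !(dotC _ z) dotDr. Qed.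

Lemma dotZr a x y : dot x (a *: y) = a * dot x y.
Proof. by rewrite !dotE -scalemxAr mxE. Qed.

Lemma dotZl a x y : dot (a *: x) y = a * dot x y.
Proof. by rewrite dotC dotZr dotC. Qed.

Lemma dotNr x y : dot x (- y) = - dot x y.
Proof. by rewrite !dotE mulmxN mxE. Qed.

Lemma dotNl x y : dot (- x) y = - dot x y.
Proof. by rewrite dotC dotNr dotC. Qed.

Lemma dotBr x y z : dot x (y - z) = dot x y - dot x z.
Proof. by rewrite dotDr dotNr. Qed.

Lemma dotBl x y z : dot (x - y) z = dot x z - dot y z.
Proof. by rewrite dotDl dotNl. Qed.

Lemma dot0r x : dot x 0 = 0.
Proof. by rewrite dotE mulmx0 mxE. Qed.

Lemma dot0l x : dot 0 x = 0.
Proof. by rewrite dotC dot0r. Qed.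

Lemma dot_mulmxl A x y : dot (A *m x) y = dot x (A^T *m y).
Proof. by rewrite !dotE trmx_mul mulmxA. Qed.

Lemma dot_ge0 x : 0 <= dot x x.
Proof. by apply: sumr_ge0 => i _; rewrite -expr2 sqr_ge0. Qed.

Lemma dot_eq0 x : dot x x = 0 -> x = 0.
Proof.
move=> /eqP; rewrite psumr_eq0 => [/allP x0|i _]; last by rewrite -expr2 sqr_ge0.
apply/colP => i; rewrite mxE; apply/eqP.
by have := x0 i (mem_index_enum _); rewrite /= mulf_eq0 orbb.
Qed.

Lemma coord_le {n} (x : 'cV[R]_n) i : `|x i 0| <= `|x|.
Proof.
by rewrite [leRHS]/Num.Def.normr/= mx_normrE (le_bigmax _ _ (i, 0)).
Qed.

Lemma norm_col_le {n} (x : 'cV[R]_n) (K : R) : 0 <= K -> (forall i, `|x i 0| <= K) -> `|x| <= K.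
Proof.
move=> K0 xK; rewrite /Num.Def.normr/= mx_normrE; apply: bigmax_le => //= -[i j] _.
by rewrite (ord1 j).
Qed.

Lemma dot_norm_le x y : `|dot x y| <= d%:R * `|x| * `|y|.
Proof.
apply: (le_trans (ler_norm_sum _ _ _)).
apply: (@le_trans _ _ (\sum_(i < d) `|x| * `|y|)).
  by apply: ler_sum => i _; rewrite normrM ler_pM ?coord_le.
by rewrite sumr_const card_ord -[leLHS]mulr_natl mulrA.
Qed.

Lemma mulmx_norm_le {m n} (A : 'M[R]_(m, n)) :
  exists2 K : R, 0 < K & forall x : 'cV[R]_n, `|A *m x| <= K * `|x|.
Proof.
exists (\sum_i \sum_j `|A i j| + 1) => [|x].
  by rewrite ltr_wpDl// sumr_ge0// => i _; rewrite sumr_ge0.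
apply: norm_col_le => [|i].
  by rewrite mulr_ge0// addr_ge0// sumr_ge0// => i _; rewrite sumr_ge0.
rewrite mxE; apply: (le_trans (ler_norm_sum _ _ _)).
apply: (@le_trans _ _ ((\sum_j `|A i j|) * `|x|)).
  by rewrite mulr_suml ler_sum// => j _; rewrite normrM ler_wpM2l// coord_le.
rewrite ler_wpM2r// [X in _ <= X + _](bigD1 i)//= -addrA lerDl addr_ge0// sumr_ge0// => k _.
by rewrite sumr_ge0.
Qed.

Lemma cvg_colP {T : Type} (F : set_system T) {FF : Filter F} (f : T -> 'cV[R]_d) x :
  f @ F --> x <-> forall i, (fun t => f t i 0) @ F --> x i 0.
Proof.
split=> [fx i|fx].
  apply/cvgrPdist_le => e e0; move/cvgrPdist_le: fx => /(_ e e0).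
  apply: filterS => t; apply: le_trans.
  by have := coord_le (x - f t) i; rewrite !mxE.
apply/cvgrPdist_le => e e0; near=> t; apply: norm_col_le; first exact: ltW.
move=> i; rewrite !mxE; move: i; near: t; apply: filter_forall => i.
by move/cvgrPdist_le: (fx i); apply.
Unshelve. all: by end_near. Qed.

Lemma cvg_dot {T : Type} (F : set_system T) {FF : Filter F} (f g : T -> 'cV[R]_d) x y :
  f @ F --> x -> g @ F --> y -> (fun t => dot (f t) (g t)) @ F --> dot x y.
Proof.
move=> /cvg_colP fx /cvg_colP gy; rewrite /dot.
elim: (index_enum _) => [|i r IH].
  by rewrite big_nil; under eq_fun do rewrite big_nil; exact: cvg_cst.
rewrite big_cons; under eq_fun do rewrite big_cons.
by apply: cvgD IH; apply: cvgM; [exact: fx|exact: gy].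
Qed.

Lemma cvg_mulmx {T : Type} (F : set_system T) {FF : Filter F} A (f : T -> 'cV[R]_d) x :
  f @ F --> x -> (fun t => A *m f t) @ F --> A *m x.
Proof.
move=> fx; have [K K0 AK] := mulmx_norm_le A.
apply/cvgrPdist_le => e e0.
have eK : 0 < e / K by rewrite divr_gt0.
move/cvgrPdist_le: fx => /(_ _ eK); apply: filterS => t.
rewrite ler_pdivlMr// mulrC -mulmxBr; exact/le_trans/AK.
Qed.

Lemma is_derive_coord (w : R -> 'cV[R]_d) t v i :
  is_derive t (1 : R) w v -> is_derive t (1 : R) (fun s => w s i 0) (v i 0).
Proof.
move=> [dw <-]; split; first by move/derivable_mxP: dw => /(_ i 0).
by rewrite derive_mx// mxE.
Qed.

Lemma is_derive_col (w : R -> 'cV[R]_d) t v :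
  (forall i, is_derive t (1 : R) (fun s => w s i 0) (v i 0)) -> is_derive t (1 : R) w v.
Proof.
move=> dw; have D : derivable w t 1.
  by apply/derivable_mxP => i j; rewrite (ord1 j); case: (dw i).
split => //; rewrite derive_mx//; apply/matrixP => i j; rewrite mxE (ord1 j).
by case: (dw i).
Qed.

Lemma is_derive_dot (w1 w2 : R -> 'cV[R]_d) t v1 v2 :
  is_derive t (1 : R) w1 v1 -> is_derive t (1 : R) w2 v2 ->
  is_derive t (1 : R) (fun s => dot (w1 s) (w2 s)) (dot v1 (w2 t) + dot (w1 t) v2).
Proof.
move=> d1 d2; rewrite -[X in is_derive _ _ X](_ :
  (\sum_(i < d) (fun s => w1 s i 0 * w2 s i 0)) = _); last first.
  by apply/funext => s; rewrite fct_sumE.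
rewrite -big_split/=; apply: is_derive_sum => i.
have c1 := is_derive_coord i d1; have c2 := is_derive_coord i d2.
apply: is_derive_eq (is_deriveM c1 c2) _.
by rewrite /GRing.scale/=; ring.
Qed.

Lemma is_derive_mulmx A (w : R -> 'cV[R]_d) t v :
  is_derive t (1 : R) w v -> is_derive t (1 : R) (fun s => A *m w s) (A *m v).
Proof.
move=> dw; apply: is_derive_col => i.
rewrite -[X in is_derive _ _ X](_ :
  (\sum_(j < d) (fun s => A i j * w s j 0)) = _); last first.
  by apply/funext => s; rewrite fct_sumE mxE.
rewrite mxE; apply: is_derive_sum => j.
have c := is_derive_coord j dw.
exact: (is_deriveZ (A i j) c).
Qed.

End EuclideanVectors.

Section SemiNorm.
Context {R : realType} {d : nat}.
Implicit Types (M P : 'M[R]_d) (a b u v z : 'cV[R]_d).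

Definition pform P a b : R := dot a (P *m b).

Lemma pformDl P a b c : pform P (a + b) c = pform P a c + pform P b c.
Proof. exact: dotDl. Qed.

Lemma pformDr P a b c : pform P a (b + c) = pform P a b + pform P a c.
Proof. by rewrite /pform mulmxDr dotDr. Qed.

Lemma pformNl P a b : pform P (- a) b = - pform P a b.
Proof. exact: dotNl. Qed.

Lemma pformNr P a b : pform P a (- b) = - pform P a b.
Proof. by rewrite /pform mulmxN dotNr. Qed.

Lemma pformZl P k a b : pform P (k *: a) b = k * pform P a b.
Proof. exact: dotZl. Qed.

Lemma pformZr P k a b : pform P a (k *: b) = k * pform P a b.
Proof. by rewrite /pform -scalemxAr dotZr. Qed.

Lemma pformC P a b : psd_mx P -> pform P a b = pform P b a.
Proof. by move=> [PT _]; rewrite /pform [RHS]dotC dot_mulmxl PT. Qed.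

Lemma pform_ge0 P a : psd_mx P -> 0 <= pform P a a.
Proof. by move=> [_]; exact. Qed.

Lemma pform_sqrD P a b : psd_mx P ->
  pform P (a + b) (a + b) = pform P a a + 2 * pform P a b + pform P b b.
Proof.
by move=> hP; rewrite pformDl !pformDr (pformC b a hP); ring.
Qed.

Lemma pform_sqrB P a b : psd_mx P ->
  pform P (a - b) (a - b) = pform P a a - 2 * pform P a b + pform P b b.
Proof.
by move=> hP; rewrite pform_sqrD// !(pformNr, pformNl); ring.
Qed.

Lemma pform_young P a b t : psd_mx P -> 0 < t ->
  2 * `|pform P a b| <= t * pform P a a + t^-1 * pform P b b.
Proof.
move=> hP t0.
have key c : 2 * pform P c b <= t * pform P c c + t^-1 * pform P b b.
  have := pform_ge0 (t *: c - b) hP.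
  rewrite pform_sqrB// !(pformZl, pformZr) => H.
  rewrite -(@ler_pM2l _ t)// mulrDr mulrA mulVKf ?gt_eqF// -subr_ge0.
  by apply: le_trans H _; rewrite le_eqVlt; apply/orP; left; apply/eqP; ring.
have [h|h] := leP 0 (pform P a b); first by rewrite ger0_norm.
rewrite ltr0_norm// -pformNl; apply: (le_trans (key _)).
by rewrite pformNl pformNr opprK.
Qed.

Lemma pform_bound P : exists2 K, 0 < K &
  forall a b, `|pform P a b| <= K * `|a| * `|b|.
Proof.
have [K K0 PK] := mulmx_norm_le P.
exists (d%:R * K + 1) => [|a b]; first by rewrite ltr_wpDl// mulr_ge0// ltW.
apply: (le_trans (dot_norm_le _ _)).
apply: (@le_trans _ _ (d%:R * `|a| * (K * `|b|))).
  by rewrite ler_wpM2l// mulr_ge0.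
rewrite !mulrDl mul1r (_ : d%:R * K * `|a| * `|b| = d%:R * `|a| * (K * `|b|)).
  by rewrite lerDl mulr_ge0.
by ring.
Qed.

Lemma cvg_pform {T : Type} (F : set_system T) {FF : Filter F} P (f g : T -> 'cV[R]_d) x y :
  f @ F --> x -> g @ F --> y -> (fun t => pform P (f t) (g t)) @ F --> pform P x y.
Proof. by move=> fx gy; apply: cvg_dot => //; exact: cvg_mulmx. Qed.

Lemma is_derive_pform P (w1 w2 : R -> 'cV[R]_d) t v1 v2 :
  is_derive t (1 : R) w1 v1 -> is_derive t (1 : R) w2 v2 ->
  is_derive t (1 : R) (fun s => pform P (w1 s) (w2 s))
    (pform P v1 (w2 t) + pform P (w1 t) v2).
Proof. by move=> d1 d2; apply: is_derive_dot => //; exact: is_derive_mulmx. Qed.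

(** [pinvmx M] need be neither symmetric nor semidefinite. Averaging it with its transpose keeps it
    a generalized inverse because [M] is symmetric, and the sandwich [P1 *m M *m P1] then inherits
    semidefiniteness from [M]. *)
Lemma psd_pinv M : psd_mx M -> exists2 P, psd_mx P & M *m P *m M = M.
Proof.
move=> [MT M0]; pose P0 := pinvmx M.
have E0 : M *m P0 *m M = M by rewrite mulmxKpV.
have E0T : M *m P0^T *m M = M.
  by have := congr1 trmx E0; rewrite !trmx_mul !MT mulmxA.
pose P1 := 2^-1 *: (P0 + P0^T).
have E1 : M *m P1 *m M = M.
  rewrite -scalemxAr -scalemxAl mulmxDr mulmxDl E0 E0T -[M + M]mulr2n.
  by rewrite -[M *+ 2]scaler_nat scalerA mulVf// scale1r.
have P1T : P1^T = P1 by rewrite /P1 linearZ linearD/= trmxK addrC.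
exists (P1 *m M *m P1); last by rewrite !mulmxA E1 E1.
split; first by rewrite !trmx_mul MT P1T mulmxA.
by move=> x; have := M0 (P1 *m x); rewrite dot_mulmxl P1T !mulmxA.
Qed.

(** Since the form vanishes at [u], Young's inequality against [z = M u] leaves
    [2 |z|^2 <= t <z, M z>] for every [t > 0]. *)
Lemma psd_ker M u : psd_mx M -> dot u (M *m u) <= 0 -> M *m u = 0.
Proof.
move=> hM u0; have {}u0 : pform M u u = 0 by apply/le_anti; rewrite u0 pform_ge0.
apply: dot_eq0; set z := M *m u.
have H t : 0 < t -> 2 * dot z z <= t * pform M z z.
  move=> t0; have := pform_young z u hM t0; rewrite u0 mulr0 addr0.
  by apply: le_trans; rewrite ler_pM2l// ler_norm.
apply/le_anti; rewrite dot_ge0 andbT; apply/ler_addgt0Pl => e e0; rewrite addr0.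
have Kp : 0 < pform M z z + 1 by rewrite ltr_wpDl// pform_ge0.
have := H _ (divr_gt0 e0 Kp) => h.
have : e / (pform M z z + 1) * pform M z z <= e.
  by rewrite mulrAC ler_pdivrMr// ler_pM2l// lerDl.
have := dot_ge0 z; lra.
Qed.

Section PseudoInverse.
Variables (M P : 'M[R]_d).
Hypotheses (hM : psd_mx M) (hP : psd_mx P) (MPM : M *m P *m M = M).

(** [M *m P] is a projector onto the span; membership becomes an equation, hence stable under
    limits. *)
Lemma colspanE a : colspan M a <-> M *m (P *m a) = a.
Proof.
split=> [[u _ <-]|<-]; first by rewrite !mulmxA MPM.
by exists (P *m a).
Qed.

Lemma colspan0 : colspan M 0.
Proof. by exists 0; rewrite ?mulmx0. Qed.

Lemma colspan_mulmx u : colspan M (M *m u).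
Proof. by exists u. Qed.

Lemma colspanD a b : colspan M a -> colspan M b -> colspan M (a + b).
Proof. by move=> [u _ <-] [v _ <-]; exists (u + v) => //; rewrite mulmxDr. Qed.

Lemma colspanZ k a : colspan M a -> colspan M (k *: a).
Proof. by move=> [u _ <-]; exists (k *: u) => //; rewrite -scalemxAr. Qed.

Lemma colspanN a : colspan M a -> colspan M (- a).
Proof. by move=> [u _ <-]; exists (- u) => //; rewrite mulmxN. Qed.

Lemma colspanB a b : colspan M a -> colspan M b -> colspan M (a - b).
Proof. by move=> ha hb; apply: colspanD => //; exact: colspanN. Qed.

Lemma colspan_cvg {T : Type} (F : set_system T) {FF : ProperFilter F}
    (f : T -> 'cV[R]_d) x :
  (\forall t \near F, colspan M (f t)) -> f @ F --> x -> colspan M x.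
Proof.
move=> fM fx; apply/colspanE.
have H : (fun t => M *m (P *m f t)) @ F --> x.
  apply: cvg_trans fx; apply: near_eq_cvg; near=> t.
  by symmetry; apply/colspanE; near: t.
have H' : (fun t => M *m (P *m f t)) @ F --> M *m (P *m x).
  by do 2 apply: cvg_mulmx.
exact: cvg_unique H' H.
Unshelve. all: by end_near. Qed.

(** [P] cancels [M] against any vector of the span. This is how the [P]-product of a velocity
    [- M u] with a displacement becomes a subgradient pairing with [u]. *)
Lemma pform_colspan a u : colspan M a -> pform P a (M *m u) = dot a u.
Proof.
move=> /colspanE aE; have [MT _] := hM; have [PT _] := hP.
by rewrite -[in RHS]aE dot_mulmxl MT dot_mulmxl PT.
Qed.

Lemma pform_mulmx u v : pform P (M *m u) (M *m v) = dot u (M *m v).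
Proof.
rewrite pform_colspan; last exact: colspan_mulmx.
by rewrite dot_mulmxl; have [-> _] := hM.
Qed.

(** [P] is only semidefinite, but at [a = M u] its form is [<u, M u>], and each coordinate of [a] is
    the [M]-product of [u] with a basis vector, so Cauchy-Schwarz applies. *)
Lemma norm_le_pform : exists2 K, 0 < K &
  forall a, colspan M a -> `|a| ^+ 2 <= K * pform P a a.
Proof.
have [K K0 MK] := pform_bound M.
exists (K + 1) => [|a]; first by rewrite ltr_wpDl// ltW.
move=> [u _ <-]; rewrite pform_mulmx.
set z := M *m u.
have Q0 : 0 <= dot u z by have [_] := hM; apply.
have coord i : `|z i 0| ^+ 2 <= K * dot u z.
  have zE : z i 0 = pform M (delta_mx i 0) u.
    rewrite /pform -/z /dot (bigD1 i)//= big1 => [|j ji]; rewrite [delta_mx _ _ _ _]mxE.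
      by rewrite !eqxx mul1r addr0.
    by rewrite (negPf ji) mul0r.
  have nd : `|delta_mx i 0 : 'cV[R]_d| <= 1.
    apply: norm_col_le => // j; rewrite mxE normr_nat.
    by case: (_ && _).
  have Mii : pform M (delta_mx i 0) (delta_mx i 0) <= K.
    apply: (le_trans (ler_norm _)); apply: (le_trans (MK _ _)).
    by rewrite -mulrA ler_piMr ?(ltW K0)// mulr_ile1.
  have H t : 0 < t -> 2 * `|z i 0| <= t * K + t^-1 * dot u z.
    move=> t0; rewrite zE; apply: (le_trans (pform_young _ _ hM t0)).
    by rewrite lerD2r ler_pM2l.
  have [z0|z0] := eqVneq (z i 0) 0.
    by rewrite z0 normr0 expr0n/= mulr_ge0// ltW.
  have nz : 0 < `|z i 0| by rewrite normr_gt0.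
  (* With [t = |z_i| / K] the first term of Young's inequality is [|z_i|], half of the left-hand
     side. *)
  have := H _ (divr_gt0 nz K0); rewrite divfK ?gt_eqF// invf_div => {}H.
  have : `|z i 0| <= K / `|z i 0| * dot u z by lra.
  by rewrite mulrAC ler_pdivlMr.
have zn : `|z| <= Num.sqrt (K * dot u z).
  apply: norm_col_le; first exact: sqrtr_ge0.
  by move=> i; rewrite -[leLHS]ger0_norm// -sqrtr_sqr ler_wsqrtr.
have := lerXn2r 2 (normr_ge0 z) (sqrtr_ge0 _) zn.
rewrite sqr_sqrtr ?mulr_ge0// ?(ltW K0)// => h.
by apply: (le_trans h); rewrite ler_wpM2r// lerDl.
Qed.

End PseudoInverse.
End SemiNorm.

(** * Lipschitz functions of time *)

Section LebesgueAlmostEverywhere.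
Context {R : realType}.
Notation mu := (@lebesgue_measure R).
Implicit Types P Q S : R -> Prop.

Lemma aeS P Q : (forall t, P t -> Q t) ->
  {ae mu, forall t, P t} -> {ae mu, forall t, Q t}.
Proof. exact: (@filterS _ _ (ae_filter_ringOfSetsType mu)). Qed.

Lemma aeS2 P Q S : (forall t, P t -> Q t -> S t) ->
  {ae mu, forall t, P t} -> {ae mu, forall t, Q t} -> {ae mu, forall t, S t}.
Proof. exact: (@filterS2 _ _ (ae_filter_ringOfSetsType mu)). Qed.

End LebesgueAlmostEverywhere.

Section OneSidedDerivative.
Context {R : realType}.
Implicit Types (f : R -> R) (t d c e L : R).

Lemma is_derive_cvg f t d : is_derive t (1 : R) f d ->
  (fun h : R => h^-1 * (f (h + t) - f t)) @ 0^' --> d.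
Proof.
move=> [/cvg_ex[/= l fl] <-].
have E : (fun h : R => h^-1 *: (f (h *: 1 + t) - f t)) =
    (fun h : R => h^-1 * (f (h + t) - f t)).
  by apply/funext => h; rewrite /GRing.scale/= mulr1.
by rewrite /derive E; rewrite E in fl; rewrite (cvg_lim _ fl).
Qed.

Lemma is_derive_le_right f t d c e : is_derive t (1 : R) f d -> 0 < e ->
  (forall x, t < x < t + e -> f x - f t <= c * (x - t)) -> d <= c.
Proof.
move=> /is_derive_cvg/cvg_dnbhs_at_right fd e0 fc.
apply: (cvgr_to_le fd); near=> h.
have h0 : 0 < h by near: h; exact: nbhs_right_gt.
have he : h < e by near: h; exact: nbhs_right_lt.
rewrite ler_pdivrMl//; apply: le_trans (fc _ _) _; first by apply/andP; split; lra.
by rewrite addrK mulrC.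
Unshelve. all: by end_near. Qed.

Lemma is_derive_le_left f t d c e : is_derive t (1 : R) f d -> 0 < e ->
  (forall x, t - e < x < t -> f t - f x <= c * (t - x)) -> d <= c.
Proof.
move=> /is_derive_cvg/cvg_dnbhs_at_left fd e0 fc.
apply: (cvgr_to_le fd); near=> h.
have h0 : h < 0 by near: h; exact: nbhs_left_lt.
have he : - e < h by near: h; apply: nbhs_left_gt; rewrite oppr_lt0.
rewrite ler_ndivrMl// -[leLHS]opprK -[leRHS]opprK lerN2 opprB.
apply: le_trans (fc _ _) _; first by apply/andP; split; lra.
by rewrite opprD addrCA subrr addr0 mulrN mulrC.
Unshelve. all: by end_near. Qed.

Lemma is_derive_lipschitz f t d L e : is_derive t (1 : R) f d -> 0 < e ->
  (forall x, t - e < x < t + e -> `|f x - f t| <= L * `|x - t|) -> `|d| <= L.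
Proof.
move=> fd e0 fL.
have H x : t < x < t + e -> `|f x - f t| <= L * (x - t).
  move=> /andP[tx xe]; rewrite -[x - t in leRHS]gtr0_norm ?subr_gt0//.
  by apply: fL; apply/andP; split; lra.
rewrite ler_norml; apply/andP; split.
  rewrite -lerN2 opprK; have fdN := is_deriveN fd.
  apply: (is_derive_le_right fdN e0) => x /H; rewrite ler_norml => /andP[].
  by rewrite !fctE; lra.
by apply: (is_derive_le_right fd e0) => x /H; rewrite ler_norml => /andP[].
Qed.
End OneSidedDerivative.

(** * Lipschitz functions are integrals of bounded densities *)

Section StieltjesDensity.
Context {R : realType}.
Notation mu := (@lebesgue_measure R).

Lemma stieltjes_ocitv (f : cumulative R R) (a b : R) : a <= b ->
  lebesgue_stieltjes_measure f `]a, b]%classic = (f b - f a)%:E.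
Proof.
move=> ab; rewrite /lebesgue_stieltjes_measure /measure_extension/=.
rewrite measurable_mu_extE/=; last exact: is_ocitv.
by rewrite wlength_itv_bnd.
Qed.

Lemma lipschitz_continuous (f : R -> R) (L : R) :
  (forall s t, `|f s - f t| <= L * `|s - t|) -> continuous f.
Proof.
move=> Lf x; apply/cvgrPdist_le => /= e e0.
have K0 : 0 < `|L| + 1 by rewrite ltr_wpDl.
near=> y; have xy : `|x - y| <= e / (`|L| + 1).
  by near: y; apply: cvgr_dist_le => //; rewrite divr_gt0.
apply: (le_trans (Lf _ _)); move: xy; rewrite ler_pdivlMr// mulrC.
apply: le_trans; apply: ler_wpM2r => //.
by rewrite (le_trans (ler_norm _))// lerDl.
Unshelve. all: by end_near. Qed.

(** The measures of [F] and [G] add up to [K] times Lebesgue measure, by uniqueness on half-open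
    intervals; dropping the measure of [G] leaves the bound. *)
Lemma stieltjes_lipschitz (F G : cumulative R R) (K : R) : 0 < K ->
  (forall x, F x + G x = K * x) ->
  forall A, measurable A ->
    (lebesgue_stieltjes_measure F A <= K%:E * mu A)%E.
Proof.
move=> K0 FG A mA.
have Ki : 0 <= K^-1 by rewrite invr_ge0 ltW.
pose nu := mscale (NngNum Ki) (measure_add (lebesgue_stieltjes_measure F)
  (lebesgue_stieltjes_measure G)).
have -> : mu A = nu A.
  apply: lebesgue_measure_unique => // X [[x y]] _ <-/=.
  have [xy|yx] := leP x y; last first.
    by rewrite set_itv_ge ?measure0// bnd_simp -leNgt ltW.
  rewrite lebesgue_measure_itv/= lte_fin.
  move: xy; rewrite le_eqVlt => /predU1P[->|xy].
    by rewrite ltxx set_itv_ge ?measure0// bnd_simp ltxx.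
  rewrite xy /nu /mscale/= /measure_add /msum 2!big_ord_recl big_ord0 /= adde0 !stieltjes_ocitv ?ltW//.
  rewrite -EFinD -EFinM; congr (_%:E).
  have := FG x; have := FG y => h1 h2.
  have -> : F y - F x + (G y - G x) = K * (y - x) by lra.
  by rewrite mulKf// gt_eqF.
rewrite /nu /mscale/= /measure_add /msum 2!big_ord_recl big_ord0 /= adde0 muleA -EFinM divff ?gt_eqF// mul1e.
by rewrite leeDl.
Qed.

Lemma bounded_integrable (f : R -> R) (K a b : R) :
  measurable_fun `[a, b] f -> (forall t, a <= t <= b -> `|f t| <= K) ->
  mu.-integrable `[a, b] (EFin \o f).
Proof.
move=> mf fK; apply: measurable_bounded_integrable => //.
  by rewrite /= lebesgue_measure_itv/=; case: ifP => _; rewrite -?EFinB ltry.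
exists K; split; first exact: num_real.
move=> M KM t /= tab; apply: le_trans (ltW KM); apply: fK.
by move: tab; rewrite in_itv.
Qed.

Lemma Rintegral_itv_cst (a b k : R) : a <= b ->
  \int[mu]_(t in `[a, b]) k = k * (b - a).
Proof.
move=> ab; rewrite Rintegral_cst//= lebesgue_measure_itv/= lte_fin.
by case: ltP => // ba; rewrite (_ : a = b) ?subrr//; apply/le_anti/andP.
Qed.

Lemma eq_Rintegral_ae (f g : R -> R) (a b : R) :
  mu.-integrable `[a, b] (EFin \o f) -> mu.-integrable `[a, b] (EFin \o g) ->
  {ae mu, forall t, a < t < b -> f t = g t} ->
  \int[mu]_(t in `[a, b]) f t = \int[mu]_(t in `[a, b]) g t.
Proof.
move=> fi gi fg; rewrite -!(@Rintegral_itv_obnd_cbnd _ a); last 2 first.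
- by apply: integrableS gi => //; apply: subset_itv; rewrite bnd_simp.
- by apply: integrableS fi => //; apply: subset_itv; rewrite bnd_simp.
rewrite -!Rintegral_itv_bndo_bndc; last 2 first.
- by apply: integrableS gi => //; apply: subset_itv; rewrite bnd_simp.
- by apply: integrableS fi => //; apply: subset_itv; rewrite bnd_simp.
have sub : `]a, b[%classic `<=` (`[a, b]%classic : set R).
  by apply: subset_itv; rewrite bnd_simp.
rewrite /Rintegral; congr fine; apply: ae_eq_integral => //.
- by apply: (measurable_int mu); apply: integrableS fi.
- by apply: (measurable_int mu); apply: integrableS gi.
- by move: fg; apply: aeS => t H; rewrite /= in_itv/= => /H ->.
Qed.

Lemma le_Rintegral_ae (f g : R -> R) (a b : R) :
  mu.-integrable `[a, b] (EFin \o f) -> mu.-integrable `[a, b] (EFin \o g) ->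
  {ae mu, forall t, a < t < b -> f t <= g t} ->
  \int[mu]_(t in `[a, b]) f t <= \int[mu]_(t in `[a, b]) g t.
Proof.
move=> fi gi fg.
(* [f \max g] agrees with [g] almost everywhere and dominates [f] everywhere, so the pointwise
   comparison of integrals applies to it. *)
have mi : mu.-integrable `[a, b] (EFin \o (f \max g)).
  have sum_i : mu.-integrable `[a, b] ((abse \o (EFin \o f)) \+ (abse \o (EFin \o g)))%E.
    by apply: integrableD => //; exact: integrable_abse.
  apply: le_integrable sum_i => //.
    apply/measurable_EFinP; apply: measurable_maxr; apply/measurable_EFinP.
      exact: (measurable_int mu fi).
    exact: (measurable_int mu gi).
  move=> t _ /=; rewrite !lee_fin [leRHS]ger0_norm ?addr_ge0// /Num.max.
  by case: ifP => _; rewrite ?lerDl ?lerDr.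
rewrite (@eq_Rintegral_ae g (f \max g))//.
  by apply: le_Rintegral => // t _; rewrite /= le_max lexx.
by move: fg; apply: aeS => t H /H fg; rewrite /= max_r.
Qed.

Lemma Rintegral_itv_split (f : R -> R) (a b c : R) : a <= b -> b <= c ->
  mu.-integrable `[a, c] (EFin \o f) ->
  \int[mu]_(t in `[a, c]) f t =
  \int[mu]_(t in `[a, b]) f t + \int[mu]_(t in `[b, c]) f t.
Proof.
move=> ab bc fi; rewrite -[X in _ + X]Rintegral_itv_obnd_cbnd; last first.
  by apply: integrableS fi => //; apply: subset_itv; rewrite bnd_simp.
by rewrite -(@Rintegral_itvB _ f (BLeft a) (BRight c) b) ?bnd_simp// subrKC.
Qed.

(** Adding [L * x] makes [f] nondecreasing, and the Stieltjes measure of the sum is absolutely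
    continuous; its Radon-Nikodym density minus [L] is the density of [f], and the derivative of [f]
    almost everywhere by Lebesgue differentiation. *)
Lemma lipschitz_density (f : R -> R) (L a b : R) : 0 < L -> a < b ->
  (forall s t, a <= s <= b -> a <= t <= b -> `|f s - f t| <= L * `|s - t|) ->
  exists g : R -> R,
    [/\ measurable_fun setT g, forall t, `|g t| <= L,
        forall s t, a <= s -> s <= t -> t <= b ->
          f t - f s = \int[mu]_(x in `[s, t]) g x &
        {ae mu, forall t, a < t < b -> is_derive t 1 f (g t)}].
Proof.
move=> L0 ab Lf.
pose cl x := Num.max a (Num.min x b).
have cl_in x : a <= cl x <= b.
  by rewrite /cl le_max lexx/= ge_max (ltW ab)/= ge_min lexx orbT.
have clE x : a <= x -> x <= b -> cl x = x.
  by move=> ax xb; rewrite /cl min_l// max_r.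
have cl_nd x y : x <= y -> cl x <= cl y.
  move=> xy; rewrite /cl ge_max le_max lexx/= le_max.
  by apply/orP; right; rewrite le_min !ge_min xy lexx orbT.
have cl_lip x y : x <= y -> cl y - cl x <= y - x.
  move=> xy; rewrite /cl.
  case: (leP x b) => xb; case: (leP y b) => yb; rewrite ?(max_r (ltW ab));
    by try case: (leP a x) => ax; try case: (leP a y) => ay; lra.
(* Clamping to [[a, b]] extends the monotone function to the whole line. [G] is its complement to
   [2 L x], monotone as well, as the domination by Lebesgue measure requires. *)
pose F x := f (cl x) + L * cl x; pose G x := 2 * L * x - F x.
have clL x y : x <= y -> `|f (cl y) - f (cl x)| <= L * (cl y - cl x).
  move=> xy; rewrite -[leRHS](_ : L * `|cl y - cl x| = _) ?Lf//.
  by rewrite ger0_norm// subr_ge0 cl_nd.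
have F_nd : nondecreasing F.
  by move=> x y xy; have := clL _ _ xy; rewrite /F ler_norml => /andP[h _]; lra.
have G_nd : nondecreasing G.
  move=> x y xy; have := clL _ _ xy; rewrite /G /F ler_norml => /andP[_ h].
  have := ler_wpM2l (ltW L0) (cl_lip _ _ xy); lra.
have F_lip x y : `|F x - F y| <= 2 * L * `|x - y|.
  wlog xy : x y / y <= x => [H|].
    have [/H//|/ltW/H] := leP y x.
    by rewrite distrC [in leRHS]distrC.
  rewrite ger0_norm ?subr_ge0 ?F_nd// ger0_norm ?subr_ge0//.
  by have := G_nd _ _ xy; rewrite /G; lra.
have F_c : continuous F by exact: lipschitz_continuous F_lip.
have G_c : continuous G.
  move=> x; apply: cvgB; last exact: F_c.
  by apply: cvgMr; exact: cvg_id.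
pose Fc : cumulative R R := HB.pack F
  (isCumulative.Build R _ R F F_nd (right_continuousW F_c)).
pose Gc : cumulative R R := HB.pack G
  (isCumulative.Build R _ R G G_nd (right_continuousW G_c)).
have K0 : 0 < 2 * L by lra.
have dom := @stieltjes_lipschitz Fc Gc _ K0 (fun x => subrKC _ _).
(* [F] is constant outside [[a, b]]; the restriction makes the measure visibly finite for
   Radon-Nikodym. *)
pose D := `]a, b]%classic : set (measurableTypeR R).
have mD : measurable D by exact: measurable_itv.
have finD : (lebesgue_stieltjes_measure Fc D < +oo)%E.
  by rewrite stieltjes_ocitv ?ltW// ltry.
pose nu := mfrestr mD finD.
have nu_dom : nu `<< mu.
  apply/null_content_dominatesP => A mA A0.
  apply/eqP; rewrite -measure_le0 /nu /mfrestr /mrestr.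
  apply: (le_trans (dom _ (measurableI _ _ mA mD))).
  apply: (@le_trans _ _ ((2 * L)%:E * mu A)%E); last by rewrite A0 mule0.
  rewrite lee_pmul2l ?lte_fin//; apply: le_measure; rewrite ?inE//.
  exact: measurableI.
have [g0 [g0_ge0 g0_fin g0_int g0E]] :=
  @radon_nikodym_sigma_finite _ _ _ mu nu nu_dom.
have g0h : g0 = EFin \o (fine \o g0).
  by apply/funext => t /=; rewrite fineK.
pose h := fine \o g0; rewrite g0h -/h in g0_int g0E.
have mh : measurable_fun setT h by apply/measurable_EFinP; case/integrableP: g0_int.
have hint A : measurable A -> mu.-integrable A (EFin \o h).
  by move=> mA; exact: integrableS g0_int.
have nuE s t : a <= s -> s <= t -> t <= b ->
    f t - f s + L * (t - s) = \int[mu]_(x in `[s, t]) h x.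
  move=> sa st tb; rewrite -Rintegral_itv_obnd_cbnd; last exact: hint.
  rewrite /Rintegral -[X in fine X]g0E; last exact: measurable_itv.
  transitivity (fine (lebesgue_stieltjes_measure Fc (`]s, t] `&` D)%classic)) => //.
  rewrite setIidl; last by apply: subset_itv; rewrite bnd_simp.
  have at_ := le_trans sa st; have sb := le_trans st tb.
  by rewrite stieltjes_ocitv//= /F !clE//; ring.
(* The density satisfies the bound [L] only almost everywhere; truncation makes it hold at every
   time. *)
pose cp y := Num.max (- L) (Num.min L y).
have cp_bd y : `|cp y| <= L.
  by rewrite ler_norml /cp le_max lexx/= ge_max ge_min lexx andbT; lra.
have cpE y : `|y| <= L -> cp y = y.
  by rewrite ler_norml => /andP[h1 h2]; rewrite /cp min_r// max_r.
pose g t := cp (h t - L).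
have mg : measurable_fun setT g.
  apply: measurable_maxr => //; apply: measurable_minr => //.
  exact: measurable_funB.
have h_loc : locally_integrable [set: R] h.
  by apply: open_integrable_locally => //; exact: openT.
have der : {ae mu, forall t, a < t < b -> is_derive t 1 f (h t - L)}.
  have := FTC1 (a := BLeft a) (fun y => hint _ (measurable_itv _)) h_loc.
  apply: aeS => t H /andP[at_ tb].
  have {H}[|dF F'] := H; first by rewrite lte_fin.
  have E1 : \forall y \near t, \int[mu]_(u in `[a, y]) h u + f a - L * (y - a) = f y.
    near=> y; rewrite -nuE//; first by ring.
      by near: y; exact: lt_le_nbhsr.
    by apply: ltW; near: y; exact: lt_nbhsl.
  apply: (near_eq_is_derive E1).
  have {}F' : is_derive t 1 (fun y => \int[mu]_(u in `[a, y]) h u) (h t).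
    split; first exact: dF.
    by have := derive1E (fun y => \int[mu]_(u in `[a, y]) h u) t => <-.
  by apply: is_derive_eq; rewrite /GRing.scale/=; ring.
have der_g : {ae mu, forall t, a < t < b -> g t = h t - L}.
  move: der; apply: aeS => t + tab => /(_ tab) dt.
  apply: cpE; case/andP: tab => at_ tb.
  have e0 : 0 < Num.min (t - a) (b - t) by rewrite lt_min !subr_gt0 at_ tb.
  apply: (is_derive_lipschitz dt e0) => x; rewrite ltrBlDr -ltrBlDl.
  rewrite -[x < _]ltrBlDl !lt_min => /andP[/andP[? _] /andP[_ ?]].
  by apply: Lf; lra.
exists g; split => //; first 2 last.
- by apply: aeS2 der der_g => t H gE tab; rewrite gE//; exact: H.
- by move=> t; exact: cp_bd.
move=> s t sa st tb.
have hI : mu.-integrable `[s, t] (EFin \o h) by exact: hint.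
have cI : mu.-integrable `[s, t] (EFin \o (fun=> L)).
  by apply: (@bounded_integrable _ `|L|).
have gI : mu.-integrable `[s, t] (EFin \o g).
  by apply: (@bounded_integrable _ L) => [|u _]; [exact: measurable_funTS mg|exact: cp_bd].
have -> : f t - f s = \int[mu]_(x in `[s, t]) (h x - L).
  rewrite (RintegralB _ hI cI)// -nuE// Rintegral_itv_cst//; ring.
apply: eq_Rintegral_ae => //.
  by apply: (integrableB _ hI cI).
by move: der_g; apply: aeS => u H /andP[su ut]; apply/esym/H; apply/andP; split; lra.
Unshelve. all: by end_near. Qed.

End StieltjesDensity.

(** * Almost everywhere differential calculus on intervals *)

Section LipschitzCalculus.
Context {R : realType}.
Notation mu := (@lebesgue_measure R).
Implicit Types (f g k : R -> R) (a b c t : R).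

Definition lip a b f := exists L, forall s t, a <= s <= b -> a <= t <= b ->
  `|f s - f t| <= L * `|s - t|.

(** A class of integrands that contains the Lipschitz functions and is stable under sums and
    products, so that integrability always follows from the shape of the integrand. *)
Definition bmeas a b f := measurable_fun `[a, b] f /\
  exists K, forall t, a <= t <= b -> `|f t| <= K.

Lemma lipW a b f : lip a b f -> exists2 L, 0 < L &
  forall s t, a <= s <= b -> a <= t <= b -> `|f s - f t| <= L * `|s - t|.
Proof.
move=> [L fL]; exists (`|L| + 1) => [|s t sab tab]; first by rewrite ltr_wpDl.
apply: (le_trans (fL _ _ sab tab)); apply: ler_wpM2r => //.
by rewrite (le_trans (ler_norm _))// lerDl.
Qed.

Lemma lip_sub a b a' b' f : a <= a' -> b' <= b -> lip a b f -> lip a' b' f.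
Proof.
move=> aa bb [L fL]; exists L => s t /andP[? ?] /andP[? ?].
by apply: fL; apply/andP; split; lra.
Qed.

Lemma lip_cst a b c : lip a b (fun=> c).
Proof. by exists 0 => s t _ _; rewrite subrr normr0 mul0r. Qed.

Lemma lip_id a b : lip a b id.
Proof. by exists 1 => s t _ _; rewrite mul1r. Qed.

Lemma lipD a b f g : lip a b f -> lip a b g -> lip a b (fun t => f t + g t).
Proof.
move=> [L fL] [L' gL]; exists (L + L') => s t sab tab.
rewrite (_ : f s + g s - _ = (f s - f t) + (g s - g t)); last by ring.
by rewrite mulrDl (le_trans (ler_normD _ _))// lerD ?fL ?gL.
Qed.

Lemma lipN a b f : lip a b f -> lip a b (fun t => - f t).
Proof.
move=> [L fL]; exists L => s t sab tab.
by rewrite -opprD normrN fL.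
Qed.

Lemma lip_bound a b f : lip a b f -> exists2 K, 0 <= K &
  forall t, a <= t <= b -> `|f t| <= K.
Proof.
move=> /lipW[L L0 fL]; have [ab|ba] := leP a b; last first.
  by exists 0 => // t /andP[at_ tb]; move: (le_trans at_ tb); rewrite leNgt ba.
exists (`|f a| + L * (b - a)).
  by rewrite addr_ge0// mulr_ge0 ?subr_ge0// ltW.
move=> t /andP[at_ tb]; rewrite -[f t](subrK (f a)) addrC.
rewrite (le_trans (ler_normD _ _))// lerD2l.
apply: (le_trans (fL _ _ _ _)); rewrite ?lexx ?at_ ?tb ?ab//.
by rewrite ler_pM2l// ger0_norm ?subr_ge0// lerB.
Qed.

Lemma lipM a b f g : lip a b f -> lip a b g -> lip a b (fun t => f t * g t).
Proof.
move=> fl gl; have [K K0 fK] := lip_bound fl; have [K' K'0 gK] := lip_bound gl.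
have [L L0 fL] := lipW fl; have [L' L'0 gL] := lipW gl.
exists (K * L' + K' * L) => s t sab tab.
rewrite (_ : f s * g s - _ = f s * (g s - g t) + g t * (f s - f t)); last by ring.
rewrite (le_trans (ler_normD _ _))// !normrM mulrDl -!mulrA.
by rewrite lerD// ler_pM ?fK ?gK ?fL ?gL.
Qed.

Lemma lip_sum a b (I : Type) (r : seq I) (F : I -> R -> R) :
  (forall i, lip a b (F i)) -> lip a b (fun t => \sum_(i <- r) F i t).
Proof.
move=> Fl; elim: r => [|i r IH].
  by under eq_fun do rewrite big_nil; exact: lip_cst.
by under eq_fun do rewrite big_cons; exact: lipD.
Qed.

Lemma lip_clamp a b f : a <= b -> lip a b f ->
  exists2 F : R -> R, continuous F & forall t, a <= t <= b -> F t = f t.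
Proof.
move=> ab /lipW[L L0 fL]; pose cl x := Num.max a (Num.min x b).
have cl_in x : a <= cl x <= b.
  by rewrite /cl le_max lexx/= ge_max ab/= ge_min lexx orbT.
exists (f \o cl) => [|t /andP[at_ tb]]; last by rewrite /= /cl min_l// max_r.
apply: (@lipschitz_continuous _ _ L) => s t /=.
apply: (le_trans (fL _ _ (cl_in _) (cl_in _))); rewrite ler_pM2l//.
wlog st : s t / s <= t => [H|].
  have [/H//|/ltW/H] := leP s t.
  by rewrite distrC [in leRHS]distrC.
have cl_nd : cl s <= cl t.
  rewrite /cl ge_max le_max lexx/= le_max.
  by apply/orP; right; rewrite le_min !ge_min st lexx orbT.
rewrite distrC [in leRHS]distrC !ger0_norm ?subr_ge0//.
rewrite /cl; case: (leP s b) => sb; case: (leP t b) => tb; rewrite ?(max_r ab);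
  by try case: (leP a s) => ?; try case: (leP a t) => ?; lra.
Qed.

Lemma bmeas_lip a b f : lip a b f -> bmeas a b f.
Proof.
move=> fl; split; last by have [K _ fK] := lip_bound fl; exists K.
have [ab|ba] := leP a b; last first.
  by rewrite set_itv_ge ?bnd_simp -?ltNge//; exact: measurable_fun_set0.
have [F Fc FE] := lip_clamp ab fl.
apply: (@eq_measurable_fun _ _ _ _ _ F).
  by move=> t; rewrite inE/= in_itv/= => /FE.
by apply: measurable_funTS; exact: continuous_measurable_fun.
Qed.

Lemma bmeas_cst a b c : bmeas a b (fun=> c).
Proof. exact/bmeas_lip/lip_cst. Qed.

Lemma bmeasD a b f g : bmeas a b f -> bmeas a b g ->
  bmeas a b (fun t => f t + g t).
Proof.
move=> [mf [K fK]] [mg [K' gK]]; split; first exact: measurable_funD.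
exists (K + K') => t tab.
by rewrite (le_trans (ler_normD _ _))// lerD ?fK ?gK.
Qed.

Lemma bmeasN a b f : bmeas a b f -> bmeas a b (fun t => - f t).
Proof.
move=> [mf [K fK]]; split; first exact: measurableT_comp.
by exists K => t tab; rewrite normrN fK.
Qed.

Lemma bmeasM a b f g : bmeas a b f -> bmeas a b g ->
  bmeas a b (fun t => f t * g t).
Proof.
move=> [mf [K fK]] [mg [K' gK]]; split; first exact: measurable_funM.
exists (K * K') => t tab.
by rewrite normrM ler_pM ?fK ?gK.
Qed.

Lemma bmeas_sum a b (I : Type) (r : seq I) (F : I -> R -> R) :
  (forall i, bmeas a b (F i)) -> bmeas a b (fun t => \sum_(i <- r) F i t).
Proof.
move=> Fl; elim: r => [|i r IH].
  by under eq_fun do rewrite big_nil; exact: bmeas_cst.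
by under eq_fun do rewrite big_cons; exact: bmeasD.
Qed.

Lemma bmeas_sub a b a' b' f : a <= a' -> b' <= b -> bmeas a b f -> bmeas a' b' f.
Proof.
move=> aa bb [mf [K fK]]; split.
  apply: measurable_funS mf => //; apply: subset_itv; rewrite bnd_simp//.
by exists K => t /andP[? ?]; apply: fK; apply/andP; split; lra.
Qed.

Lemma bmeas_integrable a b f : bmeas a b f -> mu.-integrable `[a, b] (EFin \o f).
Proof. by move=> [mf [K fK]]; exact: bounded_integrable fK. Qed.

Lemma bmeas_RintegralD a b f g : bmeas a b f -> bmeas a b g ->
  \int[mu]_(t in `[a, b]) (f t + g t) =
  \int[mu]_(t in `[a, b]) f t + \int[mu]_(t in `[a, b]) g t.
Proof. by move=> bf bg; rewrite RintegralD//; exact: bmeas_integrable. Qed.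

Lemma bmeas_RintegralZ a b c f : bmeas a b f ->
  \int[mu]_(t in `[a, b]) (c * f t) = c * \int[mu]_(t in `[a, b]) f t.
Proof. by move=> bf; rewrite RintegralZl//; exact: bmeas_integrable. Qed.

Lemma bmeas_RintegralN a b f : bmeas a b f ->
  \int[mu]_(t in `[a, b]) (- f t) = - \int[mu]_(t in `[a, b]) f t.
Proof.
move=> bf; rewrite -mulN1r -bmeas_RintegralZ//.
by apply: eq_Rintegral => t _; rewrite mulN1r.
Qed.

Lemma bmeas_le_Rintegral a b f g : bmeas a b f -> bmeas a b g ->
  {ae mu, forall t, a < t < b -> f t <= g t} ->
  \int[mu]_(t in `[a, b]) f t <= \int[mu]_(t in `[a, b]) g t.
Proof. by move=> bf bg; apply: le_Rintegral_ae; exact: bmeas_integrable. Qed.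

(** A bound on the derivative at almost every time suffices because a Lipschitz function is the
    integral of its density. Every differential inequality along flows is integrated by this lemma
    or its mirror image. *)
Lemma lip_le_Rintegral a b f k : a <= b -> lip a b f -> bmeas a b k ->
  {ae mu, forall t, a < t < b -> exists2 d, is_derive t (1 : R) f d & d <= k t} ->
  f b - f a <= \int[mu]_(t in `[a, b]) k t.
Proof.
rewrite le_eqVlt => /predU1P[->|ab] fl bk fk.
  by rewrite subrr set_itv1 Rintegral_set1.
have [L L0 fL] := lipW fl.
have [g [mg gL gE gd]] := lipschitz_density L0 ab fL.
rewrite (gE a b (lexx _) (ltW ab) (lexx _)); apply: bmeas_le_Rintegral => //.
  by split; [exact: measurable_funTS mg|exists L].
apply: aeS2 gd fk => t gd fk tab; have [d fd dk] := fk tab.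
by have [_ <-] := gd tab; have [_ ->] := fd.
Qed.

Lemma lip_ge_Rintegral a b f k : a <= b -> lip a b f -> bmeas a b k ->
  {ae mu, forall t, a < t < b -> exists2 d, is_derive t (1 : R) f d & k t <= d} ->
  \int[mu]_(t in `[a, b]) k t <= f b - f a.
Proof.
move=> ab fl bk fk.
rewrite -lerN2 -bmeas_RintegralN// opprB.
rewrite (_ : f a - f b = (- f b) - (- f a)); last by ring.
apply: (@lip_le_Rintegral _ _ (fun t => - f t)) => //; first exact: lipN.
  exact: bmeasN.
apply: aeS fk => t fk /fk[d fd kd]; exists (- d); last by rewrite lerN2.
exact: is_deriveN.
Qed.

Lemma lip_le_cst a b f c : a <= b -> lip a b f ->
  {ae mu, forall t, a < t < b -> exists2 d, is_derive t (1 : R) f d & d <= c} ->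
  f b - f a <= c * (b - a).
Proof.
move=> ab fl fc; rewrite -Rintegral_itv_cst//.
exact: (lip_le_Rintegral ab fl (bmeas_cst _ _ _)).
Qed.

(** [r] times the push-forward of Lebesgue measure under the dilation agrees with Lebesgue measure
    on intervals, so preimages of null sets are null. This justifies the time change [s -> mu s]. *)
Lemma ae_scale (P : R -> Prop) (r : R) : 0 < r ->
  {ae mu, forall t, P t} -> {ae mu, forall t, P (r * t)}.
Proof.
move=> r0 [A [mA A0 PA]].
pose rf : R -> measurableTypeR R := *%R r.
have mr : measurable_fun setT rf by exact: mulrl_measurable.
have [nu nuE] : exists nu : {measure set (measurableTypeR R) -> \bar R},
    forall B, nu B = mu (rf @^-1` B).
  by unshelve refine (ex_intro _ (pushforward mu rf : {measure set _ -> \bar R}) _).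
exists (rf @^-1` A); split => //; last by move=> t /= Pt; exact: PA.
  by rewrite -[X in measurable X]setTI; exact: mr.
have muE : mu A = mscale (NngNum (ltW r0)) nu A.
  apply: lebesgue_measure_unique => // X [[x y]] _ <-/=.
  rewrite /mscale/= nuE.
  have -> : rf @^-1` `]x, y]%classic = `]x / r, y / r]%classic.
    apply/seteqP; split=> t /=; rewrite !in_itv/= ltr_pdivrMr// ler_pdivlMr//;
      by rewrite ![t * r]mulrC.
  rewrite !lebesgue_measure_itv/= !lte_fin ltr_pM2r ?invr_gt0//.
  case: ifP => _; last by rewrite mule0.
  by rewrite -!EFinB -EFinM; congr (_%:E); field; rewrite gt_eqF.
move/eqP: muE; rewrite A0 /mscale/= nuE eq_sym mule_eq0 eqe gt_eqF//=.
by move=> /eqP.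
Qed.

Lemma ae_neq a : {ae mu, forall t, t != a}.
Proof.
exists [set a]; split; [exact: measurable_set1|exact: lebesgue_measure_set1|].
by move=> t /= /negP; rewrite negbK => /eqP.
Qed.

Lemma ae_itv_closed a b (P : R -> Prop) :
  {ae mu, forall t, a < t < b -> P t} -> {ae mu, forall t, a <= t <= b -> P t}.
Proof.
move=> H; have abH := aeS2 (fun t tb Ht => conj tb Ht) (ae_neq b) H.
apply: aeS2 (ae_neq a) abH => t ta [tb Ht] /andP[at_ tb']; apply: Ht.
by rewrite !lt_neqAle eq_sym ta at_ tb tb'.
Qed.

(** Markov's inequality: on the set where [f n >= eta] for all [n >= N], the integrals force [eta]
    times its measure to be 0. This is enough to identify an almost everywhere limit, without
    extracting a subsequence. *)
Lemma ae_liminf0 a b (f : nat -> R -> R) : (forall n, bmeas a b (f n)) ->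
  (forall n t, a <= t <= b -> 0 <= f n t) ->
  (fun n => \int[mu]_(t in `[a, b]) f n t) @ \oo --> 0 ->
  {ae mu, forall t, a < t < b ->
    forall e, 0 < e -> forall N, exists2 n, (N <= n)%N & f n t < e}.
Proof.
move=> bf f0 If.
suff H (k : nat) (N : nat) : {ae mu, forall t, a < t < b ->
    exists2 n, (N <= n)%N & f n t < k.+1%:R^-1}.
  have := ae_foralln (fun k : nat => ae_foralln (H k)).
  apply: aeS => t Ht tab e e0 N.
  have [k ke] : exists k : nat, k.+1%:R^-1 < e.
    have [k _ /(_ k (leqnn _))] := near_infty_natSinv_lt (PosNum e0).
    by exists k.
  by have [n Nn fn] := Ht k N tab; exists n => //; exact: lt_trans ke.
set eta : R := k.+1%:R^-1; have eta0 : 0 < eta by rewrite invr_gt0.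
pose A := `[a, b]%classic `&` \bigcap_(n in [set n | (N <= n)%N])
  (`[a, b]%classic `&` f n @^-1` `[eta, +oo[%classic).
have mI : measurable (`[a, b]%classic : set (measurableTypeR R)).
  exact: measurable_itv.
have mA : measurable (A : set (measurableTypeR R)).
  apply: measurableI => //; apply: bigcap_measurable => [|n Nn].
    by exists N => /=.
  by have [mf _] := bf n; apply: mf => //; exact: measurable_itv.
have Aab t : A t -> a <= t <= b by move=> [+ _]; rewrite /= in_itv.
exists A; split => //; last first.
  move=> t /=; rewrite not_implyE => -[/andP[at_ tb] Hn].
  have tab : t \in `[a, b] by rewrite in_itv/= !ltW.
  split => // n /= Nn; split => //.
  by rewrite in_itv/= andbT leNgt; apply/negP => fn; apply: Hn; exists n.
have AI : A `<=` `[a, b] by move=> t [].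
have finA : mu A \is a fin_num.
  rewrite ge0_fin_numE//; apply: (@le_lt_trans _ _ (mu `[a, b]%classic)).
    by apply: le_measure; rewrite ?inE.
  by rewrite /= lebesgue_measure_itv/=; case: ifP => _; rewrite -?EFinB ltry.
have le n : (N <= n)%N -> eta * fine (mu A) <= \int[mu]_(t in `[a, b]) f n t.
  move=> Nn; rewrite -lee_fin EFinM fineK// /Rintegral fineK; last first.
    exact/integrable_fin_num/bmeas_integrable.
  rewrite -integral_cst//.
  have mfn := measurable_int mu (bmeas_integrable (bf n)).
  apply: (@le_trans _ _ (\int[mu]_(t in A) (f n t)%:E)%E).
    apply: ge0_le_integral => //.
    - by move=> t _; rewrite /= lee_fin ltW.
    - exact: measurable_funS mfn.
    - move=> t [_ /(_ n Nn)[_ +]].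
      by rewrite /= in_itv/= andbT => etaf; rewrite lee_fin.
  by apply: ge0_subset_integral => // t; rewrite /= in_itv/= lee_fin; exact: f0.
suff : eta * fine (mu A) <= 0.
  rewrite pmulr_rle0// => A0; apply/eqP; rewrite eq_le measure_ge0 andbT.
  by rewrite -(fineK finA) lee_fin.
apply: (cvgr_to_ge If); exists N => // n /=; exact: le.
Qed.

Lemma dominated_Rintegral_cvg0 a b (f : nat -> R -> R) (K : R) :
  (forall n, bmeas a b (f n)) ->
  (forall n t, a <= t <= b -> `|f n t| <= K) ->
  {ae mu, forall t, a < t < b -> (fun n => f n t) @ \oo --> 0} ->
  (fun n => \int[mu]_(t in `[a, b]) f n t) @ \oo --> 0.
Proof.
move=> bf fK f0.
have mI : measurable (`[a, b]%classic : set (measurableTypeR R)).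
  exact: measurable_itv.
have f0' : {ae mu, forall t, `[a, b]%classic t ->
    (fun n => (f n t)%:E) @ \oo --> 0%E}.
  apply: aeS (ae_itv_closed f0) => t H; rewrite /= in_itv/= => /H ft.
  by apply/fine_cvgP; split; [exact: nearW|].
have K_int : mu.-integrable `[a, b] (EFin \o (fun=> K)).
  exact/bmeas_integrable/bmeas_cst.
have [|||_ _ +] := dominated_convergence mI (f_ := fun n t => (f n t)%:E)
    (f := fun=> 0%E) _ _ f0' K_int.
- move=> n; exact: (measurable_int mu (bmeas_integrable (bf n))).
- exact: measurable_cst.
- by apply: aeW => t n; rewrite /= in_itv/= lee_fin; exact: fK.
rewrite integral0 => H; exact: fine_cvg H.
Qed.

End LipschitzCalculus.

(** * Gradient flows in dual variables *)

Section VectorLipschitz.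
Context {R : realType} {d : nat}.
Notation mu := (@lebesgue_measure R).
Implicit Types (w : R -> 'cV[R]_d) (A P : 'M[R]_d).

Definition vlip (a b : R) w := forall i, lip a b (fun t => w t i 0).

Lemma vlip_cst a b v : vlip a b (fun=> v).
Proof. by move=> i; exact: lip_cst. Qed.

Lemma vlipB a b w1 w2 : vlip a b w1 -> vlip a b w2 ->
  vlip a b (fun t => w1 t - w2 t).
Proof.
move=> l1 l2 i; under eq_fun do rewrite !mxE.
by apply: lipD (l1 i) _; exact: lipN.
Qed.

Lemma vlip_mulmx a b A w : vlip a b w -> vlip a b (fun t => A *m w t).
Proof.
move=> lw i; under eq_fun do rewrite mxE.
by apply: lip_sum => j; apply: lipM (lw j); exact: lip_cst.
Qed.

Lemma lip_dot a b w1 w2 : vlip a b w1 -> vlip a b w2 ->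
  lip a b (fun t => dot (w1 t) (w2 t)).
Proof. by move=> l1 l2; apply: lip_sum => i; exact: lipM. Qed.

Lemma lip_pform a b P w1 w2 : vlip a b w1 -> vlip a b w2 ->
  lip a b (fun t => pform P (w1 t) (w2 t)).
Proof. by move=> l1 l2; apply: lip_dot => //; exact: vlip_mulmx. Qed.

(** A nonempty open interval is not negligible, so good times exist arbitrarily soon after [s],
    including after [s = 0]. *)
Lemma ae_exists (G : R -> Prop) (s e : R) :
  {ae mu, forall t : R, 0 < t -> G t} -> 0 <= s -> 0 < e ->
  exists2 t, s < t < s + e & G t.
Proof.
move=> [A [mA A0 GA]] s0 e0; apply: contrapT => nG.
have sub : `]s, (s + e)[ `<=` A.
  move=> t; rewrite /= in_itv/= => ste; apply: GA => /= Gt; apply: nG.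
  by exists t => //; apply: Gt; case/andP: ste => st _; exact: le_lt_trans st.
have : (mu `]s, (s + e)%R[%classic <= mu A)%E by apply: le_measure; rewrite ?inE.
rewrite A0 /= lebesgue_measure_itv/= lte_fin ltrDl e0 -EFinD lee_fin.
by rewrite addrAC subrr add0r leNgt e0.
Qed.

Lemma lip_ae_derive (f : R -> R) : (forall b, lip 0 b f) ->
  {ae mu, forall t : R, 0 < t -> exists D, is_derive t (1 : R) f D}.
Proof.
move=> fl; have H n : {ae mu, forall t : R, 0 < t < n.+1%:R ->
    exists D, is_derive t (1 : R) f D}.
  have [L L0 fL] := lipW (fl n.+1%:R).
  have [g [_ _ _]] := lipschitz_density L0 (ltr0Sn _ n) fL.
  by apply: aeS => t H /H; exists (g t).
apply: aeS (ae_foralln H) => t Ht t0.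
have [n nt] : exists n : nat, t < n.+1%:R.
  by exists (Num.truncn t); rewrite truncnS_gt.
by apply: (Ht n); rewrite t0.
Qed.
End VectorLipschitz.

Section AbstractFlow.
Context {R : realType} {d : nat}.
Notation mu := (@lebesgue_measure R).
Variables (M P : 'M[R]_d) (u0 : 'cV[R]_d).
Hypotheses (hM : psd_mx M) (hP : psd_mx P) (MPM : M *m P *m M = M).
Variables (C : set 'cV[R]_d) (g : 'cV[R]_d -> R).
Hypothesis C0 : C !=set0.
Implicit Types (w : R -> 'cV[R]_d) (v x u : 'cV[R]_d).

(* conj_val v is g^*(v) - <v, u0>, with g extended by +oo outside C, and conj_le
   bounds it; it replaces conj_val when finiteness is not yet known. *)
Definition conj_le v (al : R) := forall x, C x -> dot v (x - u0) - g x <= al.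

Definition conj_val v := sup [set dot v (x - u0) - g x | x in C].

(* With q = M u0 the gradient of the loss at x is M(x - u0), and u stands for
   x - u0. Only M u matters, so subgradients are tested along colspan M only. *)
Definition abstract_flow w :=
  (exists L, forall s t : R, 0 <= s -> 0 <= t -> `|w s - w t| <= L * `|s - t|) /\
  {ae mu, forall t : R, 0 < t -> exists u,
    [/\ is_derive t (1 : R) w (- (M *m u)), (exists al, conj_le (w t) al) &
      forall v al, colspan M (v - w t) -> conj_le v al ->
        conj_le (w t) (al - dot u (v - w t))]}.

Lemma conj_valP v al : conj_le v al -> conj_le v (conj_val v).
Proof.
move=> val x Cx; apply: sup_upper_bound; last by exists x.
split; first by have [y Cy] := C0; exists (dot v (y - u0) - g y), y.
by exists al => _ [y Cy <-]; exact: val.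
Qed.

Lemma conj_val_le v al : conj_le v al -> conj_val v <= al.
Proof.
move=> val; apply: ge_sup.
  by have [y Cy] := C0; exists (dot v (y - u0) - g y), y.
by move=> _ [y Cy <-]; exact: val.
Qed.

Lemma conj_leW v al be : al <= be -> conj_le v al -> conj_le v be.
Proof. by move=> ab val x Cx; exact: le_trans (val x Cx) ab. Qed.

Lemma nneg_vlip w (L : R) :
  (forall s t : R, 0 <= s -> 0 <= t -> `|w s - w t| <= L * `|s - t|) ->
  forall b, vlip 0 b w.
Proof.
move=> wL b i; exists L => s t /andP[s0 _] /andP[t0 _].
apply: le_trans (wL _ _ s0 t0).
by have := coord_le (w s - w t) i; rewrite !mxE.
Qed.

Lemma is_derive_norm_le w (L t : R) v :
  (forall s t : R, 0 <= s -> 0 <= t -> `|w s - w t| <= L * `|s - t|) ->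
  0 <= L -> 0 < t -> is_derive t (1 : R) w v -> `|v| <= L.
Proof.
move=> wL L0 t0 dw; apply: norm_col_le => // i.
apply: (is_derive_lipschitz (is_derive_coord i dw) t0) => x /andP[x0 _].
apply: le_trans (wL _ _ _ (ltW t0)); last by lra.
by have := coord_le (w x - w t) i; rewrite !mxE.
Qed.

Section FlowProperties.
Variable w : R -> 'cV[R]_d.
Hypothesis fw : abstract_flow w.

Lemma flow_vlip b : vlip 0 b w.
Proof. by have [[L wL] _] := fw; exact: nneg_vlip wL b. Qed.

(** [1 - M P] annihilates every velocity [- M u], so its product with [w] has zero derivative almost
    everywhere and is constant. *)
Lemma flow_colspan (s t : R) : 0 <= s -> 0 <= t -> colspan M (w t - w s).
Proof.
wlog st : s t / s <= t => [H s0 t0|s0 t0].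
  have [/H|/ltW/H] := leP s t; first exact.
  by move=> H'; rewrite -opprB; apply: colspanN; exact: H'.
apply/(colspanE MPM).
pose A := 1%:M - M *m P.
suff : A *m w t = A *m w s.
  rewrite /A !mulmxBl !mul1mx => E; rewrite mulmxA mulmxBr.
  move/eqP: E; rewrite subr_eq => /eqP Ewt.
  by rewrite [in RHS]Ewt [RHS]addrC !addrA addNr add0r addrC.
have wl : vlip s t (fun r => A *m w r).
  by apply: vlip_mulmx => i; apply: lip_sub (flow_vlip t i).
have dA : {ae mu, forall r : R, s < r < t -> is_derive r (1 : R) (fun r => A *m w r) 0}.
  have [_] := fw; apply: aeS => r Hr /andP[sr _].
  have [|u [dw _ _]] := Hr; first exact: le_lt_trans sr.
  have := is_derive_mulmx A dw.
  by rewrite mulmxN mulmxBl mul1mx mulmxA MPM subrr oppr0.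
apply/colP => i; apply/eqP; rewrite -subr_eq0; apply/eqP/le_anti/andP; split.
  rewrite -[leRHS](mul0r (t - s)); apply: (lip_le_cst st (wl i)).
  apply: aeS dA => r H /H dr; exists 0 => //.
  by have := is_derive_coord i dr; rewrite mxE.
rewrite -oppr_le0 opprB -[leRHS](mul0r (t - s)).
have -> : (A *m w s) i 0 - (A *m w t) i 0 = - (A *m w t) i 0 - - (A *m w s) i 0.
  by rewrite opprK addrC.
apply: (lip_le_cst (f := fun r => - (A *m w r) i 0) st (lipN (wl i))).
apply: aeS dA => r H /H dr; exists 0 => //.
have := is_deriveN (is_derive_coord i dr); rewrite mxE oppr0; exact.
Qed.

(** At a good time [r] the subgradient inequality costs [<u, w t - w r>]. No bound on [u] is known,
    but the form [P] rewrites this as a product of velocity and displacement, both controlled by the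
    Lipschitz constant. Letting good times decrease to [s], for each fixed [x], extends the bound to
    all [s]. *)
Lemma flow_conj_le_lip : exists2 La, 0 <= La & forall (s t al : R), 0 <= s -> 0 <= t ->
  conj_le (w t) al -> conj_le (w s) (al + La * `|t - s|).
Proof.
have [[L0 wL0] good] := fw; pose L := `|L0|.
have L_ge0 : 0 <= L by exact: normr_ge0.
have wL s t : 0 <= s -> 0 <= t -> `|w s - w t| <= L * `|s - t|.
  move=> s0 t0; apply: (le_trans (wL0 _ _ s0 t0)).
  by apply: ler_wpM2r => //; exact: ler_norm.
have [K K0 PK] := pform_bound P.
have La0 : 0 <= K * L * L by rewrite !mulr_ge0// ltW.
exists (K * L * L) => // s t al s0 t0 tal x Cx.
apply/ler_addgt0Pl => e e0.
(* Moving from [s] to [r] creates two errors of total size at most [D * (r - s)], so a good time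
   within [e / D] of [s] is close enough. *)
pose D := d%:R * L * `|x - u0| + K * L * L + 1.
have D0 : 0 < D by rewrite ltr_wpDl// addr_ge0// !mulr_ge0.
have [r /andP[sr re] [u [dw _ sub]]] := ae_exists good s0 (divr_gt0 e0 D0).
have r0 : 0 < r by exact: le_lt_trans sr.
have cr : conj_le (w r) (al + K * L * L * `|t - r|).
  apply: conj_leW (sub _ _ (flow_colspan (ltW r0) t0) tal).
  rewrite lerD2l dotC -(pform_colspan hM hP MPM u (flow_colspan (ltW r0) t0)).
  rewrite -pformNr; apply: le_trans (ler_norm _) _.
  apply: le_trans (PK _ _) _; rewrite -!mulrA ler_pM2l// mulrA.
  rewrite [leRHS]mulrAC; apply: ler_pM => //.
    exact: (wL _ _ t0 (ltW r0)).
  exact: (is_derive_norm_le wL L_ge0 r0 dw).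
have -> : dot (w s) (x - u0) - g x =
    dot (w r) (x - u0) - g x + dot (w s - w r) (x - u0).
  by rewrite dotBl; ring.
have h1 := cr x Cx.
have h2 : dot (w s - w r) (x - u0) <= d%:R * L * `|x - u0| * (r - s).
  apply: le_trans (ler_norm _) _; apply: le_trans (dot_norm_le _ _) _.
  rewrite [leRHS]mulrAC ler_wpM2r// -mulrA ler_wpM2l//.
  by apply: le_trans (wL _ _ s0 (ltW r0)) _; rewrite distrC gtr0_norm ?subr_gt0.
have h3 : K * L * L * `|t - r| <= K * L * L * `|t - s| + K * L * L * (r - s).
  rewrite -mulrDr ler_wpM2l// (_ : t - r = (t - s) + (s - r)); last by ring.
  apply: le_trans (ler_normD _ _) _.
  by rewrite lerD2l distrC gtr0_norm ?subr_gt0.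
have h4 : D * (r - s) <= e.
  by rewrite -ler_pdivlMl// mulrC lerBlDl ltW.
have : d%:R * L * `|x - u0| * (r - s) + K * L * L * (r - s) <= D * (r - s).
  rewrite -mulrDl; apply: ler_wpM2r; last by rewrite lerDl.
  by rewrite subr_ge0 ltW.
lra.
Qed.

Lemma flow_conj_val (t : R) : 0 <= t -> conj_le (w t) (conj_val (w t)).
Proof.
move=> t0; have [La _ H] := flow_conj_le_lip.
have [r /andP[r0 _] [u [_ [al ral] _]]] := ae_exists fw.2 (lexx 0) ltr01.
exact: conj_valP (H _ _ _ t0 (ltW r0) ral).
Qed.

Lemma flow_conj_val_lip : exists2 La, 0 <= La & forall s t : R, 0 <= s -> 0 <= t ->
  `|conj_val (w s) - conj_val (w t)| <= La * `|s - t|.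
Proof.
have [La La0 H] := flow_conj_le_lip; exists La => // s t s0 t0.
have h1 := conj_val_le (H _ _ _ s0 t0 (flow_conj_val t0)).
have h2 := conj_val_le (H _ _ _ t0 s0 (flow_conj_val s0)).
rewrite distrC in h1; rewrite ler_norml; apply/andP; split; lra.
Qed.

Lemma flow_conj_val_lip0 b : lip 0 b (fun t => conj_val (w t)).
Proof.
have [La _ H] := flow_conj_val_lip.
by exists La => s t /andP[s0 _] /andP[t0 _]; exact: H.
Qed.

(** The derivative of the energy is identified by a chain rule: [E(w s) - <u, w s>] is minimal at
    [s = t], so its derivative vanishes there. *)
Lemma flow_ae : {ae mu, forall t : R, 0 < t -> exists u,
  [/\ is_derive t (1 : R) w (- (M *m u)),
      is_derive t (1 : R) (fun r => conj_val (w r)) (- dot u (M *m u)) &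
      forall v al, colspan M (v - w t) -> conj_le v al ->
        conj_le (w t) (al - dot u (v - w t))]}.
Proof.
have [_ good] := fw.
apply: aeS2 good (lip_ae_derive flow_conj_val_lip0) => t Ht De t0.
have [u [dw fin sub]] := Ht t0; have [D dE] := De t0.
exists u; split => //; suff <- : D = - dot u (M *m u) by [].
have du := is_derive_dot (is_derive_cst u t (1 : R)) dw.
rewrite dot0l add0r dotNr in du.
have dphi := is_deriveB dE du.
have H s : 0 <= s ->
    conj_val (w t) - dot u (w t) <= conj_val (w s) - dot u (w s).
  move=> s0; have := sub _ _ (flow_colspan (ltW t0) s0) (flow_conj_val s0).
  by move=> /conj_val_le; rewrite dotBr; lra.
apply/eqP; rewrite -subr_eq0; apply/eqP/le_anti/andP; split.
  apply: (is_derive_le_left dphi t0) => s /andP[s0 _]; rewrite mul0r !fctE.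
  by have := H s; rewrite subrr in s0; move=> /(_ (ltW s0)); lra.
rewrite -oppr_le0; have dphiN := is_deriveN dphi.
apply: (is_derive_le_right dphiN t0) => s /andP[st _]; rewrite mul0r !fctE.
by have := H s (le_trans (ltW t0) (ltW st)); lra.
Qed.

Lemma flow_conj_val_noninc (s t : R) : 0 <= s -> s <= t -> conj_val (w t) <= conj_val (w s).
Proof.
move=> s0 st; rewrite -subr_le0 -[leRHS](mul0r (t - s)).
apply: (lip_le_cst (f := fun r => conj_val (w r)) st).
  exact: lip_sub (flow_conj_val_lip0 t).
apply: aeS flow_ae => r Hr /andP[sr _].
have [|u [_ dE _]] := Hr; first exact: le_lt_trans sr.
by exists (- dot u (M *m u)) => //; rewrite oppr_le0; have [_] := hM; apply.
Qed.

Lemma flow_dist_derive v (t : R) u : 0 <= t -> colspan M (v - w 0) ->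
  is_derive t (1 : R) w (- (M *m u)) ->
  is_derive t (1 : R) (fun r => pform P (w r - v) (w r - v)) (2 * dot u (v - w t)).
Proof.
move=> t0 vM dw.
have dB : is_derive t (1 : R) (fun r => w r - v) (- (M *m u)).
  have := is_deriveB dw (is_derive_cst v t (1 : R)).
  by rewrite subr0.
apply: is_derive_eq (is_derive_pform P dB dB) _.
rewrite [X in X + _]pformC// -mulr2n -mulr_natl -mulmxN.
rewrite pform_colspan//; first by rewrite dotC dotNl dotBr dotBr; ring.
have := colspanB (flow_colspan (lexx 0) t0) vM.
by rewrite opprB addrA subrK.
Qed.

(** The squared distance to [v] has derivative at most [2 (al - E(w r))], and [E] decreases, so its
    value at the final time bounds all the others. Bounding [E(w t)] below by the contribution of
    one [x] leaves an inequality continuous in the curve, ready for pointwise limits. *)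
Lemma flow_evi (s t : R) v (al : R) x : 0 <= s -> s <= t -> colspan M (v - w 0) ->
  conj_le v al -> C x ->
  pform P (w t - v) (w t - v) - pform P (w s - v) (w s - v) <=
  2 * (t - s) * (al - (dot (w t) (x - u0) - g x)).
Proof.
move=> s0 st vM val Cx; have t0 := le_trans s0 st.
apply: (@le_trans _ _ (2 * (al - conj_val (w t)) * (t - s))); last first.
  rewrite mulrAC ler_wpM2l ?mulr_ge0 ?subr_ge0// lerD2l lerN2.
  exact: flow_conj_val.
apply: (lip_le_cst (f := fun r => pform P (w r - v) (w r - v)) st).
  have lw : vlip s t (fun r => w r - v).
    apply: vlipB (vlip_cst _ _ _) => i.
    by apply: lip_sub (flow_vlip t i).
  exact: lip_pform.
apply: aeS flow_ae => r Hr /andP[sr rt].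
have r0 : 0 < r by exact: le_lt_trans sr.
have [u [dw _ sub]] := Hr r0.
exists (2 * dot u (v - w r)); first exact: flow_dist_derive (ltW r0) vM dw.
rewrite ler_pM2l// lerBrDl.
have vr : colspan M (v - w r).
  have := colspanB vM (flow_colspan (lexx 0) (ltW r0)).
  by rewrite opprB addrA subrK.
have := conj_val_le (sub _ _ vr val).
have := flow_conj_val_noninc (ltW r0) (ltW rt); lra.
Qed.

End FlowProperties.
End AbstractFlow.

(** * Evolution variational inequalities *)

Section EviCurves.
Context {R : realType} {d : nat}.
Variables (M P : 'M[R]_d) (u0 : 'cV[R]_d).
Hypotheses (hP : psd_mx P).
Variables (C : set 'cV[R]_d) (g : 'cV[R]_d -> R).
Hypothesis C0 : C !=set0.
Implicit Types (w : R -> 'cV[R]_d) (v x u : 'cV[R]_d).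

Let Q v := pform P v v.

(* Evolution variational inequality for the gradient flow of conj_val with respect
   to the form P on the affine space v0 + colspan M. *)
Definition evi_curve v0 w := (forall t, 0 <= t -> colspan M (w t - v0)) /\
  forall (s t : R) v (al : R) x, 0 <= s -> s <= t -> colspan M (v - v0) ->
    conj_le u0 C g v al -> C x ->
    pform P (w t - v) (w t - v) - pform P (w s - v) (w s - v) <=
    2 * (t - s) * (al - (dot (w t) (x - u0) - g x)).

Lemma colspan_sub v0 v1 v2 :
  colspan M (v1 - v0) -> colspan M (v2 - v0) -> colspan M (v1 - v2).
Proof. by move=> h1 h2; have := colspanB h1 h2; rewrite opprB addrA subrK. Qed.

Lemma pform_distC v1 v2 : Q (v1 - v2) = Q (v2 - v1).
Proof. by rewrite /Q -opprB pformNl pformNr opprK. Qed.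

Lemma evi_val v0 w (s t : R) v al : evi_curve v0 w -> 0 <= s -> s <= t ->
  colspan M (v - v0) -> conj_le u0 C g v al ->
  Q (w t - v) - Q (w s - v) <= 2 * (t - s) * (al - conj_val u0 C g (w t)).
Proof.
move=> [wM evi] s0; rewrite le_eqVlt => /predU1P[->|st] vM val.
  by rewrite !subrr mulr0 mul0r.
have ts : 0 < 2 * (t - s) by rewrite mulr_gt0// subr_gt0.
rewrite -ler_pdivrMl// lerBrDr -lerBrDl; apply: conj_val_le => // x Cx.
have := evi s t v al x s0 (ltW st) vM val Cx.
by rewrite -ler_pdivrMl// /Q; lra.
Qed.

(** Taking [w s] itself as competitor leaves only a nonnegative squared distance on the left. *)
Lemma evi_noninc v0 w (s t al : R) : evi_curve v0 w -> 0 <= s -> s <= t ->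
  conj_le u0 C g (w s) al -> conj_le u0 C g (w t) al.
Proof.
move=> [wM evi] s0; rewrite le_eqVlt => /predU1P[->//|st] sal x Cx.
have := evi s t (w s) al x s0 (ltW st) (wM s s0) sal Cx.
rewrite subrr -/(Q _) -/(Q 0) (_ : Q 0 = 0) ?subr0; last by rewrite /Q /pform dot0l.
move=> /(le_trans (pform_ge0 _ hP)); rewrite pmulr_rge0 ?subr_ge0//.
by rewrite mulr_gt0// subr_gt0.
Qed.

(** No differentiability is available. On [[s, t]] the competitor is [w' t] for [w], and [w s] for
    [w']; the two inequalities add up to an error [2 (t - s) (E(w s) - E(w t))], which telescopes
    over a uniform grid and vanishes with its mesh. *)
Lemma evi_contraction v0 w w' (al al' T : R) : evi_curve v0 w -> evi_curve v0 w' ->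
  conj_le u0 C g (w 0) al -> conj_le u0 C g (w' 0) al' -> 0 <= T ->
  Q (w T - w' T) <= Q (w 0 - w' 0).
Proof.
move=> ew ew' wal wal' T0.
pose E := conj_val u0 C g.
have fin t : 0 <= t -> conj_le u0 C g (w t) (E (w t)).
  by move=> t0; apply: conj_valP (evi_noninc ew (lexx 0) t0 wal).
have fin' t : 0 <= t -> conj_le u0 C g (w' t) (E (w' t)).
  by move=> t0; apply: conj_valP (evi_noninc ew' (lexx 0) t0 wal').
have step s t : 0 <= s -> s <= t ->
    Q (w t - w' t) - Q (w s - w' s) <= 2 * (t - s) * (E (w s) - E (w t)).
  move=> s0 st; have t0 := le_trans s0 st.
  have := evi_val ew s0 st (ew'.1 t t0) (fin' t t0).
  have := evi_val ew' s0 st (ew.1 s s0) (fin s s0).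
  rewrite (pform_distC (w' t)) (pform_distC (w' s)) -!/(E _) => h1 h2.
  have -> : 2 * (t - s) * (E (w s) - E (w t)) =
      2 * (t - s) * (E (w s) - E (w' t)) + 2 * (t - s) * (E (w' t) - E (w t)).
    by ring.
  lra.
have grid (h : R) (k : nat) : 0 <= h ->
    Q (w (k%:R * h) - w' (k%:R * h)) - Q (w 0 - w' 0) <=
    2 * h * (E (w 0) - E (w (k%:R * h))).
  move=> h0; elim: k => [|k IH]; first by rewrite !mul0r !subrr mulr0.
  have kh : 0 <= k%:R * h by rewrite mulr_ge0.
  have kS : k%:R * h <= k.+1%:R * h by rewrite ler_wpM2r// ler_nat.
  have := step _ _ kh kS; rewrite (_ : k.+1%:R * h - k%:R * h = h); last first.
    by rewrite -natr1; ring.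
  by move: IH; rewrite !mulrBr; lra.
rewrite -subr_le0; apply/ler_addgt0Pl => e e0; rewrite addr0.
pose D := 2 * T * `|E (w 0) - E (w T)|.
have D0 : 0 <= D by rewrite !mulr_ge0.
have [n nD] : exists n : nat, D / e < n.+1%:R.
  by exists (Num.truncn (D / e)); rewrite truncnS_gt.
have n0 : 0 < n.+1%:R :> R by [].
have := grid (T / n.+1%:R) n.+1 (divr_ge0 T0 (ltW n0)).
rewrite mulrCA divff ?gt_eqF// mulr1 => /le_trans; apply.
apply: (@le_trans _ _ (D / n.+1%:R)).
  rewrite /D mulrA mulrAC ler_wpM2r ?invr_ge0// ?(ltW n0)//.
  by rewrite ler_wpM2l ?mulr_ge0// ler_norm.
by rewrite ler_pdivrMr// mulrC -ler_pdivrMr// ltW.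
Qed.

End EviCurves.

(** * Barrier cones and the chain rule *)

Section CompactMinimization.
Context {R : realType} {d : nat}.
Implicit Types (A C : set 'cV[R]_d) (x y z v : 'cV[R]_d).

(** Transposition is an isometry that carries Heine-Borel from row vectors to columns. *)
Lemma closed_bounded_compact_col C (rho : R) : closed C ->
  compact (C `&` [set y | `|y| <= rho]).
Proof.
move=> cC; pose T (r : 'rV[R]_d) : 'cV[R]_d := r^T.
have Tc : continuous T.
  move=> r; apply: (proj2 (cvg_colP (F := nbhs r) T (T r))) => i.
  rewrite mxE; under eq_fun do rewrite mxE; exact: coord_continuous.
have nT (r : 'rV[R]_d) : `|r| = `|r^T|.
  apply/le_anti/andP; split.
    rewrite [leLHS]/Num.Def.normr/= mx_normrE; apply: bigmax_le => //= -[i j] _.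
    by have := coord_le r^T j; rewrite mxE (ord1 i).
  apply: norm_col_le => // i; rewrite mxE [leRHS]/Num.Def.normr/= mx_normrE.
  exact: (le_bigmax _ _ (0, i)).
have -> : C `&` [set y | `|y| <= rho] =
    T @` (T @^-1` (C `&` [set y | `|y| <= rho])).
  apply/seteqP; split=> [y Cy|_ [r Cr <-]//]; exists y^T; rewrite /T/= ?trmxK//.
apply: continuous_compact; first exact: continuous_subspaceT.
apply: bounded_closed_compact.
  exists rho; split; first exact: num_real.
  by move=> K rK r /= [_ rrho]; apply: le_trans (ltW rK); rewrite nT.
apply: (@closed_comp _ _ T) => [r _|]; first exact: Tc.
apply: closedI => //.
have -> : [set y | `|y| <= rho] = closed_ball_ Num.norm 0 rho :> set 'cV[R]_d.
  by apply/seteqP; split=> y; rewrite /closed_ball_/= sub0r normrN.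
exact: closed_closed_ball_.
Qed.

(** The hypothesis replaces coercivity: points of the sublevel set need only be exchangeable for
    bounded ones that are no worse. This admits objectives that are constant along lines contained
    in C. *)
Lemma attained_min C (f : 'cV[R]_d -> R) (rho : R) y0 : closed C -> C y0 ->
  continuous f ->
  (forall y, C y -> f y <= f y0 -> exists y', [/\ C y', `|y'| <= rho & f y' <= f y]) ->
  exists2 x, C x & forall y, C y -> f x <= f y.
Proof.
move=> cC Cy0 fc H.
have [y1 [Cy1 y1r fy1]] := H y0 Cy0 (lexx _).
have [||x] := @compact_EVT_min _ _ f _ _ (closed_bounded_compact_col (rho := rho) cC).
- by exists y1.
- exact: continuous_subspaceT.
rewrite inE => -[Cx _] fx; exists x => // y Cy.
have [fy|fy] := leP (f y) (f y0).
  have [y' [Cy' y'r fy']] := H y Cy fy.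
  by apply: le_trans fy'; apply: fx; rewrite inE.
apply: le_trans (ltW fy); apply: le_trans fy1; apply: fx; by rewrite inE.
Qed.

Definition segment_closed C := forall x y (t : R), 0 < t < 1 -> C x -> C y ->
  C ((1 - t) *: x + t *: y).

Definition quadb (A : 'M[R]_d) b y : R := 2^-1 * dot y (A *m y) - dot b y.

Lemma quadb_min (A : 'M[R]_d) b C x : psd_mx A -> segment_closed C -> C x ->
  (forall y, C y -> quadb A b x <= quadb A b y) ->
  forall y, C y -> 0 <= dot (A *m x - b) (y - x).
Proof.
move=> hA cC Cx xmin y Cy; set z := y - x.
have H t : 0 < t < 1 -> 0 <= dot (A *m x - b) z + t * (2^-1 * pform A z z).
  move=> /andP[t0 t1].
  have := xmin _ (cC x y t _ Cx Cy); rewrite t0 t1 => /(_ isT).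
  have -> : (1 - t) *: x + t *: y = x + t *: z.
    by rewrite scalerBl scale1r scalerBr addrAC addrA.
  rewrite /quadb -/(pform A x x) -/(pform A (x + t *: z) (x + t *: z)).
  rewrite pform_sqrD// !pformZr !pformZl dotDr dotZr.
  have -> : dot (A *m x - b) z = pform A x z - dot b z.
    by rewrite dotBl (pformC x z hA) /pform dotC.
  move=> h; rewrite -(pmulr_rge0 _ t0); move: h.
  set p := pform A x x; set q := pform A x z; set r := pform A z z; set s := dot b z.
  move=> h; have -> : t * (q - s + t * (2^-1 * r)) =
    (2^-1 * (p + 2 * (t * q) + t * (t * r)) - (dot b x + t * s)) -
    (2^-1 * p - dot b x) by field.
  by rewrite subr_ge0.
apply/ler_addgt0Pl => e e0.
(* [t <= e / K] makes the second-order term at most [e], and [1/2] keeps [t] below 1. *)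
pose K := `|2^-1 * pform A z z| + 1.
have K0 : 0 < K by rewrite ltr_wpDl.
pose t := Num.min 2^-1 (e / K).
have t0 : 0 < t by rewrite lt_min invr_gt0 ltr0n divr_gt0.
have t1 : t < 1 by rewrite gt_min invf_lt1// ltr1n.
have := H t; rewrite t0 t1 => /(_ isT) h.
have : t * (2^-1 * pform A z z) <= e.
  apply: (@le_trans _ _ (t * K)).
    by rewrite ler_pM2l// (le_trans (ler_norm _))// lerDl.
  by rewrite -ler_pdivlMr// ge_min lexx orbT.
lra.
Qed.

Lemma quadb_continuous (A : 'M[R]_d) b : continuous (quadb A b).
Proof.
suff H (x : 'cV[R]_d) : quadb A b @ x --> quadb A b x by move=> x; exact: H.
have hb : (fun y => dot b y) @ x --> dot b x.
  by apply: cvg_dot; [exact: cvg_cst|exact: cvg_id].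
have hA : (fun y => dot y (A *m y)) @ x --> dot x (A *m x).
  by apply: cvg_dot; [exact: cvg_id|apply: cvg_mulmx; exact: cvg_id].
have h2 : (fun y => 2^-1 * dot y (A *m y)) @ x --> 2^-1 * dot x (A *m x).
  by apply: cvgM hA; exact: cvg_cst.
exact: cvgB h2 hb.
Qed.

End CompactMinimization.

Section Barrier.
Context {R : realType} {d : nat}.
Variable C : set 'cV[R]_d.
Hypotheses (C0 : C !=set0) (cC : closed C) (vC : segment_closed C).
Implicit Types (x y z v : 'cV[R]_d).

Definition barrier v := exists al, forall x, C x -> dot v x <= al.

Lemma barrier0 : barrier 0.
Proof. by exists 0 => x _; rewrite dot0l. Qed.

Lemma psd_scalar1 : psd_mx (1%:M : 'M[R]_d).
Proof. by split; [exact: trmx1|move=> x; rewrite mul1mx dot_ge0]. Qed.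

Lemma enorm_le_norm x : `|x| ^+ 2 <= dot x x.
Proof.
have H : `|x| <= Num.sqrt (dot x x).
  apply: norm_col_le => [|i]; first exact: sqrtr_ge0.
  rewrite -[leLHS]ger0_norm// -sqrtr_sqr ler_wsqrtr//.
  rewrite -normrX ger0_norm ?sqr_ge0// /dot (bigD1 i)//= expr2 lerDl.
  by apply: sumr_ge0 => j _; rewrite -expr2 sqr_ge0.
have := lerXn2r 2 (normr_ge0 x) (sqrtr_ge0 _) H.
by rewrite sqr_sqrtr ?dot_ge0.
Qed.

(** Project [z = x + p] onto C, at [y0]. The normal [n = z - y0] lies in the barrier cone, hence is
    orthogonal to [p], and [<n, n> = <n, x - y0> <= 0]. *)
Lemma lineality p x : (forall v, barrier v -> dot v p = 0) -> C x -> C (x + p).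
Proof.
move=> bp Cx; set z := x + p.
have [|y0 Cy0 ymin] := @attained_min _ _ C (quadb 1%:M z)
  (`|z| + Num.sqrt (dot z z + 2 * quadb 1%:M z x)) x cC Cx (@quadb_continuous _ _ _ _).
  move=> y Cy yx; exists y; split => //.
  rewrite -(subrK z y) addrC; apply: (le_trans (ler_normD _ _)).
  rewrite lerD2l -[leLHS]ger0_norm// -sqrtr_sqr ler_wsqrtr//.
  apply: (le_trans (enorm_le_norm _)).
  have -> : dot (y - z) (y - z) = dot z z + 2 * quadb 1%:M z y.
    by rewrite /quadb mul1mx dotBl !dotBr (dotC y z); lra.
  by rewrite lerD2l ler_pM2l.
have vi := quadb_min psd_scalar1 vC Cy0 ymin; rewrite mul1mx in vi.
pose n := z - y0.
have nle y : C y -> dot n (y - y0) <= 0.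
  by move=> /vi; rewrite -opprB dotNl oppr_ge0.
have bn : barrier n.
  by exists (dot n y0) => y /nle; rewrite dotBr subr_le0.
have nn : dot n n <= 0.
  rewrite {2}/n /z addrAC dotDr (bp n bn) addr0; exact: nle.
have /dot_eq0/eqP : dot n n = 0 by apply/le_anti; rewrite nn dot_ge0.
by rewrite subr_eq0 => /eqP ->.
Qed.

Lemma dom_support_fun : dom (support_fun C) = barrier.
Proof.
apply/seteqP; split=> v; rewrite /dom/= /support_fun.
  case E : (ereal_sup _) => [r| |]// _.
    exists r => x Cx; rewrite -lee_fin -E; apply: ereal_sup_ubound.
    by exists x.
  exists 0 => x Cx; have : ((dot v x)%:E <= -oo)%E.
    by rewrite -E; apply: ereal_sup_ubound; exists x.
  by rewrite leeNy_eq.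
move=> [al val]; apply: (@le_lt_trans _ _ al%:E); last by rewrite ltry.
by apply: ge_ereal_sup => _ [x Cx <-]; rewrite lee_fin val.
Qed.

(** Because the barrier cone contains 0, this affine hull is a linear subspace. *)
Definition bspan : set 'cV[R]_d := aff (dom (support_fun C)).

Lemma barrier_bspan v : barrier v -> bspan v.
Proof. by move=> bv A [_]; apply; rewrite dom_support_fun. Qed.

Lemma bspan_affine : affine_set bspan.
Proof.
move=> x y t hx hy A [affA KA]; apply: (affA); [exact: hx|exact: hy].
Qed.

Lemma bspanZ k v : bspan v -> bspan (k *: v).
Proof.
move=> hv; have := bspan_affine k (barrier_bspan barrier0) hv.
by rewrite scaler0 add0r.
Qed.

Lemma bspanD v z : bspan v -> bspan z -> bspan (v + z).
Proof.
move=> hv hz; have := bspan_affine 2^-1 hv hz => /(bspanZ 2).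
rewrite scalerDr !scalerA mulfV// scale1r (_ : 2 * (1 - 2^-1) = 1) ?scale1r//.
by field.
Qed.

(** The subspace is defined only as an intersection. Rows taken from it with maximal rank generate
    it, since appending a vector outside their span would raise the rank. *)
Lemma bspan_basis : exists m (B : 'M[R]_(m, d)),
  (forall i, bspan (row i B)^T) /\ forall v, bspan v -> (v^T <= B)%MS.
Proof.
pose W r := `[< exists m (B : 'M[R]_(m, d)),
  (forall i, bspan (row i B)^T) /\ \rank B = r >].
have W0 : exists r, W r.
  exists 0; apply/asboolP; exists 0, 0; split; last exact: mxrank0.
  by case.
have Wd r : W r -> (r <= d)%N.
  by move=> /asboolP[m [B [_ <-]]]; exact: rank_leq_col.
have [r /asboolP[m [B [Bs Br]]] rmax] := ex_maxnP W0 Wd.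
exists m, B; split => // v hv; apply: contrapT => /negP vB.
have /rmax : W (\rank (col_mx B v^T)).
  apply/asboolP; exists (m + 1)%N, (col_mx B v^T); split => // i.
  rewrite -(splitK i); case: (fintype.split i) => j /=.
    by rewrite rowKu.
  by rewrite rowKd row_id trmxK.
rewrite -Br leqNgt => /negP; apply.
have lt : (B < col_mx B v^T)%MS.
  rewrite /ltmx; apply/andP; split; first by rewrite -addsmxE addsmxSl.
  by apply: contra vB => /(submx_trans _); apply; rewrite -addsmxE addsmxSr.
exact: rank_ltmx.
Qed.

Lemma row_mulE m (B : 'M[R]_(m, d)) i y : (B *m y) i 0 = dot (row i B)^T y.
Proof. by rewrite dotE trmxK -row_mul [RHS]mxE. Qed.

(** Quantitative relative interiority: since [a] can be moved both ways along each generator inside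
    the barrier cone, the gap [kap - <a, x>] controls [<dl, x>] over all of C for every direction of
    the span. It serves both to make minima attained and to repair competitors. *)
Lemma ri_barrier_bound a : ri (dom (support_fun C)) a ->
  exists kap c, [/\ 0 < c, forall x, C x -> 0 <= kap - dot a x &
    forall dl, bspan dl -> forall x, C x ->
      `|dot dl x| <= c * `|dl| * (kap - dot a x)].
Proof.
move=> [Ka near_a].
have [r r0 ra] : exists2 r : R, 0 < r &
    forall y, `|y - a| < r -> bspan y -> barrier y.
  move: near_a => /nbhs_ballP[r /= r0 ra]; exists r => // y yr hy.
  have := ra y; rewrite -dom_support_fun; apply => //.
  by rewrite mx_norm_ball /ball_ /= distrC.
have [m [B [Bs Bmax]]] := bspan_basis.
pose b i : 'cV[R]_d := (row i B)^T.
(* Small enough for every [a + tau b_i] and [a - tau b_i] to stay in the ball of radius [r] around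
   [a]. *)
pose tau := r / (1 + \sum_i `|b i|).
have s0 : 0 < 1 + \sum_i `|b i| by rewrite ltr_pwDl// sumr_ge0.
have tau0 : 0 < tau by rewrite divr_gt0.
have bi i : `|b i| < 1 + \sum_i `|b i|.
  rewrite (bigD1 i)//= addrCA ltrDl ltr_pwDl//.
  by rewrite sumr_ge0.
rewrite dom_support_fun in Ka.
have Kb i (s : R) : `|s| <= 1 -> barrier (a + (s * tau) *: b i).
  move=> s1; apply: ra; last first.
    by apply: bspanD (bspanZ _ (Bs i)); exact: barrier_bspan.
  rewrite addrAC subrr add0r normrZ normrM (gtr0_norm tau0).
  apply: (@le_lt_trans _ _ (tau * `|b i|)).
    by rewrite ler_wpM2r// ler_piMl// ltW.
  by rewrite /tau mulrAC ltr_pdivrMr// ltr_pM2l.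
have /choice[al alP] i : exists al, forall x, C x ->
    dot a x + tau * `|dot (b i) x| <= al.
  have [|al1 h1] := Kb i 1; first by rewrite normr1.
  have [|al2 h2] := Kb i (-1); first by rewrite normrN normr1.
  exists (Num.max al1 al2) => x Cx; rewrite le_max.
  have := h1 x Cx; have := h2 x Cx; rewrite !dotDl !dotZl mul1r mulN1r mulNr.
  have [h|h] := leP 0 (dot (b i) x).
    by rewrite ger0_norm// => _ ->.
  by rewrite ltr0_norm// mulrN => ->; rewrite orbT.
have [al0 h0] := Ka.
(* One constant above all the bounds at once; [al0] keeps the gap nonnegative even when [B] has no
   rows. *)
pose kap := `|al0| + \sum_i `|al i|.
have kapi i x : C x -> dot a x + tau * `|dot (b i) x| <= kap.
  move=> Cx; apply: (le_trans (alP i x Cx)); apply: (le_trans (ler_norm _)).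
  rewrite /kap (bigD1 i)//= addrCA lerDl addr_ge0//.
  by rewrite sumr_ge0.
have kap0 x : C x -> 0 <= kap - dot a x.
  move=> Cx; rewrite subr_ge0; apply: (le_trans (h0 x Cx)).
  by apply: (le_trans (ler_norm _)); rewrite lerDl sumr_ge0.
have [K K0 hK] := mulmx_norm_le (pinvmx B)^T.
exists kap, (m%:R * K / tau + 1); split => //.
  by rewrite ltr_wpDl// divr_ge0 ?(ltW tau0)// mulr_ge0// ltW.
move=> dl hdl x Cx.
pose ga : 'cV[R]_m := (pinvmx B)^T *m dl.
have dlE : dot dl x = \sum_i ga i 0 * dot (b i) x.
  have E : dl^T = ga^T *m B by rewrite trmx_mul trmxK mulmxKpV// Bmax.
  rewrite dotE E -mulmxA mxE; apply: eq_bigr => i _.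
  by rewrite row_mulE mxE.
rewrite dlE; apply: (le_trans (ler_norm_sum _ _ _)).
apply: (@le_trans _ _ (\sum_(i < m) K * `|dl| * ((kap - dot a x) / tau))).
  apply: ler_sum => i _; rewrite normrM; apply: ler_pM => //.
    by apply: (le_trans (coord_le _ _)); exact: hK.
  by rewrite ler_pdivlMr// mulrC; have := kapi i x Cx; lra.
rewrite sumr_const card_ord -[leLHS]mulr_natl.
have -> : m%:R * (K * `|dl| * ((kap - dot a x) / tau)) =
    m%:R * K / tau * `|dl| * (kap - dot a x) by ring.
by rewrite ler_wpM2r ?kap0// ler_wpM2r// lerDl.
Qed.

Section SubdifferentialChainRule.
Variables (M P : 'M[R]_d) (u0 : 'cV[R]_d).
Hypotheses (hM : psd_mx M) (hP : psd_mx P) (MPM : M *m P *m M = M).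
Notation conj_le0 := (conj_le u0 C (fun=> 0)).

(* The proximal point of the support function yields the subgradient: the
   minimizer of the quadratic below over C has the required image under M. *)
Lemma subgradient_lift a v u al : ri (dom (support_fun C)) a ->
  colspan M (v - a) -> conj_le0 v al ->
  (forall z be, colspan M (z - v) -> conj_le0 z be ->
     conj_le0 v (be - dot u (z - v))) ->
  exists x, [/\ C x, M *m (x - u0) = M *m u & forall y, C y -> dot v (y - x) <= 0].
Proof.
move=> ria vaM val sub.
have [kap [c [c0 kap0 kapc]]] := ri_barrier_bound ria.
have [m [B [Bs Bmax]]] := bspan_basis.
have Ka : barrier a by have [] := ria; rewrite dom_support_fun.
(* Up to a constant, [Psi y] is half the squared [M]-distance of [y] to [u0 + u] minus [<v, y>]. *)
pose bb := M *m (u0 + u) + v; pose Psi := quadb M bb.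
have PsiE y : Psi y = 2^-1 * dot (y - u0 - u) (M *m (y - u0 - u)) - dot v y -
    2^-1 * dot (u0 + u) (M *m (u0 + u)).
  have -> : y - u0 - u = y - (u0 + u) by rewrite opprD addrA.
  rewrite /Psi /quadb /bb; set e := u0 + u.
  have := pform_sqrB y e hM; rewrite /pform => ->.
  by rewrite dotDl (dotC (M *m e)); lra.
have vle y : C y -> dot v y <= al + dot v u0.
  by move=> /val; rewrite dotBr subr0; lra.
have [y0 Cy0] := C0.
have [Kn Kn0 hKn] := norm_le_pform hM hP MPM.
have [KP KP0 hKP] := mulmx_norm_le P.
(* [A y] records everything about [y] that [M] and the vectors of the barrier cone can detect. *)
pose A := col_mx M B.
have [KA KA0 hKA] := mulmx_norm_le (pinvmx A).
have [Kf Kf0 hKf] := pform_bound P.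
pose cst := 2^-1 * dot (u0 + u) (M *m (u0 + u)).
(* Bounds on the sublevel set of [y0]: [X] for the [M]-form of [y - u0 - u], hence [be1] for [M y];
   then [be2] for the gap [kap - <a, y>], because [v - a] lies in the span of [M] and so sees only
   [M y]; finally [be3] for [A y]. *)
pose X := 2 * (Psi y0 + cst + al + dot v u0).
pose be1 := Num.sqrt (Kn * X) + `|M *m (u0 + u)|.
pose be2 := kap + Psi y0 + cst + Kf * `|v - a| * be1.
pose be3 := be1 + \sum_i c * `|(row i B)^T| * be2.
have bv : barrier v by exists (al + dot v u0).
have MT : M^T = M by have [] := hM.
have [|x Cx xmin] := @attained_min _ _ C Psi (KA * be3) y0 cC Cy0
    (@quadb_continuous _ _ _ _).
  move=> y Cy; rewrite PsiE -/cst; set z := y - u0 - u => yle.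
  have qz : 0 <= dot z (M *m z) by have [_] := hM; apply.
  have vy := vle y Cy.
  have qX : dot z (M *m z) <= X by rewrite /X; lra.
  have Mz : `|M *m z| <= Num.sqrt (Kn * X).
    rewrite -[leLHS]ger0_norm// -sqrtr_sqr ler_wsqrtr//.
    have := hKn _ (colspan_mulmx M z); rewrite (pform_mulmx hM hP MPM) => h.
    by apply: (le_trans h); rewrite ler_pM2l.
  have My : `|M *m y| <= be1.
    have -> : y = z + (u0 + u) by rewrite /z -[y - u0 - u]addrA -opprD subrK.
    by rewrite mulmxDr (le_trans (ler_normD _ _))// lerD2r.
  have be1_0 : 0 <= be1 by exact: le_trans My.
  have ay : kap - dot a y <= be2.
    have -> : dot a y = dot v y - dot (v - a) y by rewrite dotBl; ring.
    have : dot (v - a) y <= Kf * `|v - a| * be1.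
      rewrite -(pform_colspan hM hP MPM y vaM); apply: (le_trans (ler_norm _)).
      by apply: (le_trans (hKf _ _)); rewrite ler_wpM2l// mulr_ge0// ltW.
    by rewrite /be2; lra.
  have be2_0 : 0 <= be2 by exact: le_trans (kap0 y Cy) ay.
  have by_ i : `|(B *m y) i 0| <= c * `|(row i B)^T| * be2.
    rewrite row_mulE; apply: (le_trans (kapc _ (Bs i) _ Cy)).
    by rewrite ler_wpM2l// mulr_ge0// ltW.
  have sum0 : 0 <= \sum_i c * `|(row i B)^T| * be2.
    by apply: sumr_ge0 => i _; apply: le_trans (by_ i).
  have Ay : `|A *m y| <= be3.
    apply: norm_col_le => [|i]; first by rewrite addr_ge0.
    rewrite mul_col_mx -(splitK i); case: (fintype.split i) => j /=.
      rewrite col_mxEu (le_trans (coord_le _ _))// (le_trans My)//.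
      by rewrite lerDl.
    rewrite col_mxEd (le_trans (by_ j))// /be3 (bigD1 j)//= addrCA lerDl.
    rewrite addr_ge0// sumr_ge0// => k _; exact: le_trans (by_ k).
  (* [y'] has the same image under [A] as [y], hence the same value of [Psi]; it differs from [y] by
     a vector orthogonal to the barrier cone, so it stays in C; and its norm is controlled by
     [A y]. *)
  pose y' := pinvmx A *m (A *m y).
  have AE : A *m y' = A *m y by rewrite 2!mulmxA (mulmxKpV (submx_refl A)).
  have [MyE ByE] : M *m y' = M *m y /\ B *m y' = B *m y.
    by move: AE; rewrite /A !mul_col_mx => /eq_col_mx.
  have lin z' : barrier z' -> dot z' (y' - y) = 0.
    move=> /barrier_bspan/Bmax h.
    by rewrite dotE -(mulmxKpV h) -[_ *m B *m _]mulmxA mulmxBr ByE subrr mulmx0 mxE.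
  exists y'; split.
  - by rewrite -(subrK y y') addrC; exact: lineality.
  - by apply: (le_trans (hKA _)); rewrite ler_pM2l.
  rewrite /z -PsiE le_eqVlt /Psi /quadb MyE; apply/orP; left; apply/eqP.
  have vE : dot v y' = dot v y by apply/eqP; rewrite -subr_eq0 -dotBr lin.
  have yE : dot y' (M *m y) = dot y (M *m y).
    by rewrite -{1}MT -dot_mulmxl MyE dotC.
  by rewrite /bb !dotDl vE !dot_mulmxl MT MyE yE.
have vi := quadb_min hM vC Cx xmin.
have bbE : M *m x - bb = M *m (x - u0 - u) - v.
  by rewrite /bb !mulmxBr mulmxDr !opprD !addrA.
(* Optimality says that [x] maximizes [v - r] over C. Testing the hypothesis on [u] with the
   competitor [v - r] then gives [<x - u0 - u, r> <= 0], which forces [r = 0]. *)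
set r := M *m (x - u0 - u) in bbE; rewrite bbE in vi.
have vr : conj_le0 (v - r) (dot (v - r) (x - u0)).
  move=> y /vi; rewrite subr0 -opprB dotNl oppr_ge0 => h.
  by rewrite -subr_le0 -dotBr opprB addrA subrK.
have rM : colspan M (v - r - v).
  by rewrite addrAC subrr add0r; apply: colspanN; exact: colspan_mulmx.
have := sub _ _ rM vr x Cx; rewrite subr0 (_ : v - r - v = - r); last first.
  by rewrite addrAC subrr add0r.
rewrite dotNr dotBl => h.
have /(psd_ker hM) r0 : dot (x - u0 - u) (M *m (x - u0 - u)) <= 0.
  by rewrite -/r dotBl (dotC (x - u0) r); lra.
exists x; split => //.
  by apply/eqP; rewrite -subr_eq0 -mulmxBr r0.
move=> y /vi; rewrite /r r0 sub0r dotNl oppr_ge0; exact.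
Qed.

End SubdifferentialChainRule.

End Barrier.

(** * Limits of families of flows *)

Section UltrafilterLimits.
Context {R : realType} {T : Type}.

Lemma ultra_compact_cvg {X : topologicalType} (U : set_system T) (f : T -> X)
    (K : set X) : UltraFilter U -> compact K -> (\forall e \near U, K (f e)) ->
  exists2 p, K p & f @ U --> p.
Proof.
move=> UU cK UK; have UP : ProperFilter U := ultra_proper.
have [p [Kp clp]] := cK (f @ U) _ UK; exists p => // N Np.
have [//|UN] := in_ultra_setVsetC (f @^-1` N) UU.
by have [x [/= nN /nN]] := clp (~` N) N UN Np.
Qed.

Lemma frequently_ultra (F : set_system T) (B : set T) : Filter F ->
  ~ F (~` B) -> exists U, [/\ UltraFilter U, F `<=` U & U B].
Proof.
move=> FF nB; have WP : ProperFilter (within B F).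
  by apply: Build_ProperFilter => h; apply: nB; exact: h.
have [U [UU FU]] := ultraFilterLemma WP; exists U; split => //.
  by move=> A FA; apply: FU; apply: filterS FA => e Ae _.
by apply: FU; exact: (@filterS _ F _ setT _ (fun e _ Be => Be) filterT).
Qed.

End UltrafilterLimits.

Section EviLimits.
Context {R : realType} {d : nat}.
Variables (M P : 'M[R]_d) (u0 : 'cV[R]_d).
Hypotheses (hM : psd_mx M) (hP : psd_mx P) (MPM : M *m P *m M = M).
Variable C : set 'cV[R]_d.
Hypotheses (C0 : C !=set0) (cC : closed C) (vC : segment_closed C).
Notation conj_le0 := (conj_le u0 C (fun=> 0)).
Notation Q v := (pform P v v).
Notation mu := (@lebesgue_measure R).
Implicit Types (w : R -> 'cV[R]_d) (v x u : 'cV[R]_d).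

Lemma dist_derive (w : R -> 'cV[R]_d) v (t : R) u : colspan M (w t - v) ->
  is_derive t (1 : R) w (- (M *m u)) ->
  is_derive t (1 : R) (fun r => Q (w r - v)) (2 * dot u (v - w t)).
Proof.
move=> vM dw.
have dB : is_derive t (1 : R) (fun r => w r - v) (- (M *m u)).
  by have := is_deriveB dw (is_derive_cst v t (1 : R)); rewrite subr0.
apply: is_derive_eq (is_derive_pform P dB dB) _.
rewrite [X in X + _]pformC// -mulr2n -mulr_natl -mulmxN.
by rewrite (pform_colspan hM hP MPM)// dotC dotNl dotBr dotBr; ring.
Qed.

(** Converse of [flow_evi]. Velocities lie in [colspan M] as limits of difference quotients, so they
    have the form [- M u], and the EVI divided by [t - s] becomes the subgradient inequality. *)
Lemma evi_abstract_flow w v0 (L al : R) : evi_curve M P u0 C (fun=> 0) v0 w ->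
  (forall s t, 0 <= s -> 0 <= t -> `|w s - w t| <= L * `|s - t|) ->
  conj_le0 (w 0) al -> abstract_flow M u0 C (fun=> 0) w.
Proof.
move=> ew wL w0al; split; first by exists L.
have AF := ae_filter_ringOfSetsType mu.
have dW : {ae mu, forall t : R, 0 < t -> exists v, is_derive t (1 : R) w v}.
  have H i : {ae mu, forall t : R, 0 < t ->
      exists D, is_derive t (1 : R) (fun s => w s i 0) D}.
    by apply: lip_ae_derive => b; exact: nneg_vlip wL b i.
  have {}H := @filter_forall _ _ _ _ AF H.
  apply: (aeS _ H) => t Ht t0.
  have /choice[D HD] i := Ht i t0.
  exists (\col_i D i); apply: is_derive_col => i; rewrite mxE; exact: HD.
apply: (aeS _ dW) => t Dt t0; have [v dv] := Dt t0.
have vM : colspan M v.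
  have cv : (fun h : R => h^-1 *: (w (h *: 1 + t) - w t)) @ 0^' --> v.
    by have [/cvg_ex[l wl] <-] := dv; rewrite /derive (cvg_lim _ wl).
  apply: (colspan_cvg MPM _ cv); near=> h.
  apply: colspanZ; apply: colspan_sub; last exact: (ew.1 t (ltW t0)).
  apply: ew.1; rewrite /GRing.scale/= mulr1 -lerBlDr sub0r ltW//.
  by near: h; apply: nbhs_dnbhs; apply: lt_nbhsr; rewrite oppr_lt0.
have uE : - (M *m (- (P *m v))) = v.
  by rewrite mulmxN opprK; apply/(colspanE MPM).
exists (- (P *m v)); split; rewrite ?uE//.
  by exists al; exact: (evi_noninc hP ew (lexx 0) (ltW t0) w0al).
move=> z be zM zbe x Cx; rewrite subr0.
rewrite lerBrDr addrC -lerBrDr.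
have tzM : colspan M (w t - z) by rewrite -opprB; exact: colspanN.
have dw : is_derive t (1 : R) w (- (M *m (- (P *m v)))) by rewrite uE.
have df := dist_derive tzM dw.
(* The derivative is taken from the left because the EVI evaluates the energy at the final time of
   [[s, t]]. *)
rewrite -(@ler_pM2l _ 2)//; apply: (is_derive_le_left df t0) => s /andP[s0 st].
rewrite subrr in s0.
have zv0 : colspan M (z - v0).
  have := colspanD zM (ew.1 t (ltW t0)).
  by rewrite addrA subrK.
have := ew.2 s t z be x (ltW s0) (ltW st) zv0 zbe Cx.
by rewrite subr0; lra.
Unshelve. all: by end_near. Qed.

(** The subgradient at the initial point bounds the first displacement [w h - w 0] linearly in [h];
    contraction between the curve and its shift by [h] propagates the bound to all later times. *)
Lemma evi_lipschitz w v0 u (al : R) : evi_curve M P u0 C (fun=> 0) v0 w ->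
  conj_le0 (w 0) al ->
  (forall v be, conj_le0 v be -> conj_le0 (w 0) (be - dot u (v - w 0))) ->
  exists L, forall s t, 0 <= s -> 0 <= t -> `|w s - w t| <= L * `|s - t|.
Proof.
move=> ew w0al hu.
have [Kn Kn0 hKn] := norm_le_pform hM hP MPM.
have [Kp Kp0 hKp] := pform_bound P.
pose La := 2 * Kn * d%:R * `|u|.
have La0 : 0 <= La by rewrite !mulr_ge0// ltW.
have init h : 0 <= h -> `|w h - w 0| <= La * h.
  move=> h0; have hw := evi_noninc hP ew (lexx 0) h0 w0al.
  have hv := conj_valP C0 hw.
  have dM : colspan M (w h - w 0).
    by apply: colspan_sub (ew.1 _ h0) (ew.1 _ (lexx 0)).
  have := evi_val C0 ew (lexx 0) h0 (ew.1 _ (lexx 0)) (conj_valP C0 w0al).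
  rewrite !subrr subr0 [X in _ - X](_ : _ = 0); last by rewrite /pform dot0l.
  rewrite subr0 => h1.
  have h2 := conj_val_le C0 (hu _ _ hv).
  have h3 : Q (w h - w 0) <= 2 * h * (d%:R * `|u| * `|w h - w 0|).
    apply: (le_trans h1); rewrite ler_wpM2l ?mulr_ge0//.
    apply: (@le_trans _ _ (- dot u (w h - w 0))); first by lra.
    by rewrite -dotNl (le_trans (ler_norm _))// (le_trans (dot_norm_le _ _))// normrN.
  have h4 := hKn _ dM.
  have [->|D0] := eqVneq (w h - w 0) 0; first by rewrite normr0 mulr_ge0.
  have Dp : 0 < `|w h - w 0| by rewrite normr_gt0.
  rewrite -(ler_pM2r Dp) -expr2; apply: (le_trans h4).
  have := h3; rewrite -(ler_pM2l Kn0) => h5; apply: (le_trans h5).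
  by rewrite /La le_eqVlt; apply/orP; left; apply/eqP; ring.
exists (Num.sqrt (Kn * Kp) * La).
have main s t : 0 <= s -> s <= t -> `|w t - w s| <= Num.sqrt (Kn * Kp) * La * (t - s).
  move=> s0 st; pose h := t - s; have h0 : 0 <= h by rewrite subr_ge0.
  have ew' : evi_curve M P u0 C (fun=> 0) v0 (fun r => w (h + r)).
    split=> [r r0|r1 r2 v be x r10 r12 vM vbe Cx].
      by apply: ew.1; rewrite addr_ge0.
    have := ew.2 (h + r1) (h + r2) v be x (addr_ge0 h0 r10) _ vM vbe Cx.
    by rewrite lerD2l => /(_ r12); rewrite opprD addrACA subrr add0r.
  have fh : conj_le0 (w (h + 0)) al.
    by rewrite addr0; exact: (evi_noninc hP ew (lexx 0) h0 w0al).
  have := evi_contraction hP C0 ew' ew fh w0al s0.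
  rewrite addr0 /h subrK -/h => cQ.
  have tM : colspan M (w t - w s).
    by apply: colspan_sub (ew.1 _ (le_trans s0 st)) (ew.1 _ s0).
  have : `|w t - w s| ^+ 2 <= Kn * Kp * (La * h) ^+ 2.
    apply: (le_trans (hKn _ tM)); rewrite -mulrA ler_pM2l//.
    apply: (le_trans cQ); apply: (le_trans (ler_norm _)).
    apply: (le_trans (hKp _ _)); rewrite -mulrA ler_pM2l// -expr2.
    by apply: lerXn2r; rewrite ?nnegrE ?(mulr_ge0 La0)//; exact: init.
  move=> /ler_wsqrtr; rewrite sqrtr_sqr ger0_norm//
    (sqrtrM _ (mulr_ge0 (ltW Kn0) (ltW Kp0))).
  by rewrite sqrtr_sqr ger0_norm ?(mulr_ge0 La0)// mulrA.
move=> s t s0 t0; have [st|/ltW ts] := leP s t.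
  by rewrite distrC [`|s - t|]distrC [`|t - s|]ger0_norm ?subr_ge0// main.
by rewrite [`|s - t|]ger0_norm ?subr_ge0// main.
Qed.

End EviLimits.

(** * Compactness of families of flows and identification of the limit *)

Section FlowFamilies.
Context {R : realType} {d : nat}.
Variables (M P : 'M[R]_d) (u0 : 'cV[R]_d).
Hypotheses (hM : psd_mx M) (hP : psd_mx P) (MPM : M *m P *m M = M).
Variable C : set 'cV[R]_d.
Hypotheses (C0 : C !=set0) (cC : closed C) (vC : segment_closed C).
Notation conj_le0 := (conj_le u0 C (fun=> 0)).
Notation Q v := (pform P v v).
Notation mu := (@lebesgue_measure R).

Context {T : Type} (F0 : set_system T) {FF0 : ProperFilter F0}.
Variables (W : T -> R -> 'cV[R]_d) (g : T -> 'cV[R]_d -> R) (eta : T -> R).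
Variables (wb0 a u1 : 'cV[R]_d) (al1 : R).
Hypotheses
  (Wflow : \forall e \near F0, abstract_flow M u0 C (g e) (W e))
  (g_ge : \forall e \near F0, forall x, C x -> - eta e <= g e x)
  (eta0 : eta @ F0 --> 0)
  (g_cvg : forall x, C x -> (fun e => g e x) @ F0 --> 0)
  (W0 : (fun e => W e 0) @ F0 --> wb0)
  (ria : ri (dom (support_fun C)) a)
  (aM : colspan M (a - wb0))
  (W0_span : \forall e \near F0, bspan C (W e 0 - wb0))
  (wb0_fin : conj_le0 wb0 al1)
  (wb0_sub : forall v be, conj_le0 v be -> conj_le0 wb0 (be - dot u1 (v - wb0))).
Implicit Types (v x u : 'cV[R]_d) (w : R -> 'cV[R]_d).

Lemma cvg_finer {X : topologicalType} (F : set_system T) (f : T -> X) (y : X) :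
  F0 `<=` F -> f @ F0 --> y -> f @ F --> y.
Proof. by move=> sF fy A /fy; exact: sF. Qed.

Lemma pform_colspan_eq0 v : colspan M v -> Q v <= 0 -> v = 0.
Proof.
move=> vM Qv; have [K K0 hK] := norm_le_pform hM hP MPM.
have : `|v| ^+ 2 <= 0 by apply: (le_trans (hK _ vM)); rewrite pmulr_rle0.
by rewrite -[leRHS](expr0n R 2)/= ler_sqr ?nnegrE// normr_le0 => /eqP.
Qed.

Lemma cvg_scale (F : set_system T) {FF : Filter F} (k : T -> R) (f : T -> 'cV[R]_d)
    (l : R) v :
  k @ F --> l -> f @ F --> v -> (fun e => k e *: f e) @ F --> l *: v.
Proof. by move=> kl fv; exact: cvgZ. Qed.

(* Shifting a competitor v of the limit flow by W e 0 - wb0 may leave the domain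
   of the support function; mixing in a little of the relative interior point a
   repairs this. *)
Lemma recovery v al : colspan M (v - wb0) -> conj_le0 v al ->
  exists ve : T -> 'cV[R]_d, exists ale : T -> R,
    [/\ ve @ F0 --> v, ale @ F0 --> al,
        \forall e \near F0, colspan M (ve e - W e 0) &
        \forall e \near F0, conj_le u0 C (g e) (ve e) (ale e)].
Proof.
move=> vM val.
have [kap [c [c0 kap0 kapc]]] := ri_barrier_bound ria.
(* This [lam] makes [<dl, x> <= lam (kap - <a, x>)] on C, so the terms [lam <a, x>] cancel and [ale]
   bounds the mixture uniformly in [x]. *)
pose dl e := W e 0 - wb0; pose lam e := c * `|dl e|.
have dl0 : dl @ F0 --> (0 : 'cV[R]_d).
  by rewrite -(subrr wb0); apply: cvgB W0 _; exact: cvg_cst.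
have lam0 : lam @ F0 --> 0.
  have h : (fun e => `|dl e| : R) @ F0 --> (0 : R).
    by rewrite -[X in _ --> X](normr0 'cV[R]_d); exact: cvg_norm dl0.
  have cc : (fun=> c) @ F0 --> c by exact: cvg_cst.
  by have := cvgM cc h; rewrite mulr0; apply.
have lam1 : (fun e => 1 - lam e) @ F0 --> (1 : R).
  by rewrite -[X in _ --> X]subr0; apply: cvgB lam0; exact: cvg_cst.
pose ve e := (1 - lam e) *: v + lam e *: a + dl e.
pose ale e := (1 - lam e) * (al + dot v u0) + lam e * kap - dot (ve e) u0 + eta e.
have vev : ve @ F0 --> v.
  have h1 : (fun e => (1 - lam e) *: v) @ F0 --> 1 *: v.
    by apply: cvg_scale lam1 _; exact: cvg_cst.
  have h2 : (fun e => lam e *: a) @ F0 --> 0 *: a.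
    by apply: cvg_scale lam0 _; exact: cvg_cst.
  have -> : v = 1 *: v + 0 *: a + 0 by rewrite scale1r scale0r !addr0.
  by apply: cvgD dl0; exact: cvgD h1 h2.
exists ve, ale; split => //.
- have h1 : (fun e => (1 - lam e) * (al + dot v u0)) @ F0 --> 1 * (al + dot v u0).
    by apply: cvgM lam1 _; exact: cvg_cst.
  have h2 : (fun e => lam e * kap) @ F0 --> 0 * kap.
    by apply: cvgM lam0 _; exact: cvg_cst.
  have h3 : (fun e => dot (ve e) u0) @ F0 --> dot v u0.
    by apply: cvg_dot vev _; exact: cvg_cst.
  have -> : al = 1 * (al + dot v u0) + 0 * kap - dot v u0 + 0 by ring.
  by apply: cvgD eta0; apply: cvgB h3; exact: cvgD h1 h2.
- apply: nearW => e; rewrite /ve /dl.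
  have -> : (1 - lam e) *: v + lam e *: a + (W e 0 - wb0) - W e 0 =
      (1 - lam e) *: (v - wb0) + lam e *: (a - wb0).
    by apply/colP => i; rewrite !mxE; ring.
  by apply: colspanD; exact: colspanZ.
near=> e => x Cx.
have lam_ge0 : 0 <= lam e by rewrite mulr_ge0// ltW.
have lam_le1 : lam e <= 1.
  by near: e; apply: cvgr_le lam0 _ _; exact: ltr01.
have ge : - eta e <= g e x by have := near g_ge e; apply.
have dle : `|dot (dl e) x| <= lam e * (kap - dot a x).
  by apply: kapc => //; near: e.
have := val x Cx; rewrite subr0 dotBr => vx.
have h1 : (1 - lam e) * dot v x <= (1 - lam e) * (al + dot v u0).
  apply: ler_wpM2l; first by rewrite subr_ge0.
  by lra.
have h2 := le_trans (ler_norm _) dle.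
have E : dot (ve e) x = (1 - lam e) * dot v x + lam e * dot a x + dot (dl e) x.
  by rewrite /ve !dotDl !dotZl.
rewrite /ale dotBr E; move: h1 h2 ge; rewrite !mulrBr; lra.
Unshelve. all: by end_near. Qed.

(** Both times may move with the parameter: constant times give the EVI of the limit, and a moving
    upper time gives uniform convergence. *)
Lemma limit_evi (F : set_system T) {FF : ProperFilter F} (t s : T -> R)
    (t1 s1 : R) (p q : 'cV[R]_d) v (al : R) x :
  F0 `<=` F -> t @ F --> t1 -> s @ F --> s1 ->
  (\forall e \near F, 0 <= s e /\ s e <= t e) ->
  (fun e => W e (t e)) @ F --> p -> (fun e => W e (s e)) @ F --> q ->
  colspan M (v - wb0) -> conj_le0 v al -> C x ->
  Q (p - v) - Q (q - v) <= 2 * (t1 - s1) * (al - (dot p (x - u0) - 0)).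
Proof.
move=> sF tt ss st Wp Wq vM val Cx.
have [ve [ale [/(cvg_finer sF) vev /(cvg_finer sF) alev /sF veM /sF veal]]] :=
  recovery vM val.
have gx := cvg_finer sF (g_cvg Cx).
have h1 : (fun e => Q (W e (t e) - ve e) - Q (W e (s e) - ve e)) @ F -->
    Q (p - v) - Q (q - v).
  by apply: cvgB; apply: cvg_pform; exact: cvgB.
have h2 : (fun e => 2 * (t e - s e) *
     (ale e - (dot (W e (t e)) (x - u0) - g e x))) @ F -->
    2 * (t1 - s1) * (al - (dot p (x - u0) - 0)).
  apply: cvgM; first by apply: cvgM; [exact: cvg_cst|exact: cvgB].
  apply: cvgB alev _; apply: cvgB gx; apply: cvg_dot Wp _; exact: cvg_cst.
rewrite -subr_ge0; apply: (cvgr_to_ge (cvgB h2 h1)); near=> e.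
rewrite /= !fctE subr_ge0.
have [s0 ste] : 0 <= s e /\ s e <= t e by near: e.
have fl : abstract_flow M u0 C (g e) (W e) by near: e; exact: sF.
apply: (flow_evi hM hP MPM C0 fl s0 ste _ _ Cx); near: e; [exact: veM|exact: veal].
Unshelve. all: by end_near. Qed.

(** The EVI from time 0 against recovered competitors for [wb0] bounds [X^2] by [A + B X], where [X]
    is the distance to the competitor; this fails as soon as [X > A + B + 1]. *)
Lemma family_bound (S : R) : exists K, \forall e \near F0,
  forall s, 0 <= s <= S -> `|W e s| <= K.
Proof.
have [x Cx] := C0.
have [Kn Kn0 hKn] := norm_le_pform hM hP MPM.
have [|ve [ale [vev alev veM veal]]] := recovery _ wb0_fin.
  by rewrite subrr; exact: colspan0.
pose S' := `|S|.
pose c2 := al1 - (dot wb0 (x - u0) - 0) + 1.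
pose c3 := d%:R * `|x - u0|.
pose A := Kn * (1 + 2 * S' * `|c2|); pose B := Kn * (2 * S' * c3).
have S'0 : 0 <= S' by exact: normr_ge0.
have c30 : 0 <= c3 by exact: mulr_ge0.
have A0 : 0 <= A by rewrite mulr_ge0 ?(ltW Kn0)// addr_ge0// !mulr_ge0.
have B0 : 0 <= B by rewrite mulr_ge0 ?(ltW Kn0)// !mulr_ge0.
exists (A + B + 1 + (`|wb0| + 1)).
have h1 : (fun e => Q (W e 0 - ve e)) @ F0 --> Q (wb0 - wb0).
  by apply: cvg_pform; exact: cvgB.
have z0 : Q (wb0 - wb0) = 0 by rewrite subrr /pform dot0l.
rewrite z0 in h1.
have h2 : (fun e => ale e - (dot (ve e) (x - u0) - g e x)) @ F0 -->
    al1 - (dot wb0 (x - u0) - 0).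
  apply: cvgB alev _; apply: cvgB (g_cvg Cx); apply: cvg_dot vev _; exact: cvg_cst.
near=> e => s /andP[s0 sS].
have fl : abstract_flow M u0 C (g e) (W e) by near: e.
have e1 : Q (W e 0 - ve e) <= 1.
  by near: e; apply: cvgr_le h1 _ _; exact: ltr01.
have e2 : ale e - (dot (ve e) (x - u0) - g e x) <= c2.
  by near: e; apply: cvgr_le h2 _ _; rewrite ltrDl.
have e3 : `|ve e| <= `|wb0| + 1.
  by near: e; apply: cvgr_le (cvg_norm vev) _ _; rewrite ltrDl.
have e4 : colspan M (ve e - W e 0) by near: e.
have e5 : conj_le u0 C (g e) (ve e) (ale e) by near: e.
have := flow_evi hM hP MPM C0 fl (lexx 0) s0 e4 e5 Cx.
rewrite subr0; set D := W e s - ve e => ev.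
rewrite -(subrK (ve e) (W e s)) -/D (le_trans (ler_normD _ _))// lerD//.
have DM : colspan M D.
  have := colspanB (flow_colspan MPM fl (lexx 0) s0) e4.
  by rewrite opprB addrA subrK.
set X := `|D|; have X0 : 0 <= X by exact: normr_ge0.
have e6 : - dot D (x - u0) <= c3 * X.
  rewrite -dotNl; apply: (le_trans (ler_norm _)).
  by apply: (le_trans (dot_norm_le _ _)); rewrite normrN /c3 mulrAC.
have e7 : Q D <= 1 + 2 * S' * (`|c2| + c3 * X).
  have sS' : s <= S' by rewrite (le_trans sS)// ler_norm.
  have E : dot (W e s) (x - u0) = dot (ve e) (x - u0) + dot D (x - u0).
    by rewrite /D dotBl; ring.
  have h : ale e - (dot (W e s) (x - u0) - g e x) <= `|c2| + c3 * X.
    by rewrite E; have := ler_norm c2; lra.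
  have : 2 * s * (ale e - (dot (W e s) (x - u0) - g e x)) <=
      2 * S' * (`|c2| + c3 * X).
    apply: (@le_trans _ _ (2 * s * (`|c2| + c3 * X))).
      by apply: ler_wpM2l; [exact: mulr_ge0|].
    apply: ler_wpM2r; last by rewrite ler_pM2l.
    by apply: addr_ge0 => //; exact: mulr_ge0.
  lra.
have e8 : X ^+ 2 <= A + B * X.
  apply: (le_trans (hKn _ DM)); apply: (@le_trans _ _ (Kn * (1 + 2 * S' * (`|c2| + c3 * X)))).
    by rewrite ler_pM2l.
  by rewrite /A /B le_eqVlt; apply/orP; left; apply/eqP; ring.
rewrite leNgt; apply/negP => X1.
have X1' : 1 <= X by lra.
have : A + B * X < X ^+ 2.
  rewrite expr2; apply: (@le_lt_trans _ _ ((A + B) * X)).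
    by rewrite mulrDl lerD2r ler_peMr.
  by rewrite ltr_pM2r; lra.
by rewrite ltNge e8.
Unshelve. all: by end_near. Qed.

Lemma ultra_limit (U : set_system T) (s : T -> R) (S : R) :
  UltraFilter U -> F0 `<=` U -> (\forall e \near U, 0 <= s e <= S) ->
  exists p : 'cV[R]_d, (fun e => W e (s e)) @ U --> p.
Proof.
move=> UU sU sS; have UP : ProperFilter U by exact: ultra_proper.
have [K /sU WK] := family_bound S.
have cK := @closed_bounded_compact_col R d setT K closedT.
have [|p _ Wp] := ultra_compact_cvg (f := fun e => W e (s e)) UU cK; last by exists p.
near=> e; split => //=; near: e; apply: filterS2 WK sS => e; exact.
Unshelve. all: by end_near. Qed.

(** Bounded values converge along an ultrafilter at every time at once, so no equicontinuity and no
    diagonal extraction is involved. *)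
Lemma ultra_curve (U : set_system T) : UltraFilter U -> F0 `<=` U ->
  exists w, [/\ w 0 = wb0, evi_curve M P u0 C (fun=> 0) wb0 w &
    forall s, 0 <= s -> (fun e => W e s) @ U --> w s].
Proof.
move=> UU sU; have UP : ProperFilter U by exact: ultra_proper.
have /choice[w Ww] s : exists p : 'cV[R]_d, 0 <= s -> (fun e => W e s) @ U --> p.
  have [s0|s0] := leP 0 s; last by exists 0.
  have [|p Wp] := @ultra_limit U (fun=> s) s UU sU; last by exists p.
  by apply: nearW => e; rewrite s0 lexx.
have w0 : w 0 = wb0.
  have h1 := Ww 0 (lexx 0); have h2 := cvg_finer sU W0.
  exact: cvg_unique h1 h2.
exists w; split => //; split => [t t0|s t v al x s0 st vM val Cx].
  apply: (colspan_cvg MPM (F := U) (f := fun e => W e t - W e 0)).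
    apply: sU; apply: filterS Wflow => e fl.
    exact: (flow_colspan MPM fl (lexx 0) t0).
  apply: cvgB; [exact: Ww|exact: cvg_finer sU W0].
apply: (limit_evi (F := U) (t := fun=> t) (s := fun=> s)) => //.
- exact: cvg_cst.
- exact: cvg_cst.
- by apply: nearW.
- by apply: Ww; exact: le_trans st.
- exact: Ww.
Qed.

(** If uniform convergence failed, some ultrafilter would concentrate on bad parameters, with bad
    times [s i] tending to [s1] and values [W i (s i)] to [p]. The EVI started just before [s1]
    forces [p = w s1], which contradicts the gap [e]. *)
Lemma limit_curve : exists w, [/\ w 0 = wb0,
  evi_curve M P u0 C (fun=> 0) wb0 w,
  exists L, forall s t, 0 <= s -> 0 <= t -> `|w s - w t| <= L * `|s - t| &
  forall S e, 0 <= S -> 0 < e ->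
    \forall i \near F0, forall s, 0 <= s <= S -> `|W i s - w s| < e].
Proof.
have [U0 [UU0 sU0]] := ultraFilterLemma FF0.
have [w [w0 ew _]] := ultra_curve UU0 sU0.
have w0al : conj_le0 (w 0) al1 by rewrite w0.
have [L wL] : exists L, forall s t, 0 <= s -> 0 <= t -> `|w s - w t| <= L * `|s - t|.
  by apply: (evi_lipschitz hM hP MPM C0 ew w0al (u := u1)); rewrite w0.
exists w; split => //; first by exists L.
move=> S e S0 e0; apply: contrapT => nF.
pose bad i := exists2 s, 0 <= s <= S & e <= `|W i s - w s|.
have [|U [UU sU Ubad]] := frequently_ultra (B := bad) (F := F0) _.
  move=> h; apply: nF; apply: filterS h => i nb s sS.
  by rewrite ltNge; apply/negP => h; apply: nb; exists s.
have UP : ProperFilter U by exact: ultra_proper.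
have /choice[s sP] i : exists s, bad i -> 0 <= s <= S /\ e <= `|W i s - w s|.
  have [[s sS es]|nb] := pselect (bad i); first by exists s.
  by exists 0.
have sS : \forall i \near U, 0 <= s i <= S by apply: filterS Ubad => i /sP[].
have se : \forall i \near U, e <= `|W i (s i) - w (s i)|.
  by apply: filterS Ubad => i /sP[].
have [s1 s1S ss] : exists2 s1, `[0, S]%classic s1 & s @ U --> s1.
  apply: ultra_compact_cvg UU (@segment_compact R 0 S) _.
  by apply: filterS sS => i; rewrite /= in_itv.
have {s1S}/andP[s10 s1S] : 0 <= s1 <= S by move: s1S; rewrite /= in_itv.
have [p Wp] := ultra_limit UU sU sS.
have [w' [w'0 ew' Ww']] := ultra_curve UU sU.
have Q00 : Q (0 : 'cV[R]_d) = 0 by rewrite /pform dot0l.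
have ww' t : 0 <= t -> w' t = w t.
  move=> t0; have w'0al : conj_le0 (w' 0) al1 by rewrite w'0.
  have := evi_contraction hP C0 ew' ew w'0al w0al t0.
  rewrite w0 w'0 subrr Q00 => Q0; apply/eqP; rewrite -subr_eq0; apply/eqP.
  exact: pform_colspan_eq0 (colspan_sub (ew'.1 _ t0) (ew.1 _ t0)) Q0.
have [x Cx] := C0.
pose ka := al1 - (dot p (x - u0) - 0).
have pM : colspan M (p - wb0).
  apply: (colspan_cvg MPM (F := U) (f := fun i => W i (s i) - W i 0)).
    apply: filterS2 (sU _ Wflow) sS => i fl /andP[si0 _].
    exact: (flow_colspan MPM fl (lexx 0) si0).
  by apply: cvgB Wp _; exact: cvg_finer sU W0.
(* The starting time must eventually precede [s i]: this holds when [t < s1], and for [t = 0], which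
   covers the case [s1 = 0]. *)
have key t : 0 <= t -> (t < s1 \/ t = 0) -> Q (p - w t) <= 2 * (s1 - t) * ka.
  move=> t0 ts1; have tw : (fun i => W i t) @ U --> w t by rewrite -ww'//; exact: Ww'.
  have := limit_evi (F := U) (t := s) (s := fun=> t) sU ss (cvg_cst t) _ Wp tw
    (ew.1 t t0) (evi_noninc hP ew (lexx 0) t0 w0al) Cx.
  rewrite subrr Q00 subr0; apply; case: ts1 => [ts1|->]; last by apply: filterS sS => i /andP[].
  by apply: filterS (cvgr_gt s1 ss _ ts1) => i /ltW.
have lipc (I : Type) (F : set_system I) (FF : Filter F) (r : I -> R) (r1 : R) :
    0 <= r1 -> (\forall i \near F, 0 <= r i) -> r @ F --> r1 ->
    (fun i => w (r i)) @ F --> w r1.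
  move=> r10 rF rr; apply/cvgrPdist_le => ep ep0.
  have L0 : 0 < `|L| + 1 by rewrite ltr_wpDl.
  move/cvgrPdist_le: rr => /(_ _ (divr_gt0 ep0 L0)) rr.
  near=> i; have ri0 : 0 <= r i by near: i.
  apply: (le_trans (wL _ _ r10 ri0)); apply: (@le_trans _ _ ((`|L| + 1) * `|r1 - r i|)).
    by rewrite ler_wpM2r// (le_trans (ler_norm _))// lerDl.
  by rewrite -ler_pdivlMl// mulrC; near: i.
have pw : p - w s1 = 0.
  apply: pform_colspan_eq0; first exact: colspan_sub pM (ew.1 _ s10).
  move: s10; rewrite le_eqVlt => /predU1P[s1E|s1p].
    by have := key 0 (lexx 0) (or_intror erefl); rewrite -s1E subrr mulr0 mul0r.
  have tc : (fun t : R => t) @ s1^'- --> s1 by exact: cvg_at_left_filter cvg_id.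
  have wc : (fun t => w t) @ s1^'- --> w s1.
    apply: lipc => //; first exact: ltW.
    near=> t; apply: ltW; near: t; exact: nbhs_left_gt.
  have c1 : (fun t => Q (p - w t)) @ s1^'- --> Q (p - w s1).
    by apply: cvg_pform; apply: cvgB wc; exact: cvg_cst.
  have c2 : (fun t => 2 * (s1 - t) * ka) @ s1^'- --> 2 * (s1 - s1) * ka.
    apply: cvgM; last exact: cvg_cst.
    apply: cvgM; first exact: cvg_cst.
    by apply: cvgB tc; exact: cvg_cst.
  rewrite subrr mulr0 mul0r in c2.
  rewrite -oppr_ge0 -[leRHS]add0r; apply: (cvgr_to_ge (cvgB c2 c1)); near=> t.
  rewrite /= !fctE subr_ge0; apply: key; last by left; near: t; exact: nbhs_left_lt.
  by apply: ltW; near: t; exact: nbhs_left_gt.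
have wsc : (fun i => w (s i)) @ U --> w s1.
  by apply: lipc => //; apply: filterS sS => i /andP[].
have d1 : (fun i => W i (s i) - w (s i)) @ U --> p - w s1 by exact: cvgB Wp wsc.
have nc : (fun i => `|W i (s i) - w (s i)|) @ U --> `|p - w s1| by exact: cvg_norm d1.
have : e <= `|p - w s1| by exact: cvgr_to_ge nc se.
rewrite pw normr0.
by rewrite leNgt e0.
Unshelve. all: by end_near. Qed.

End FlowFamilies.

(** * Strong convergence of the velocities *)

Section FlowDensity.
Context {R : realType} {d : nat}.
Notation mu := (@lebesgue_measure R).
Implicit Types (w G H : R -> 'cV[R]_d) (P : 'M[R]_d) (S : R).

Definition vbmeas (a b : R) G := forall i, bmeas a b (fun t => G t i 0).

(** A bounded measurable representative of the velocity, defined at all times so that it can be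
    integrated. *)
Definition density S w G := vbmeas 0 S G /\
  {ae mu, forall t : R, 0 < t < S -> is_derive t (1 : R) w (G t)}.

Lemma density_exists S w : 0 < S -> vlip 0 S w -> exists G, density S w G.
Proof.
move=> S0 wl.
have /choice[g gP] i : exists g : R -> R, bmeas 0 S g /\
    {ae mu, forall t : R, 0 < t < S -> is_derive t (1 : R) (fun r => w r i 0) (g t)}.
  have [L L0 wL] := lipW (wl i).
  have [g [mg gL _ gd]] := lipschitz_density L0 S0 wL.
  by exists g; split => //; split; [exact: measurable_funTS|exists L].
exists (fun t => \col_i g i t); split.
  by move=> i; under eq_fun do rewrite mxE; case: (gP i).
have AF := ae_filter_ringOfSetsType mu.
have H := @filter_forall _ _ _ _ AF (fun i => (gP i).2).
apply: (aeS _ H) => t Ht tS; apply: is_derive_col => i; rewrite mxE; exact: Ht.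
Qed.

Lemma vbmeasB a b G H : vbmeas a b G -> vbmeas a b H -> vbmeas a b (fun t => G t - H t).
Proof.
move=> bG bH i; under eq_fun do rewrite !mxE.
by apply: bmeasD (bG i) _; exact: bmeasN.
Qed.

Lemma vbmeas_vlip a b w : vlip a b w -> vbmeas a b w.
Proof. by move=> wl i; exact: bmeas_lip. Qed.

Lemma vbmeas_sub a b a' b' G : a <= a' -> b' <= b -> vbmeas a b G -> vbmeas a' b' G.
Proof. by move=> aa bb bG i; exact: bmeas_sub (bG i). Qed.

Lemma bmeas_pform a b P G H : vbmeas a b G -> vbmeas a b H ->
  bmeas a b (fun t => pform P (G t) (H t)).
Proof.
move=> bG bH; apply: bmeas_sum => i; apply: bmeasM => //.
under eq_fun do rewrite mxE.
by apply: bmeas_sum => j; apply: bmeasM => //; exact: bmeas_cst.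
Qed.

Lemma bmeas_tpform a b P G H : vbmeas a b G -> vbmeas a b H ->
  bmeas a b (fun t => t * pform P (G t) (H t)).
Proof. by move=> bG bH; apply: bmeasM (bmeas_pform P bG bH); exact/bmeas_lip/lip_id. Qed.

Lemma vbmeas_bound a b G : vbmeas a b G -> exists2 K, 0 <= K &
  forall t, a <= t <= b -> `|G t| <= K.
Proof.
move=> bG; have /choice[k kP] i : exists k, forall t, a <= t <= b -> `|G t i 0| <= k.
  by have [_ [K GK]] := bG i; exists K.
exists (\sum_i `|k i|); first exact: sumr_ge0.
move=> t tab; apply: norm_col_le => [|i]; first exact: sumr_ge0.
apply: (le_trans (kP i t tab)); apply: (le_trans (ler_norm _)).
by rewrite (bigD1 i)//= lerDl sumr_ge0.
Qed.

End FlowDensity.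

Section FlowEnergy.
Context {R : realType} {d : nat}.
Notation mu := (@lebesgue_measure R).
Variables (M P : 'M[R]_d) (u0 : 'cV[R]_d).
Hypotheses (hM : psd_mx M) (hP : psd_mx P) (MPM : M *m P *m M = M).
Variables (C : set 'cV[R]_d) (g : 'cV[R]_d -> R).
Hypothesis C0 : C !=set0.
Notation Q v := (pform P v v).
Notation E v := (conj_val u0 C g v).
Variables (w G : R -> 'cV[R]_d) (S : R).
Hypotheses (fw : abstract_flow M u0 C g w) (dG : density S w G).

Lemma flow_density_ae : {ae mu, forall t : R, 0 < t < S -> exists u,
  [/\ G t = - (M *m u), is_derive t (1 : R) w (- (M *m u)),
      is_derive t (1 : R) (fun r => E (w r)) (- Q (G t)) &
      forall v al, colspan M (v - w t) -> conj_le u0 C g v al ->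
        conj_le u0 C g (w t) (al - dot u (v - w t))]}.
Proof.
apply: aeS2 dG.2 (flow_ae hM hP MPM C0 fw) => t dGt Ht tS.
have [u [dw dE sub]] := Ht (andP tS).1.
have GE : G t = - (M *m u).
  by have [_ <-] := dGt tS; have [_ <-] := dw.
exists u; split => //.
by rewrite GE pformNl pformNr opprK (pform_mulmx hM hP MPM).
Qed.

Let tE_lip s s' : 0 <= s -> lip s s' (fun t => t * E (w t)).
Proof.
move=> s0; apply: lipM; first exact: lip_id.
by apply: lip_sub (flow_conj_val_lip0 hM hP MPM C0 fw s').
Qed.

(** Since [(t E)' = E - t Q], the first line is the integral of E over the piece. The function
    [- t E - Q(w - v) / 2] has derivative at least [t Q - al]; this bounds the integral by
    quantities that converge with the family, whereas its energies need not. *)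
Lemma piece_upper s s' v al : 0 <= s -> s <= s' -> s' <= S ->
  colspan M (v - w 0) -> conj_le u0 C g v al ->
  \int[mu]_(t in `[s, s']) (t * Q (G t)) + s' * E (w s') - s * E (w s) <=
  (s' - s) * al + 2^-1 * Q (w s - v).
Proof.
move=> s0 ss' s'S vM val.
pose f t := - (t * E (w t)) + - (2^-1 * Q (w t - v)).
have fl : lip s s' f.
  apply: lipD; first by apply: lipN; exact: tE_lip.
  apply: lipN; apply: lipM; first exact: lip_cst.
  have wl : vlip s s' (fun t => w t - v).
    apply: vlipB (vlip_cst _ _ _) => i.
    by apply: lip_sub (flow_vlip fw s' i).
  exact: lip_pform.
have bG : vbmeas s s' G by apply: vbmeas_sub dG.1.
have bk := bmeas_tpform P bG bG.
have bc := bmeas_cst s s' (- al).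
have := lip_ge_Rintegral ss' fl (bmeasD bk bc).
rewrite bmeas_RintegralD// Rintegral_itv_cst// => H.
have {}H : \int[mu]_(t in `[s, s']) (t * Q (G t)) + - al * (s' - s) <= f s' - f s.
  apply: H; apply: aeS flow_density_ae => t Ht /andP[st ts'].
  have t0 : 0 < t by exact: le_lt_trans st.
  have tS : 0 < t < S by rewrite t0 (lt_le_trans ts').
  have [u [GE dw dE sub]] := Ht tS.
  have vt : colspan M (w t - v).
    have := colspanB (flow_colspan MPM fw (lexx 0) (ltW t0)) vM.
    by rewrite opprB addrA subrK.
  have dQ := dist_derive hM hP MPM vt dw.
  have dt := is_derive_id t (1 : R).
  have d1 := is_deriveN (is_deriveM dt dE).
  have d2 := is_deriveN (is_deriveZ (2^-1 : R) dQ).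
  exists (- (t *: - Q (G t) + E (w t) *: 1) + - (2^-1 *: (2 * dot u (v - w t)))).
    exact: (is_deriveD d1 d2).
  have vt' : colspan M (v - w t) by rewrite -opprB; exact: colspanN.
  have := conj_val_le C0 (sub _ _ vt' val).
  by rewrite /GRing.scale/= mulr1 mulrA mulVf// mul1r; lra.
have := pform_ge0 (w s' - v) hP.
by move: H; rewrite /f; lra.
Qed.

(** The same integral of E is at least the length times the final value, because E decreases. *)
Lemma piece_lower s s' : 0 <= s -> s <= s' -> s' <= S ->
  (s' - s) * E (w s') <=
  \int[mu]_(t in `[s, s']) (t * Q (G t)) + s' * E (w s') - s * E (w s).
Proof.
move=> s0 ss' s'S.
have bG : vbmeas s s' G by apply: vbmeas_sub dG.1.
have bk := bmeasN (bmeas_tpform P bG bG).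
have bc := bmeas_cst s s' (E (w s')).
have := lip_ge_Rintegral ss' (tE_lip s' s0) (bmeasD bk bc).
rewrite bmeas_RintegralD// Rintegral_itv_cst// bmeas_RintegralN; last exact: bmeas_tpform.
move=> H; have {}H : - (\int[mu]_(t in `[s, s']) (t * Q (G t))) + E (w s') * (s' - s) <=
    s' * E (w s') - s * E (w s).
  apply: H; apply: aeS flow_density_ae => t Ht /andP[st ts'].
  have t0 : 0 < t by exact: le_lt_trans st.
  have tS : 0 < t < S by rewrite t0 (lt_le_trans ts').
  have [u [GE dw dE sub]] := Ht tS.
  have dt := is_derive_id t (1 : R).
  exists (t *: - Q (G t) + E (w t) *: 1); first exact: (is_deriveM dt dE).
  have := flow_conj_val_noninc hM hP MPM C0 fw (ltW t0) (ltW ts').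
  by rewrite /GRing.scale/= mulr1; lra.
lra.
Qed.

End FlowEnergy.

Section StrongConvergence.
Context {R : realType} {d : nat}.
Notation mu := (@lebesgue_measure R).
Variables (M P : 'M[R]_d) (u0 : 'cV[R]_d).
Hypotheses (hM : psd_mx M) (hP : psd_mx P) (MPM : M *m P *m M = M).
Variable C : set 'cV[R]_d.
Hypotheses (C0 : C !=set0).
Notation conj_le0 := (conj_le u0 C (fun=> 0)).
Notation Q v := (pform P v v).
Notation E0 v := (conj_val u0 C (fun=> 0) v).

Context {T : Type} (F0 : set_system T) {FF0 : ProperFilter F0}.
Variables (W : T -> R -> 'cV[R]_d) (g : T -> 'cV[R]_d -> R) (w : R -> 'cV[R]_d).
Variables (S : R) (G : T -> R -> 'cV[R]_d) (Gb : R -> 'cV[R]_d).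
Hypotheses (S0 : 0 < S)
  (Wflow : \forall e \near F0, abstract_flow M u0 C (g e) (W e))
  (wflow : abstract_flow M u0 C (fun=> 0) w)
  (g_cvg : forall x, C x -> (fun e => g e x) @ F0 --> 0)
  (rec : forall v al, colspan M (v - w 0) -> conj_le0 v al ->
    exists ve : T -> 'cV[R]_d, exists ale : T -> R,
      [/\ ve @ F0 --> v, ale @ F0 --> al,
          \forall e \near F0, colspan M (ve e - W e 0) &
          \forall e \near F0, conj_le u0 C (g e) (ve e) (ale e)])
  (Wunif : forall e, 0 < e ->
    \forall i \near F0, forall s, 0 <= s <= S -> `|W i s - w s| < e)
  (dG : \forall e \near F0, density S (W e) (G e))
  (dGb : density S w Gb).
Implicit Types (s t : R).

Let X e s s' := \int[mu]_(t in `[s, s']) (t * Q (G e t)) +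
  (s' * conj_val u0 C (g e) (W e s') - s * conj_val u0 C (g e) (W e s)).
Let Xb s s' := \int[mu]_(t in `[s, s']) (t * Q (Gb t)) + (s' * E0 (w s') - s * E0 (w s)).

Let Wcvg s : 0 <= s <= S -> (fun e => W e s) @ F0 --> w s.
Proof.
move=> sS; apply/cvgrPdist_le => e e0; near=> i.
by rewrite distrC; apply: ltW; move: s sS; near: i; exact: Wunif.
Unshelve. all: by end_near. Qed.

Lemma split_X (f : R -> R) (a b c : R) (e : R -> R) : 0 <= a -> a <= b -> b <= c -> c <= S ->
  bmeas 0 S f ->
  \int[mu]_(t in `[a, c]) f t + (c * e c - a * e a) =
  (\int[mu]_(t in `[a, b]) f t + (b * e b - a * e a)) +
  (\int[mu]_(t in `[b, c]) f t + (c * e c - b * e b)).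
Proof.
move=> a0 ab bc cS bf; rewrite (Rintegral_itv_split ab bc); first by ring.
exact/bmeas_integrable/(bmeas_sub a0 cS bf).
Qed.

(* X collects the terms of the energy identity on a piece of the time interval;
   the error is quadratic in the length of the piece, so it disappears along
   refined partitions. *)
Lemma piece_energy : exists La, forall s s' e, 0 <= s -> s <= s' -> s' <= S ->
  0 < e -> \forall i \near F0, X i s s' <= Xb s s' + La * (s' - s) ^+ 2 + e.
Proof.
have [La La0 wL] := flow_conj_val_lip hM hP MPM C0 wflow.
exists La => s s' e s0 ss' s'S e0.
have s'0 := le_trans s0 ss'.
have vM := flow_colspan MPM wflow (lexx 0) s0.
have [ve [ale [vev alev veM veal]]] := rec vM (flow_conj_val hM hP MPM C0 wflow s0).
have c1 : (fun i => (s' - s) * ale i + 2^-1 * Q (W i s - ve i)) @ F0 -->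
    (s' - s) * E0 (w s) + 2^-1 * Q (w s - w s).
  apply: cvgD; apply: cvgM => //; try exact: cvg_cst.
  by apply: cvg_pform; apply: cvgB => //; apply: Wcvg; rewrite s0 (le_trans ss').
have Q00 : Q (w s - w s) = 0 by rewrite subrr /pform dot0l.
rewrite Q00 mulr0 addr0 in c1.
have lowb := piece_lower hM hP MPM C0 wflow dGb s0 ss' s'S.
have hE : (s' - s) * E0 (w s) <= (s' - s) * E0 (w s') + La * (s' - s) ^+ 2.
  rewrite expr2 mulrCA -mulrDr ler_wpM2l ?subr_ge0// -lerBlDl.
  apply: (le_trans (ler_norm _)); apply: (le_trans (wL _ _ s0 s'0)).
  by rewrite distrC ger0_norm ?subr_ge0.
near=> i.
have fi : abstract_flow M u0 C (g i) (W i) by near: i.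
have di : density S (W i) (G i) by near: i.
have vi : colspan M (ve i - W i 0) by near: i.
have ai : conj_le u0 C (g i) (ve i) (ale i) by near: i.
have ub := piece_upper hM hP MPM C0 fi di s0 ss' s'S vi ai.
have h1 : (s' - s) * ale i + 2^-1 * Q (W i s - ve i) <= (s' - s) * E0 (w s) + e.
  by near: i; apply: (cvgr_le _ c1); rewrite ltrDl.
by rewrite /X /Xb; lra.
Unshelve. all: by end_near. Qed.

Lemma total_energy_X e : 0 < e -> \forall i \near F0, X i 0 S <= Xb 0 S + e.
Proof.
move=> e0; have [La pe] := piece_energy.
have bGb := bmeas_tpform P dGb.1 dGb.1.
(* [n] is chosen so that the quadratic errors of all [n + 1] pieces sum to at most [e / 2]; the
   pieces share the other half through [ep]. *)
pose D := 2 * (`|La| * S ^+ 2) / e.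
have [n nD] : exists n : nat, D < n.+1%:R.
  by exists (Num.truncn D); rewrite truncnS_gt.
have n0 : 0 < n.+1%:R :> R by [].
pose h := S / n.+1%:R; have h0 : 0 < h by rewrite divr_gt0.
pose ep := e / (2 * n.+1%:R); have ep0 : 0 < ep by rewrite divr_gt0// mulr_gt0.
have grid k : (k <= n.+1)%N -> \forall i \near F0,
    X i 0 (k%:R * h) <= Xb 0 (k%:R * h) + k%:R * (La * h ^+ 2 + ep).
  elim: k => [_|k IH kn].
    apply: nearW => i; rewrite /X /Xb !mul0r !set_itv1 !Rintegral_set1; lra.
  have {}IH := IH (ltnW kn).
  have kh0 : 0 <= k%:R * h by rewrite mulr_ge0// ltW.
  have kS : k%:R * h <= k.+1%:R * h by rewrite ler_wpM2r ?ler_nat// ltW.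
  have kSS : k.+1%:R * h <= S.
    rewrite /h mulrA ler_pdivrMr// mulrC ler_pM2l//.
    by rewrite ler_nat.
  have := pe _ _ ep kh0 kS kSS ep0.
  have hE : k.+1%:R * h - k%:R * h = h by rewrite -natr1; ring.
  rewrite hE => pk; near=> i.
  have di : density S (W i) (G i) by near: i.
  have bGi := bmeas_tpform P di.1 di.1.
  have sX : X i 0 (k.+1%:R * h) = X i 0 (k%:R * h) + X i (k%:R * h) (k.+1%:R * h).
    exact: (split_X (fun t => conj_val u0 C (g i) (W i t)) (lexx 0) kh0 kS kSS bGi).
  have sXb : Xb 0 (k.+1%:R * h) = Xb 0 (k%:R * h) + Xb (k%:R * h) (k.+1%:R * h).
    exact: (split_X (fun t => E0 (w t)) (lexx 0) kh0 kS kSS bGb).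
  have i1 : X i 0 (k%:R * h) <= Xb 0 (k%:R * h) + k%:R * (La * h ^+ 2 + ep) by near: i.
  have i2 : X i (k%:R * h) (k.+1%:R * h) <=
    Xb (k%:R * h) (k.+1%:R * h) + La * h ^+ 2 + ep by near: i.
  have -> : k.+1%:R * (La * h ^+ 2 + ep) =
      k%:R * (La * h ^+ 2 + ep) + (La * h ^+ 2 + ep) by rewrite -natr1; ring.
  rewrite sX sXb; lra.
have nh : n.+1%:R * h = S by rewrite /h mulrC divfK// gt_eqF.
have := grid n.+1 (leqnn _); rewrite nh; apply: filterS => i.
move=> /le_trans; apply; rewrite lerD2l mulrDr.
have -> : n.+1%:R * ep = e / 2 by rewrite /ep; field; rewrite gt_eqF//= addr_gt0.
have -> : n.+1%:R * (La * h ^+ 2) = La * S ^+ 2 / n.+1%:R.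
  by rewrite /h; field; rewrite gt_eqF//= addr_gt0.
have : La * S ^+ 2 / n.+1%:R <= e / 2.
  rewrite ler_pdivrMr//.
  apply: (@le_trans _ _ (`|La| * S ^+ 2)).
    by rewrite ler_wpM2r ?ler_norm// sqr_ge0.
  have := ltW nD; rewrite /D ler_pdivrMr//; lra.
by move=> h1; rewrite [leRHS]splitr lerD2r.
Unshelve. all: by end_near. Qed.

Let A e := \int[mu]_(t in `[0, S]) (t * Q (G e t)).
Let Ab := \int[mu]_(t in `[0, S]) (t * Q (Gb t)).

(** In the total bound the term [t E] vanishes at 0. At time [S] it is lower semicontinuous: a
    nearly optimal [x] for the limit bounds the energies of the family from below. *)
Lemma energy_limsup e : 0 < e -> \forall i \near F0, A i <= Ab + e.
Proof.
move=> e0; have SS : 0 <= S <= S by rewrite lexx ltW.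
have hE := flow_conj_val hM hP MPM C0 wflow (ltW S0).
have e20 : 0 < e / 2 / S by rewrite !divr_gt0.
have [x Cx hx] : exists2 x, C x & E0 (w S) - e / 2 / S < dot (w S) (x - u0) - 0.
  have hs : has_sup [set dot (w S) (x - u0) - 0 | x in C].
    split; first by have [y Cy] := C0; exists (dot (w S) (y - u0) - 0), y.
    by exists (E0 (w S)) => _ [y Cy <-]; exact: hE.
  by have [_ [x Cx <-] hx] := sup_adherent e20 hs; exists x.
have c1 : (fun i => dot (W i S) (x - u0) - g i x) @ F0 --> dot (w S) (x - u0) - 0.
  apply: cvgB; last exact: g_cvg.
  by apply: cvg_dot (cvg_cst _); exact: Wcvg.
have e2 : 0 < e / 2 by rewrite divr_gt0.
have tX := total_energy_X e2.
near=> i.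
have fi : abstract_flow M u0 C (g i) (W i) by near: i.
have h1 : E0 (w S) - e / 2 / S <= dot (W i S) (x - u0) - g i x.
  by apply: ltW; near: i; apply: (cvgr_gt _ c1).
have h2 := flow_conj_val hM hP MPM C0 fi (ltW S0) Cx.
have h3 : X i 0 S <= Xb 0 S + e / 2 by near: i.
have h4 : S * E0 (w S) - e / 2 <= S * conj_val u0 C (g i) (W i S).
  have := le_trans h1 h2; rewrite -(ler_pM2l S0) mulrBr.
  by rewrite [S * (_ / S)]mulrC divfK ?gt_eqF.
by move: h3; rewrite /X /Xb !mul0r -/(A i) -/Ab; lra.
Unshelve. all: by end_near. Qed.

Variable L : R.
Hypothesis wL : forall s t, 0 <= s -> 0 <= t -> `|w s - w t| <= L * `|s - t|.

(** The limit velocity is only bounded and measurable; these Lipschitz approximations of it can be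
    differentiated in an integration by parts. *)
Lemma difference_quotient_cvg : exists D : nat -> R -> 'cV[R]_d,
  (forall n, vlip 0 S (D n)) /\
  (fun n => \int[mu]_(t in `[0, S]) (t * Q (Gb t - D n t))) @ \oo --> 0.
Proof.
pose D n t := n.+1%:R *: (w (t + n.+1%:R^-1) - w t).
have Dl n : vlip 0 S (D n).
  move=> i; under eq_fun do rewrite !mxE.
  apply: lipM (lip_cst _ _ _) _; apply: lipD; last first.
    apply: lipN; exact: nneg_vlip wL S i.
  exists L => s t /andP[s0 _] /andP[t0 _].
  have n0 : 0 <= n.+1%:R^-1 :> R by rewrite invr_ge0.
  have := wL (addr_ge0 s0 n0) (addr_ge0 t0 n0).
  rewrite opprD addrACA subrr addr0; apply: le_trans.
  by have := coord_le (w (s + n.+1%:R^-1) - w (t + n.+1%:R^-1)) i; rewrite !mxE.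
exists D; split => //.
have [KG KG0 hKG] := vbmeas_bound dGb.1.
have [Kp Kp0 hKp] := pform_bound P.
have DL n t : 0 <= t -> `|D n t| <= `|L|.
  move=> t0; rewrite /D normrZ normr_nat -ler_pdivlMl// mulrC.
  have := wL (addr_ge0 t0 (ltW (_ : 0 < n.+1%:R^-1))) t0.
  rewrite invr_gt0 ltr0Sn => /(_ isT) h; apply: (le_trans h).
  rewrite addrAC subrr add0r ger0_norm ?invr_ge0// ler_wpM2r ?invr_ge0//.
  exact: ler_norm.
apply: (@dominated_Rintegral_cvg0 _ _ _ _ (S * (Kp * (KG + `|L|) ^+ 2))).
- move=> n; apply: bmeas_tpform; apply: vbmeasB dGb.1 _; exact: vbmeas_vlip.
- move=> n t /andP[t0 tS]; rewrite normrM ger0_norm//; apply: ler_pM => //.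
  apply: (le_trans (hKp _ _)); rewrite -mulrA ler_pM2l// -expr2.
  rewrite lerXn2r// ?nnegrE ?addr_ge0//.
  by rewrite (le_trans (ler_normB _ _))// lerD ?DL// hKG// t0.
apply: aeS dGb.2 => t dGt tS; have dw := dGt tS.
have cv : (fun h : R => h^-1 *: (w (h *: 1 + t) - w t)) @ 0^' --> Gb t.
  by have [/cvg_ex[l wl] <-] := dw; rewrite /derive (cvg_lim _ wl).
have Dc : (fun n => D n t) @ \oo --> Gb t.
  apply/cvgrPdist_le => e e0; move/cvgrPdist_le: cv => /(_ e e0)[r /= r0 hr].
  near=> n; have := hr n.+1%:R^-1.
  rewrite /ball_/= sub0r normrN gtr0_norm ?invr_gt0// /D invrK /GRing.scale/= mulr1.
  rewrite [n.+1%:R^-1 + t]addrC; apply; last by rewrite gt_eqF// invr_gt0.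
  by near: n; exact: (near_infty_natSinv_lt (PosNum r0)).
have z : (fun n => t * Q (Gb t - D n t)) @ \oo --> t * Q (Gb t - Gb t).
  by apply: cvgM (cvg_cst _) _; apply: cvg_pform; apply: cvgB (cvg_cst _) Dc.
by move: z; rewrite subrr /pform dot0l mulr0.
Unshelve. all: by end_near. Qed.

(** Weak convergence tested on a Lipschitz field: integrating by parts moves the derivative from
    [W i - w], which is uniformly small, onto [t D]. *)
Lemma cross_term_cvg (D : R -> 'cV[R]_d) e : vlip 0 S D -> 0 < e ->
  \forall i \near F0, `|\int[mu]_(t in `[0, S]) (t * pform P (G i t - Gb t) (D t))| <= e.
Proof.
move=> Dl e0.
have [H dH] := density_exists S0 Dl.
have [KD KD0 hKD] := vbmeas_bound (vbmeas_vlip Dl).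
have [KH KH0 hKH] := vbmeas_bound dH.1.
have [Kp Kp0 hKp] := pform_bound P.
(* [c] bounds the two terms in which the derivative falls on [t] or on [D]; [B] adds the boundary
   term at [S], and 1 for positivity. *)
pose c := Kp * KD + S * (Kp * KH).
have c0 : 0 <= c by rewrite addr_ge0 ?mulr_ge0// ltW.
pose B := c * S + S * (Kp * KD) + 1.
have B0 : 0 < B by rewrite ltr_wpDl// addr_ge0// ?mulr_ge0// ltW.
have eB : 0 < e / B by rewrite divr_gt0.
have wl : vlip 0 S w := nneg_vlip wL S.
near=> i.
have fi : abstract_flow M u0 C (g i) (W i) by near: i.
have di : density S (W i) (G i) by near: i.
have sig : forall s, 0 <= s <= S -> `|W i s - w s| < e / B by near: i; exact: Wunif.
have Wl : vlip 0 S (fun t => W i t - w t) by apply: vlipB => //; exact: flow_vlip fi S.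
pose f t := t * pform P (W i t - w t) (D t).
have fl : lip 0 S f by apply: lipM (lip_id _ _) _; exact: lip_pform.
have bZ : bmeas 0 S (fun t => t * pform P (G i t - Gb t) (D t)).
  by apply: bmeas_tpform (vbmeas_vlip Dl); exact: vbmeasB di.1 dGb.1.
have bc k := bmeas_cst 0 S k.
have der : {ae mu, forall t : R, 0 < t < S -> exists2 dd, is_derive t (1 : R) f dd &
    `|dd - t * pform P (G i t - Gb t) (D t)| <= c * (e / B)}.
  have a1 := aeS2 (fun t h1 h2 => conj h1 h2) dGb.2 dH.2.
  apply: aeS2 di.2 a1 => t dWi [dw dD] tS.
  have d1 := is_deriveB (dWi tS) (dw tS).
  have d2 := is_derive_pform P d1 (dD tS).
  have d3 := is_deriveM (is_derive_id t (1 : R)) d2.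
  eexists; first exact: d3.
  have tS' : 0 <= t <= S by case/andP: tS => h1 h2; rewrite !ltW.
  have sg := ltW (sig t tS').
  rewrite /GRing.scale/= mulr1.
  have -> : t * (pform P (G i t - Gb t) (D t) + pform P (W i t - w t) (H t)) +
      pform P (W i t - w t) (D t) - t * pform P (G i t - Gb t) (D t) =
      pform P (W i t - w t) (D t) + t * pform P (W i t - w t) (H t) by ring.
  rewrite (le_trans (ler_normD _ _))// /c mulrDl lerD//.
    apply: (le_trans (hKp _ _)); rewrite -!mulrA ler_pM2l// [leRHS]mulrC.
    by rewrite ler_pM// hKD.
  rewrite normrM -mulrA ler_pM//.
    by rewrite ger0_norm; case/andP: tS'.
  apply: (le_trans (hKp _ _)); rewrite -!mulrA ler_pM2l// [leRHS]mulrC.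
  by rewrite ler_pM// hKH.
have up := lip_le_Rintegral (ltW S0) fl (bmeasD bZ (bc (c * (e / B)))).
have lo := lip_ge_Rintegral (ltW S0) fl (bmeasD bZ (bc (- (c * (e / B))))).
rewrite (bmeas_RintegralD bZ (bc _)) (Rintegral_itv_cst _ (ltW S0)) in up.
rewrite (bmeas_RintegralD bZ (bc _)) (Rintegral_itv_cst _ (ltW S0)) in lo.
set Z := \int[mu]_(t in `[0, S]) _ in up lo *.
have {}up : f S - f 0 <= Z + c * (e / B) * (S - 0).
  apply: up; apply: aeS der => t Ht /Ht[dd ddd hd]; exists dd => //.
  by move: hd; rewrite ler_norml => /andP[_]; lra.
have {}lo : Z + - (c * (e / B)) * (S - 0) <= f S - f 0.
  apply: lo; apply: aeS der => t Ht /Ht[dd ddd hd]; exists dd => //.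
  by move: hd; rewrite ler_norml => /andP[+ _]; lra.
have f0 : f 0 = 0 by rewrite /f mul0r.
have SS : 0 <= S <= S by rewrite lexx ltW.
have fS : `|f S| <= S * (Kp * KD) * (e / B).
  rewrite /f normrM gtr0_norm// -mulrA ler_pM2l//.
  apply: (le_trans (hKp _ _)); rewrite -!mulrA ler_pM2l// [leRHS]mulrC.
  by rewrite ler_pM// ?hKD// ltW// sig.
have eE : B * (e / B) = e by rewrite mulrC divfK// gt_eqF.
have : (c * S + S * (Kp * KD)) * (e / B) <= e.
  by rewrite -[leRHS]eE ler_pM2r// lerDl.
move: fS up lo; rewrite f0 !subr0 !ler_norml => /andP[f1 f2] up lo h.
by apply/andP; split; lra.
Unshelve. all: by end_near. Qed.

(** Expand [Q(G - Gb)] as [Q(G) - Q(Gb)] minus twice the product of [G - Gb] with [Gb], and split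
    [Gb] into [D n] and a remainder. Young's inequality absorbs half of the left side, and the rest
    is at most [5 e / 16]. *)
Lemma derivative_strong_cvg e : 0 < e ->
  \forall i \near F0, \int[mu]_(t in `[0, S]) (t * Q (G i t - Gb t)) <= e.
Proof.
move=> e0; have [D [Dl Dc]] := difference_quotient_cvg.
have e16 : 0 < e / 16 by rewrite divr_gt0.
have [n nI] : exists n, \int[mu]_(t in `[0, S]) (t * Q (Gb t - D n t)) <= e / 16.
  have [n _ /(_ n (leqnn _)) h] := cvgr_le _ Dc _ e16.
  by exists n.
have A_e := energy_limsup e16; have Z_e := cross_term_cvg (Dl n) e16.
near=> i.
have di : density S (W i) (G i) by near: i.
have h1 : A i <= Ab + e / 16 by near: i.
have h2 : `|\int[mu]_(t in `[0, S]) (t * pform P (G i t - Gb t) (D n t))| <= e / 16.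
  by near: i.
have bD := vbmeas_vlip (Dl n).
have bJ := bmeas_tpform P (vbmeasB di.1 dGb.1) (vbmeasB di.1 dGb.1).
have bA := bmeas_tpform P di.1 di.1.
have bAb := bmeas_tpform P dGb.1 dGb.1.
have bI := bmeas_tpform P (vbmeasB dGb.1 bD) (vbmeasB dGb.1 bD).
have bZ := bmeas_tpform P (vbmeasB di.1 dGb.1) bD.
have bc k := bmeas_cst 0 S k.
set J := \int[mu]_(t in `[0, S]) _.
have : J <= A i - Ab + 2^-1 * J + 2 * (e / 16) + 2 * (e / 16).
  have b1 := bmeasD bA (bmeasN bAb).
  have b2 := bmeasD b1 (bmeasM (bc 2^-1) bJ).
  have b3 := bmeasD b2 (bmeasM (bc 2) bI).
  have b4 := bmeasD b3 (bmeasM (bc (- 2)) bZ).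
  apply: (@le_trans _ _ (\int[mu]_(t in `[0, S]) (t * Q (G i t) + - (t * Q (Gb t)) +
      2^-1 * (t * Q (G i t - Gb t)) + 2 * (t * Q (Gb t - D n t)) +
      - 2 * (t * pform P (G i t - Gb t) (D n t))))).
    apply: bmeas_le_Rintegral => //; apply: aeW => t /andP[t0 _].
    have half0 : 0 < 2^-1 :> R by rewrite invr_gt0.
    have y := pform_young (G i t - Gb t) (Gb t - D n t) hP half0.
    rewrite invrK in y.
    have E1 : pform P (G i t - Gb t) (Gb t) =
        pform P (G i t - Gb t) (Gb t - D n t) + pform P (G i t - Gb t) (D n t).
      by rewrite -pformDr subrK.
    have E2 : Q (G i t) = Q (G i t - Gb t) + 2 * pform P (G i t - Gb t) (Gb t) + Q (Gb t).
      by rewrite -pform_sqrD// subrK.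
    have := ler_norm (- pform P (G i t - Gb t) (Gb t - D n t)); rewrite normrN => y2.
    have -> : t * Q (G i t) + - (t * Q (Gb t)) + 2^-1 * (t * Q (G i t - Gb t)) +
        2 * (t * Q (Gb t - D n t)) + - 2 * (t * pform P (G i t - Gb t) (D n t)) =
        t * (Q (G i t) - Q (Gb t) + 2^-1 * Q (G i t - Gb t) +
          2 * Q (Gb t - D n t) - 2 * pform P (G i t - Gb t) (D n t)) by ring.
    by rewrite ler_pM2l// E2 E1; lra.
  rewrite (bmeas_RintegralD b3 (bmeasM (bc (- 2)) bZ)).
  rewrite (bmeas_RintegralD b2 (bmeasM (bc 2) bI)).
  rewrite (bmeas_RintegralD b1 (bmeasM (bc 2^-1) bJ)).
  rewrite (bmeas_RintegralD bA (bmeasN bAb)) bmeas_RintegralN//.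
  rewrite !bmeas_RintegralZ// -/(A i) -/Ab -/J.
  by move: h2; rewrite ler_norml => /andP[h2 _]; lra.
lra.
Unshelve. all: by end_near. Qed.

End StrongConvergence.

(** * Mirror flows *)

Section QuadraticLoss.
Context {R : realType} {d : nat}.
Variables (M P : 'M[R]_d) (u0 : 'cV[R]_d) (c : R).
Hypotheses (hM : psd_mx M) (hP : psd_mx P) (MPM : M *m P *m M = M).
Notation l := (quad M (M *m u0) c).

Lemma quad_shift x v (k : R) : l (k *: v + x) - l x =
  k * dot (M *m (x - u0)) v + k ^+ 2 * (2^-1 * dot v (M *m v)).
Proof.
have [MT _] := hM; have MS y z : dot y (M *m z) = dot z (M *m y).
  by rewrite dotC dot_mulmxl MT.
rewrite /quad mulmxDr -scalemxAr mulmxBr dotBl !dotDl !dotDr !dotZl !dotZr.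
by rewrite (MS v x) (dotC (M *m x)) (MS x v); lra.
Qed.

Lemma grad_quad x : grad l x = M *m (x - u0).
Proof.
apply/colP => i; rewrite mxE; apply: cvg_lim => //.
pose v : 'cV[R]_d := delta_mx i 0; pose k := 2^-1 * dot v (M *m v).
have -> : (M *m (x - u0)) i 0 = dot (M *m (x - u0)) v + 0 * k.
  rewrite mul0r addr0 /dot (bigD1 i)//= big1 ?addr0 => [|j ji].
    by rewrite [v i 0]mxE !eqxx mulr1.
  by rewrite [v j 0]mxE (negbTE ji) mulr0.
apply: (@cvg_trans _ ((fun r : R => dot (M *m (x - u0)) v + r * k) @ 0^')).
  apply: near_eq_cvg; near=> r.
  have r0 : r != 0 by near: r; exact: nbhs_dnbhs_neq.
  by rewrite /= quad_shift -/v -/k /GRing.scale/=; field.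
by apply: cvgD; [exact: cvg_cst|apply: cvgM; [exact: nbhs_dnbhs|exact: cvg_cst]].
Unshelve. all: by end_near. Qed.

Lemma quad_grad x : l x = 2^-1 * pform P (grad l x) (grad l x) + l u0.
Proof.
have := quad_shift u0 (x - u0) 1.
rewrite scale1r subrK subrr mulmx0 dot0l mulr0 add0r expr1n mul1r => /eqP.
by rewrite subr_eq grad_quad (pform_mulmx hM hP MPM) => /eqP.
Qed.

End QuadraticLoss.

Section RealValuedForms.
Context {R : realType} {d : nat}.
Variable u0 : 'cV[R]_d.
Implicit Types (h : 'cV[R]_d -> \bar R) (C : set 'cV[R]_d) (v w x y : 'cV[R]_d).

Lemma dom_fineE h x : proper_efun h -> dom h x -> h x = (fine (h x))%:E.
Proof. by move=> [hN _] hx; rewrite fineK// fin_numE gt_eqF//= lt_eqF. Qed.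

Lemma segment_closed_dom h : proper_efun h -> convex_efun h -> segment_closed (dom h).
Proof.
move=> hp hc x y t t01 hx hy; rewrite /dom/=; apply: (le_lt_trans (hc x y t t01)).
by rewrite (dom_fineE hp hx) (dom_fineE hp hy) -!EFinM -EFinD ltry.
Qed.

(** The infimum of [h] is [- h^*(0)]. *)
Lemma conjugate_lower_bound h : proper_efun h -> dom (conjugate h) 0 ->
  exists2 m, 0 <= m & forall x, dom h x -> - m <= fine (h x).
Proof.
move=> hp; rewrite /dom/= => h0.
have ub x : dom h x -> ((- fine (h x))%:E <= conjugate h 0)%E.
  move=> hx; apply: ereal_sup_ubound; exists x => //.
  by rewrite dot0l sub0e {1}(dom_fineE hp hx) EFinN.
have [N [x0 hx0]] := hp; have E : conjugate h 0 = (fine (conjugate h 0))%:E.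
  rewrite fineK// fin_numE (lt_eqF h0) andbT gt_eqF//.
  by apply: lt_le_trans (ub _ hx0); rewrite ltNyr.
exists `|fine (conjugate h 0)| => // x hx; have := ub x hx.
rewrite E lee_fin => /le_trans/(_ (ler_norm _)); lra.
Qed.

Lemma subdiff_fine h x w : proper_efun h -> subdiff h x w ->
  dom h x /\ forall y, dom h y -> dot w (y - x) <= fine (h y) - fine (h x).
Proof.
move=> hp hw; have [hN [x0 hx0]] := hp.
have hx : dom h x.
  have := hw x0; rewrite (dom_fineE hp hx0) /dom/=.
  by case: (h x) => [r| |]//=; rewrite ltry.
split=> // y hy; have := hw y.
by rewrite (dom_fineE hp hx) (dom_fineE hp hy) -EFinD lee_fin -lerBrDl.
Qed.

Lemma dom_indicator C : dom (indicator_fun C) = C.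
Proof.
apply/seteqP; split=> x; rewrite /dom/= /indicator_fun; first by case: asboolP.
by move=> Cx; rewrite asboolT ?ltry.
Qed.

Lemma proper_indicator C : C !=set0 -> proper_efun (indicator_fun C).
Proof.
move=> C0; split; last by rewrite dom_indicator.
by move=> x; rewrite /indicator_fun; case: asboolP; rewrite ?ltNyr.
Qed.

Lemma fine_indicator C x : fine (indicator_fun C x) = 0.
Proof. by rewrite /indicator_fun; case: asboolP. Qed.

Lemma subdiff_indicator C x w : C !=set0 ->
  subdiff (indicator_fun C) x w <-> C x /\ forall y, C y -> dot w (y - x) <= 0.
Proof.
move=> C0; split=> [/(subdiff_fine (proper_indicator C0))|[Cx wx] y].
  rewrite dom_indicator => -[Cx H]; split=> // y /H.
  by rewrite !fine_indicator subrr.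
rewrite {1}/indicator_fun asboolT// add0e /indicator_fun.
by case: asboolP => [Cy|_]; [rewrite lee_fin wx|rewrite leey].
Qed.

Lemma subdiff_support C w x : C !=set0 -> subdiff (support_fun C) w x ->
  (exists al, conj_le u0 C (fun=> 0) w al) /\
  forall v be, conj_le u0 C (fun=> 0) v be ->
    conj_le u0 C (fun=> 0) w (be - dot (x - u0) (v - w)).
Proof.
move=> [y0 Cy0] wx.
have le v be : conj_le u0 C (fun=> 0) v be -> (support_fun C v <= (be + dot v u0)%:E)%E.
  move=> vb; apply: ge_ereal_sup => _ [y Cy <-]; rewrite lee_fin.
  by have := vb y Cy; rewrite dotBr subr0; lra.
have ge v y : C y -> ((dot v y)%:E <= support_fun C v)%E.
  by move=> Cy; apply: ereal_sup_ubound; exists y.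
have wfin v be : conj_le u0 C (fun=> 0) v be ->
    conj_le u0 C (fun=> 0) w (be - dot (x - u0) (v - w)).
  move=> vb y Cy; have := le_trans (leeD2r _ (ge w y Cy)) (le_trans (wx v) (le _ _ vb)).
  by rewrite -EFinD lee_fin dotBl !dotBr (dotC u0 v) (dotC u0 w); lra.
(* Finiteness at [w] comes from the competitor 0, whose support value is 0. *)
split=> //; exists (0 - dot (x - u0) (0 - w)); apply: wfin => y Cy.
by rewrite dot0l subr0.
Qed.

Lemma normal_subdiff_support C w x : C x -> (forall y, C y -> dot w (y - x) <= 0) ->
  subdiff (support_fun C) w x.
Proof.
move=> Cx wx v.
have -> : support_fun C w = (dot w x)%:E.
  apply/le_anti/andP; split.
    apply: ge_ereal_sup => _ [y Cy <-]; rewrite lee_fin.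
    by have := wx y Cy; rewrite dotBr subr_le0.
  by apply: ereal_sup_ubound; exists x.
rewrite -EFinD dotBr (dotC w) addrC subrK dotC.
by apply: ereal_sup_ubound; exists x.
Qed.

Lemma conj_le_subgradient C (g : 'cV[R]_d -> R) w x : C x ->
  (forall y, C y -> dot w (y - x) <= g y - g x) ->
  (exists al, conj_le u0 C g w al) /\
  forall v be, conj_le u0 C g v be -> conj_le u0 C g w (be - dot (x - u0) (v - w)).
Proof.
move=> Cx wx; split=> [|v be vb y Cy].
  by exists (dot w (x - u0) - g x) => y Cy; have := wx y Cy; rewrite !dotBr; lra.
have := wx y Cy; have := vb x Cx.
by rewrite !dotBl !dotBr (dotC x v) (dotC x w) (dotC u0 v) (dotC u0 w); lra.
Qed.

End RealValuedForms.

Section MirrorFlowAsAbstractFlow.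
Context {R : realType} {d : nat}.
Notation mu := (@lebesgue_measure R).
Variables (M : 'M[R]_d) (u0 : 'cV[R]_d) (c : R).
Hypothesis hM : psd_mx M.
Notation l := (quad M (M *m u0) c).
Implicit Types (w x : R -> 'cV[R]_d) (h : 'cV[R]_d -> \bar R).

Lemma is_derive_rescale w (r t : R) v : 0 < r -> is_derive (r * t) (1 : R) w v ->
  is_derive t (1 : R) (fun s => r^-1 *: w (r * s)) v.
Proof.
move=> r0 dw; apply: is_derive_col => i; under eq_fun do rewrite mxE.
have di := is_derive_coord i dw.
have dr : is_derive t (1 : R) (fun s : R => r * s) r.
  by apply: is_derive_eq (is_deriveZ r (is_derive_id t (1 : R))) _; exact: mulr1.
have := is_derive1_comp (f := fun s : R => w s i 0) (g := fun s : R => r * s) di dr.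
move/(is_deriveZ r^-1) => H; apply: is_derive_eq H _.
by rewrite /GRing.scale/= [v i 0 * r]mulrC mulKf// gt_eqF.
Qed.

Lemma lipschitz_nneg w : [lipschitz w t | t in `[0, +oo[%classic] ->
  exists L, forall s t, 0 <= s -> 0 <= t -> `|w s - w t| <= L * `|s - t|.
Proof.
move=> [L [_ /(_ (L + 1))]]; rewrite ltrDl ltr01 => /(_ isT) H.
exists (L + 1) => s t s0 t0; apply: (H (s, t)).
by split; rewrite /= in_itv/= andbT.
Qed.

Lemma nneg_lipschitz w (L : R) :
  (forall s t, 0 <= s -> 0 <= t -> `|w s - w t| <= L * `|s - t|) ->
  [lipschitz w t | t in `[0, +oo[%classic].
Proof.
move=> wL; exists L; split; first exact: num_real.
move=> K LK [s t] [/=]; rewrite !in_itv/= !andbT => s0 t0.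
by apply: (le_trans (wL s t s0 t0)); rewrite ler_wpM2r// ltW.
Qed.

(** Dividing the values by [r] and accelerating time by [r] cancel in the velocity, while the
    potential is divided by [r]; it therefore fades into the indicator of its domain. *)
Lemma primal_variable_rescale h w x (r : R) : proper_efun h -> 0 < r ->
  primal_variable h l w x ->
  {ae mu, forall t : R, 0 < t ->
    [/\ is_derive t (1 : R) (fun s => r^-1 *: w (r * s)) (- (M *m (x (r * t) - u0))),
        dom h (x (r * t)) &
        forall y, dom h y -> dot (r^-1 *: w (r * t)) (y - x (r * t)) <=
          fine (h y) / r - fine (h (x (r * t))) / r]}.
Proof.
move=> hp r0 wx; apply: aeS (ae_scale r0 wx) => t Ht t0.
have [|dw /(subdiff_fine hp)[hx wh]] := Ht; first by rewrite mulr_ge0// ltW.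
split=> // [|y hy]; first by rewrite -(grad_quad u0 c hM); exact: is_derive_rescale.
by rewrite dotZl -mulrBl mulrC ler_pM2r ?invr_gt0// wh.
Qed.

Lemma mirror_abstract_flow h w (r : R) : proper_efun h -> 0 < r ->
  lipschitz_mirror_flow h l w ->
  abstract_flow M u0 (dom h) (fun y => fine (h y) / r) (fun s => r^-1 *: w (r * s)).
Proof.
move=> hp r0 [/lipschitz_nneg[L wL] [x wx]]; split.
  exists L => s t s0 t0; rewrite -scalerBr normrZ gtr0_norm ?invr_gt0//.
  rewrite ler_pdivrMl//; apply: (le_trans (wL _ _ _ _)).
  - by rewrite mulr_ge0// ltW.
  - by rewrite mulr_ge0// ltW.
  - by rewrite -mulrBr normrM gtr0_norm// mulrCA.
apply: aeS (primal_variable_rescale hp r0 wx) => t Ht t0.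
have [dw hx wy] := Ht t0; exists (x (r * t) - u0).
have [fin sub] := conj_le_subgradient u0 hx wy.
by split=> // v al _; exact: sub.
Qed.

Lemma indicator_abstract_flow (C : set 'cV[R]_d) w : C !=set0 ->
  lipschitz_mirror_flow (indicator_fun C) l w -> abstract_flow M u0 C (fun=> 0) w.
Proof.
move=> C0 /(mirror_abstract_flow (proper_indicator C0) ltr01).
rewrite dom_indicator; congr (abstract_flow _ _ _ _ _).
  by apply/funext => y; rewrite fine_indicator mul0r.
by apply/funext => s; rewrite invr1 scale1r mul1r.
Qed.

End MirrorFlowAsAbstractFlow.

(** * Convergence in weighted L^p *)

Section WeightedLpConvergence.
Context {R : realType}.
Notation mu := (@lebesgue_measure R).
Import HBNNSimple.

(* The library's ae_ge0_le_integral asks f to be Borel, which the functions of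
   weighted L^p spaces are only up to a negligible set. *)
Lemma ae_le_integral (D : set (measurableTypeR R)) (f g : R -> \bar R) :
  measurable D -> (forall t, D t -> (0 <= f t)%E) -> (forall t, D t -> (0 <= g t)%E) ->
  measurable_fun D g -> {ae mu, forall t, D t -> (f t <= g t)%E} ->
  (\int[mu]_(t in D) f t <= \int[mu]_(t in D) g t)%E.
Proof.
move=> mD f0 g0 mg fg; rewrite !(integral_mkcond D).
rewrite [leLHS]ge0_integralTE; last by move=> t; exact: erestrict_ge0.
apply: ge_ereal_sup => _ [k /= kf <-]; rewrite -integralT_nnsfun.
apply: ae_ge0_le_integral => //.
- by move=> t _; rewrite lee_fin.
- exact/measurable_EFinP.
- by move=> t _; exact: erestrict_ge0.
- exact/(measurable_restrictT _ _).1.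
apply: aeS fg => t fgt _; apply: (le_trans (kf t)).
by rewrite !patchE; case: ifPn => // /set_mem; exact: fgt.
Qed.

Context {m : nat}.
Implicit Types (f g : R -> 'cV[R]_m) (p S : R).

(** The majorant [k] carries all the measurability, so [f] may be arbitrary on a null set. *)
Lemma wLnorm_le p S f (k : R -> R) (e : R) : 0 < p -> 0 <= e -> bmeas 0 S k ->
  (forall t, 0 <= t <= S -> 0 <= k t) ->
  {ae mu, forall t, 0 < t < S -> enorm (f t) `^ p * t <= k t} ->
  \int[mu]_(t in `[0, S]) k t <= e `^ p -> (wLnorm p S f <= e%:E)%E.
Proof.
move=> p0 e0 bk k0 fk Ik.
have -> : e%:E = ((e `^ p)%:E `^ p^-1)%E.
  by rewrite poweR_EFin -powRrM mulfV ?gt_eqF// powRr1.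
apply: gt0_ler_poweR.
- by rewrite invr_ge0 ltW.
- rewrite in_itv/= leey andbT; apply: integral_ge0 => t.
  by rewrite /= in_itv/= => /andP[t0 _]; rewrite lee_fin mulr_ge0// powR_ge0.
- by rewrite in_itv/= leey andbT lee_fin powR_ge0.
apply: (@le_trans _ _ (\int[mu]_(t in `[0%R, S]%classic) (k t)%:E)%E).
  apply: ae_le_integral => //.
  - by move=> t; rewrite /= in_itv/= => /andP[t0 _]; rewrite lee_fin mulr_ge0// powR_ge0.
  - by apply/measurable_EFinP; case: bk.
  apply: aeS (ae_itv_closed fk) => t ft; rewrite /= in_itv/= => /ft.
  by rewrite lee_fin.
rewrite -[leLHS]fineK ?lee_fin//.
exact/integrable_fin_num/bmeas_integrable.
Qed.

Lemma enorm_bound (v : 'cV[R]_m) (K : R) : `|v| <= K -> enorm v <= Num.sqrt (m%:R * K * K).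
Proof.
move=> vK; rewrite ler_wsqrtr// (le_trans (ler_norm _))//.
apply: (le_trans (dot_norm_le _ _)); apply: ler_pM => //.
by rewrite ler_wpM2l.
Qed.

Lemma in_wLpI p S f g : 0 < p -> 0 < S -> vbmeas 0 S g ->
  {ae mu, forall t, 0 < t < S -> f t = g t} -> in_wLp p S f.
Proof.
move=> p0 S0 bg fg; split.
  exists g; split; first by move=> i; case: (bg i).
  apply: aeS (ae_itv_closed fg) => t ft; rewrite /= in_itv/=; exact: ft.
have [K K0 gK] := vbmeas_bound bg.
pose B := Num.sqrt (m%:R * K * K) `^ p * S.
have B0 : 0 <= B by rewrite mulr_ge0 ?powR_ge0// ltW.
have bB := bmeas_cst 0 S B.
pose e := (`|\int[mu]_(t in `[0, S]) B|) `^ p^-1.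
apply: (@le_lt_trans _ _ e%:E); last by rewrite ltry.
apply: (wLnorm_le p0 (powR_ge0 _ _) bB) => //.
  apply: aeS fg => t ft tS; rewrite ft//; case/andP: tS => t0 tS.
  apply: ler_pM; rewrite ?powR_ge0 ?(ltW t0) ?(ltW tS)//.
  apply: ge0_ler_powR; rewrite ?nnegrE ?sqrtr_ge0 ?(ltW p0)//.
  by apply: enorm_bound; apply: gK; rewrite !ltW.
by rewrite /e -powRrM mulVf ?gt_eqF// powRr1// ler_norm.
Qed.

Lemma cvg_wLpI p S (F : set_system R) {FF : Filter F} (f_ : R -> R -> 'cV[R]_m) f :
  0 < p -> (\forall e \near F, in_wLp p S (f_ e)) -> in_wLp p S f ->
  (forall eta, 0 < eta -> \forall e \near F, exists k,
     [/\ bmeas 0 S k, forall t, 0 <= t <= S -> 0 <= k t,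
         {ae mu, forall t, 0 < t < S -> enorm (f_ e t - f t) `^ p * t <= k t} &
         \int[mu]_(t in `[0, S]) k t <= eta]) ->
  cvg_wLp p S F f_ f.
Proof.
move=> p0 in_ in_f H; split=> //.
have N0 e : (0 <= wLnorm p S (fun s => (f_ e s - f s)%R))%E by exact: poweR_ge0.
have fin eta : 0 < eta ->
    \forall e \near F, (wLnorm p S (fun s => (f_ e s - f s)%R) <= eta%:E)%E.
  move=> eta0; have := H _ (powR_gt0 p eta0); apply: filterS => e [k [bk k0 fk Ik]].
  exact: wLnorm_le (ltW eta0) bk k0 fk Ik.
apply/fine_cvgP; split.
  have := fin 1 ltr01; apply: filterS => e he; rewrite ge0_fin_numE//.
  by rewrite (le_lt_trans he)// ltry.
apply/cvgrPdist_le => eta eta0; have := fin _ eta0; apply: filterS => e he.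
have fe : wLnorm p S (fun s => f_ e s - f s) \is a fin_num.
  by rewrite ge0_fin_numE// (le_lt_trans he)// ltry.
by rewrite sub0r normrN ger0_norm ?fine_ge0// -lee_fin fineK.
Qed.

End WeightedLpConvergence.

Section FieldsWithQuadraticEnergy.
Context {R : realType} {d : nat}.
Notation mu := (@lebesgue_measure R).
Variables (M P : 'M[R]_d) (S : R) (F : set_system R).
Context {FF : Filter F}.
Hypotheses (hM : psd_mx M) (hP : psd_mx P) (MPM : M *m P *m M = M) (S0 : 0 < S).
Notation Q v := (pform P v v).
Variables (f_ G : R -> R -> 'cV[R]_d) (f Gb : R -> 'cV[R]_d).
Hypotheses (bG : \forall e \near F, vbmeas 0 S (G e)) (bGb : vbmeas 0 S Gb)
  (fG : \forall e \near F, {ae mu, forall t, 0 < t < S ->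
     f_ e t = - G e t /\ colspan M (f_ e t)})
  (fGb : {ae mu, forall t, 0 < t < S -> f t = - Gb t /\ colspan M (f t)})
  (energy_cvg : forall eta, 0 < eta -> \forall e \near F,
     \int[mu]_(t in `[0, S]) (t * Q (G e t - Gb t)) <= eta).

Let vbmeasN (g : R -> 'cV[R]_d) : vbmeas 0 S g -> vbmeas 0 S (fun t => - g t).
Proof. by move=> bg i; under eq_fun do rewrite mxE; exact: bmeasN. Qed.

Lemma cvg_wLp_field : cvg_wLp 2 S F f_ f.
Proof.
have [K K0 hK] := norm_le_pform hM hP MPM.
apply: cvg_wLpI => //.
- near=> e; have be : vbmeas 0 S (G e) by near: e.
  have fe : {ae mu, forall t, 0 < t < S -> f_ e t = - G e t /\ colspan M (f_ e t)}.
    by near: e.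
  apply: (in_wLpI _ S0 (vbmeasN be)) => //; apply: aeS fe => t H /H[].
  by [].
- apply: (in_wLpI _ S0 (vbmeasN bGb)) => //; apply: aeS fGb => t H /H[].
  by [].
(* The squared Euclidean norm is at most [d] times the squared sup norm, which [K] compares with the
   form; 1 is added for positivity. *)
move=> eta eta0; pose c := d%:R * K + 1.
have c0 : 0 < c by rewrite ltr_wpDl// mulr_ge0// ltW.
have ec : 0 < eta / c by rewrite divr_gt0.
have E := energy_cvg ec; near=> e.
have be : vbmeas 0 S (G e) by near: e.
have fe : {ae mu, forall t, 0 < t < S -> f_ e t = - G e t /\ colspan M (f_ e t)}.
  by near: e.
have bQ := bmeas_tpform P (vbmeasB be bGb) (vbmeasB be bGb).
exists (fun t => c * (t * Q (G e t - Gb t))); split.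
- exact: bmeasM (bmeas_cst _ _ _) bQ.
- by move=> t /andP[t0 _]; rewrite !mulr_ge0 ?pform_ge0// ltW.
- apply: aeS2 fe fGb => t He Hf tS; have [Ee Me] := He tS; have [Ef Mf] := Hf tS.
  have t0 : 0 <= t by case/andP: tS => /ltW.
  rewrite powR_mulrn ?sqrtr_ge0// sqr_sqrtr ?dot_ge0// mulrCA [leLHS]mulrC ler_wpM2l//.
  have -> : Q (G e t - Gb t) = Q (f_ e t - f t).
    by rewrite Ee Ef opprK -opprB pformNl pformNr opprK addrC.
  have := hK _ (colspanB Me Mf); have := dot_norm_le (f_ e t - f t) (f_ e t - f t).
  have := pform_ge0 (f_ e t - f t) hP.
  set v := _ - _; rewrite /c => Q0 h1 h2; apply: (le_trans (ler_norm _)).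
  apply: (le_trans h1); rewrite -mulrA -expr2.
  apply: (@le_trans _ _ (d%:R * (K * Q v))); first by rewrite ler_wpM2l.
  by rewrite mulrA ler_wpM2r// lerDl.
- rewrite bmeas_RintegralZ// mulrC -ler_pdivlMr//.
  by near: e.
Unshelve. all: by end_near. Qed.

Lemma cvg_wLp_energy (k : R) : cvg_wLp 1 S F
  (fun e t => const_mx (2^-1 * Q (f_ e t) + k) : 'cV[R]_1)
  (fun t => const_mx (2^-1 * Q (f t) + k)).
Proof.
have Qm (g : R -> 'cV[R]_d) : vbmeas 0 S g ->
      vbmeas 0 S (fun t => const_mx (2^-1 * Q (g t) + k) : 'cV[R]_1).
  move=> bg i; under eq_fun do rewrite mxE.
  apply: bmeasD (bmeas_cst _ _ _); apply: bmeasM (bmeas_cst _ _ _) _.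
  exact: bmeas_pform.
have QN (v : 'cV[R]_d) : Q (- v) = Q v by rewrite pformNl pformNr opprK.
apply: cvg_wLpI => //.
- near=> e; have be : vbmeas 0 S (G e) by near: e.
  have fe : {ae mu, forall t, 0 < t < S -> f_ e t = - G e t /\ colspan M (f_ e t)}.
    by near: e.
  apply: (in_wLpI _ S0 (Qm _ be)) => //; apply: aeS fe => t H /H[-> _].
  by rewrite QN.
- apply: (in_wLpI _ S0 (Qm _ bGb)) => //; apply: aeS fGb => t H /H[-> _].
  by rewrite QN.
move=> eta eta0.
have bb := bmeas_tpform P bGb bGb.
pose Ab := \int[mu]_(t in `[0, S]) (t * Q (Gb t)).
(* Young's inequality with parameter [th] bounds the difference of energies by
   [c Q(G - Gb) + th Q(Gb) / 2]. The second term integrates to at most [eta / 2] by this choice;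
   strong convergence takes care of the first. *)
pose th := eta / (`|Ab| + 1).
have A1 : 0 < `|Ab| + 1 by rewrite ltr_wpDl.
have th0 : 0 < th by rewrite divr_gt0.
pose c := 2^-1 * (1 + th^-1).
have c0 : 0 < c by rewrite mulr_gt0 ?invr_gt0// addr_gt0 ?invr_gt0.
have ec : 0 < eta / 2 / c by rewrite !divr_gt0.
have E := energy_cvg ec; near=> e.
have be : vbmeas 0 S (G e) by near: e.
have fe : {ae mu, forall t, 0 < t < S -> f_ e t = - G e t /\ colspan M (f_ e t)}.
  by near: e.
have bQ := bmeas_tpform P (vbmeasB be bGb) (vbmeasB be bGb).
have b1 := bmeasM (bmeas_cst 0 S c) bQ.
have b2 := bmeasM (bmeas_cst 0 S (2^-1 * th)) bb.
exists (fun t => c * (t * Q (G e t - Gb t)) + 2^-1 * th * (t * Q (Gb t))); split.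
- exact: bmeasD.
- move=> t /andP[t0 _].
  have := pform_ge0 (G e t - Gb t) hP; have := pform_ge0 (Gb t) hP => h1 h2.
  have c0' := ltW c0; have th0' : 0 <= 2^-1 * th by rewrite pmulr_rge0 ?invr_gt0// ltW.
  by apply: addr_ge0; apply: mulr_ge0 => //; apply: mulr_ge0.
- apply: aeS2 fe fGb => t He Hf tS; have [Ee _] := He tS; have [Ef _] := Hf tS.
  have t0 : 0 <= t by case/andP: tS => /ltW.
  rewrite powRr1 ?sqrtr_ge0//.
  have -> : enorm (const_mx (2^-1 * Q (f_ e t) + k) - const_mx (2^-1 * Q (f t) + k) :
      'cV[R]_1) = `|2^-1 * Q (G e t) - 2^-1 * Q (Gb t)|.
    rewrite /enorm /dot big_ord_recl big_ord0 addr0 !mxE -expr2 sqrtr_sqr Ee Ef !QN.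
    by congr `|_|; ring.
  have E2 : Q (G e t) = Q (G e t - Gb t) + 2 * pform P (G e t - Gb t) (Gb t) + Q (Gb t).
    by rewrite -pform_sqrD// subrK.
  have th1 : 0 < th^-1 by rewrite invr_gt0.
  have y := pform_young (G e t - Gb t) (Gb t) hP th1.
  rewrite invrK in y.
  have -> : c * (t * Q (G e t - Gb t)) + 2^-1 * th * (t * Q (Gb t)) =
    2^-1 * (Q (G e t - Gb t) + (th^-1 * Q (G e t - Gb t) + th * Q (Gb t))) * t.
    by rewrite /c; ring.
  rewrite ler_wpM2r// E2 -mulrBr normrM gtr0_norm ?invr_gt0// ler_pM2l ?invr_gt0//.
  rewrite addrK; apply: (le_trans (ler_normD _ _)).
  by rewrite ger0_norm ?pform_ge0// lerD2l normrM ger0_norm.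
- rewrite bmeas_RintegralD// !bmeas_RintegralZ// -/Ab.
have h1 : c * \int[mu]_(t in `[0, S]) (t * Q (G e t - Gb t)) <= eta / 2.
  by rewrite mulrC -ler_pdivlMr//; near: e.
have h2 : th * Ab <= eta.
  rewrite /th mulrAC ler_pdivrMr// ler_pM2l//.
  by apply: (le_trans (ler_norm _)); rewrite lerDl.
lra.
Unshelve. all: by end_near. Qed.

End FieldsWithQuadraticEnergy.

(** * The limit flow *)

Section LimitFlow.
Context {R : realType} {d : nat}.
Notation mu := (@lebesgue_measure R).
Variables (M P : 'M[R]_d) (u0 : 'cV[R]_d) (c : R).
Hypotheses (hM : psd_mx M) (hP : psd_mx P) (MPM : M *m P *m M = M).
Notation l := (quad M (M *m u0) c).
Variable C : set 'cV[R]_d.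
Hypotheses (C0 : C !=set0) (cC : closed C) (vC : segment_closed C).
Notation conj_le0 := (conj_le u0 C (fun=> 0)).
Implicit Types (w : R -> 'cV[R]_d) (x y : 'cV[R]_d).

Lemma abstract_flow_unique w w' : abstract_flow M u0 C (fun=> 0) w ->
  abstract_flow M u0 C (fun=> 0) w' -> w 0 = w' 0 ->
  forall s, 0 <= s -> w s = w' s.
Proof.
move=> fw fw' ww' s s0.
have wal := flow_conj_val hM hP MPM C0 fw (lexx 0).
have evi (v : R -> 'cV[R]_d) : abstract_flow M u0 C (fun=> 0) v -> v 0 = w 0 ->
    evi_curve M P u0 C (fun=> 0) (w 0) v.
  move=> fv v0; split=> [t t0|r t z be x r0 rt zM zbe Cx].
    by rewrite -v0; apply: (flow_colspan MPM fv).
  by apply: (flow_evi hM hP MPM C0 fv r0 rt _ zbe Cx); rewrite v0.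
have wal' : conj_le0 (w' 0) (conj_val u0 C (fun=> 0) (w 0)) by rewrite -ww'.
have := evi_contraction hP C0 (evi w fw erefl) (evi w' fw' (esym ww')) wal wal' s0.
rewrite /= ww' subrr {2}/pform dot0l => /(pform_colspan_eq0 hM hP MPM) H.
apply/eqP; rewrite -subr_eq0; apply/eqP; apply: H.
apply: (colspan_sub (v0 := w 0)); first by apply: (flow_colspan MPM fw).
by rewrite ww'; apply: (flow_colspan MPM fw').
Qed.

Lemma abstract_flow_primal w a : abstract_flow M u0 C (fun=> 0) w ->
  ri (dom (support_fun C)) a -> colspan M (a - w 0) ->
  lipschitz_mirror_flow (indicator_fun C) l w.
Proof.
move=> fw ria aM; have [[L wL] good] := fw; split; first exact: nneg_lipschitz wL.
have H : {ae mu, forall t : R, exists x, 0 <= t ->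
    is_derive t (1 : R) w (- grad l x) /\ subdiff (indicator_fun C) x (w t)}.
  apply: aeS2 (ae_neq 0) good => t t_neq0 Ht.
  have [t0|t0] := leP 0 t; last by exists 0.
  have [|u [dw [al wal] sub]] := Ht; first by rewrite lt_neqAle eq_sym t_neq0.
  have waM := colspan_sub (flow_colspan MPM fw (lexx 0) t0) aM.
  have [x [Cx Mx nx]] := subgradient_lift C0 cC vC hM hP MPM ria waM wal sub.
  exists x => _; split; first by rewrite grad_quad// Mx.
  exact/subdiff_indicator.
(* A primal point is chosen separately at each time; the default 0 is taken only where no admissible
   point exists. *)
pose ok (t : R) x := 0 <= t ->
  is_derive t (1 : R) w (- grad l x) /\ subdiff (indicator_fun C) x (w t).
exists (fun t => xget 0 [set x | ok t x]).
by apply: aeS H => t [x okx]; exact: (@xgetPex _ 0 [set x | ok t x] (ex_intro _ x okx)).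
Qed.

(* Along the flow the value E of the support function satisfies
   E' = <y - u0, w'> for every subgradient y of the support function: the
   difference of the two sides is the derivative of a function minimal at t. *)
Lemma flow_subdiff_min w : abstract_flow M u0 C (fun=> 0) w ->
  {ae mu, forall t : R, 0 < t -> forall x y,
     is_derive t (1 : R) w (- (M *m (x - u0))) -> subdiff (support_fun C) (w t) y ->
     l x <= l y}.
Proof.
move=> fw; apply: aeS (flow_ae hM hP MPM C0 fw) => t Ht t0 x y dx yw.
have [u [du dE _]] := Ht t0; have [_ sub] := subdiff_support u0 C0 yw.
have Mu : M *m u = M *m (x - u0).
  by apply: oppr_inj; have [_ <-] := du; have [_ <-] := dx.
pose phi (r : R) := conj_val u0 C (fun=> 0) (w r) - dot (y - u0) (w r).
have dphi : is_derive t (1 : R) phi (- dot u (M *m u) + dot (y - u0) (M *m u)).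
  have := is_deriveB dE (is_derive_dot (is_derive_cst (y - u0) t (1 : R)) du).
  by rewrite dot0l add0r dotNr opprK.
have phit r : 0 < r -> phi t <= phi r.
  move=> r0; have := sub _ _ (flow_conj_val hM hP MPM C0 fw (ltW r0)).
  by move/(conj_val_le C0); rewrite /phi dotBr; lra.
have E : dot (y - u0) (M *m u) = dot u (M *m u).
  have h1 : 0 <= - dot u (M *m u) + dot (y - u0) (M *m u).
    rewrite -oppr_le0; apply: (is_derive_le_right (is_deriveN dphi) ltr01) => r /andP[tr _].
    by rewrite mul0r /= opprK addrC subr_le0 phit// (lt_trans t0).
  have h2 : - dot u (M *m u) + dot (y - u0) (M *m u) <= 0.
    apply: (is_derive_le_left dphi t0) => r /andP[tr _].
    by rewrite mul0r subr_le0 phit// -(subrr t).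
  lra.
rewrite (quad_grad u0 c hM hP MPM x) (quad_grad u0 c hM hP MPM y) lerD2r.
rewrite ler_pM2l ?invr_gt0// !grad_quad// -Mu !(pform_mulmx hM hP MPM) -E.
have [MT Mge] := hM.
(* The cross term equals [<u, M u>] by [E], so expanding the square yields
   [<u, M u> <= <y - u0, M (y - u0)>]. *)
have := Mge (y - u0 - u); rewrite mulmxBr dotBl !dotBr.
by rewrite [dot u (M *m (y - u0))]dotC dot_mulmxl MT; lra.
Qed.

End LimitFlow.

(** * Rescaled mirror flows and their primal variables *)

Section RescaledMirrorFlows.
Context {R : realType} {d : nat}.
Notation mu := (@lebesgue_measure R).
Variables (M P : 'M[R]_d) (u0 : 'cV[R]_d) (c : R).
Hypotheses (hM : psd_mx M) (hP : psd_mx P) (MPM : M *m P *m M = M).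
Notation l := (quad M (M *m u0) c).
Notation Q v := (pform P v v).
Variable h : 'cV[R]_d -> \bar R.
Hypotheses (hh : Gamma0 h) (hC : closed (dom h)) (hconj : dom (conjugate h) 0).
Notation C := (dom h).
Notation conj_le0 := (conj_le u0 C (fun=> 0)).
Variables (r : R -> R) (w x : R -> R -> 'cV[R]_d).
Hypotheses (hw : forall e, 0 < e -> lipschitz_mirror_flow h l (w e))
  (hx : forall e, 0 < e -> primal_variable h l (w e) (x e))
  (r_cvg : r e @[e --> 0^'+] --> +oo).
Let wb e s := (r e)^-1 *: w e (r e * s).
Let xb e s := x e (r e * s).
Let g e y := fine (h y) / r e.
Variables (wb0 a : 'cV[R]_d).
Hypotheses (wb_cvg : wb e 0 @[e --> 0^'+] --> wb0)
  (wb0_dom : dom_subdiff (support_fun C) wb0)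
  (ria : ri (dom (support_fun C)) a) (aM : colspan M (a - wb0))
  (wb_span : \forall e \near 0^'+, bspan C (wb e 0 - wb0)).

Let hp : proper_efun h. Proof. by case: hh. Qed.
Let C0 : C !=set0. Proof. by case: hp. Qed.
Let vC : segment_closed C.
Proof. by have [_ hc _] := hh; exact: segment_closed_dom. Qed.

Let rV_cvg : (r e)^-1 @[e --> 0^'+] --> 0.
Proof.
apply/cvgrPdist_le => e e0; near=> i; rewrite sub0r normrN.
have re : e^-1 < r i by near: i; move/cvgryPgt: r_cvg; exact.
have e1 : 0 < e^-1 by rewrite invr_gt0.
have ri := lt_trans e1 re.
by rewrite gtr0_norm ?invr_gt0// invf_ple ?posrE//; exact: ltW.
Unshelve. all: by end_near. Qed.

Let cvg_seq_right (e_ : nat -> R) : (forall k, 0 < e_ k) ->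
  e_ k @[k --> \oo] --> 0 -> e_ @ \oo --> 0^'+.
Proof.
move=> e0 e_cvg A HA.
have H : \forall k \near \oo, 0 < e_ k -> A (e_ k) := e_cvg _ HA.
suff: \forall k \near \oo, A (e_ k) by [].
by apply: filterS H => k; apply; exact: e0.
Qed.

Let kV_cvg (k : R) : k / r e @[e --> 0^'+] --> 0.
Proof. by have := cvgM (cvg_cst k) rV_cvg; rewrite mulr0; apply. Qed.

Let scale_pos : \forall e \near 0^'+, 0 < e /\ 0 < r e.
Proof.
near=> e; split; near: e; first exact: nbhs_right_gt.
by move/cvgryPgt: r_cvg; exact.
Unshelve. all: by end_near. Qed.

Let wb_flow : \forall e \near 0^'+, abstract_flow M u0 C (g e) (wb e).
Proof.
by apply: filterS scale_pos => e [e0 re]; exact: mirror_abstract_flow (hw e0).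
Qed.

Let g_cvg y : C y -> g e y @[e --> 0^'+] --> 0.
Proof. by move=> _; exact: kV_cvg. Qed.

Let penalty_lower_bound : exists2 eta : R -> R, eta e @[e --> 0^'+] --> 0 &
  \forall e \near 0^'+, forall y, C y -> - eta e <= g e y.
Proof.
have [m m0 hm] := conjugate_lower_bound hp hconj.
exists (fun e => m / r e); first exact: kV_cvg.
apply: filterS scale_pos => e [_ re] y Cy.
by rewrite -mulNr ler_pM2r ?invr_gt0// hm.
Qed.

Lemma rescaled_limit_exists : exists wbar, [/\ abstract_flow M u0 C (fun=> 0) wbar, wbar 0 = wb0 &
  forall S e, 0 <= S -> 0 < e ->
    \forall i \near 0^'+, forall s, 0 <= s <= S -> `|wb i s - wbar s| < e].
Proof.
have [eta eta0 geta] := penalty_lower_bound.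
have [y wy] := wb0_dom; have [[al wal] sub] := subdiff_support u0 C0 wy.
have [v [v0 ev [L vL] vunif]] := limit_curve hM hP MPM C0 wb_flow geta eta0 g_cvg
  wb_cvg ria aM wb_span wal sub.
exists v; split => //; apply: (evi_abstract_flow hM hP MPM ev vL (al := al)).
by rewrite v0.
Qed.

Variables (wbar xbar : R -> 'cV[R]_d) (S : R).
Hypotheses (S0 : 0 < S) (wbar_flow : abstract_flow M u0 C (fun=> 0) wbar)
  (wbar0 : wbar 0 = wb0)
  (wbar_unif : forall e, 0 < e ->
    \forall i \near 0^'+, forall s, 0 <= s <= S -> `|wb i s - wbar s| < e)
  (xbarP : primal_variable (indicator_fun C) l wbar xbar).

Let xbar_ae : {ae mu, forall t : R, 0 < t ->
  [/\ is_derive t (1 : R) wbar (- (M *m (xbar t - u0))), C (xbar t) &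
      forall y, C y -> dot (wbar t) (y - xbar t) <= 0]}.
Proof.
apply: aeS xbarP => t H t0; have [dw /subdiff_indicator[//|Cx nx]] := H (ltW t0).
by split=> //; rewrite -(grad_quad u0 c hM).
Qed.

Let densities : exists G : R -> R -> 'cV[R]_d, exists Gb : R -> 'cV[R]_d,
  (\forall e \near 0^'+, density S (wb e) (G e)) /\ density S wbar Gb.
Proof.
pose ok e G := density S (wb e) G.
have [Gb dGb] := density_exists S0 (flow_vlip wbar_flow S).
exists (fun e => xget (fun=> 0) [set G | ok e G]), Gb; split=> //.
apply: filterS wb_flow => e fe.
have [G dG] := density_exists S0 (flow_vlip fe S).
exact: (@xgetPex _ (fun=> 0) [set G | ok e G] (ex_intro _ G dG)).
Qed.

Let is_derive_eqN (v : R -> 'cV[R]_d) (t : R) y z :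
  is_derive t (1 : R) v (- y) -> is_derive t (1 : R) v z -> y = - z.
Proof. by move=> [_ yE] [_ zE]; rewrite -zE yE opprK. Qed.

Section Densities.
Variables (G : R -> R -> 'cV[R]_d) (Gb : R -> 'cV[R]_d).
Hypotheses (dG : \forall e \near 0^'+, density S (wb e) (G e)) (dGb : density S wbar Gb).

Let energy_cvg eta : 0 < eta -> \forall e \near 0^'+,
  \int[mu]_(t in `[0, S]) (t * Q (G e t - Gb t)) <= eta.
Proof.
have [et et0 get_] := penalty_lower_bound; have [[L wL] _] := wbar_flow.
apply: (derivative_strong_cvg hM hP MPM C0 S0 wb_flow wbar_flow g_cvg _ wbar_unif
  dG dGb wL) => v al vM val.
apply: (recovery get_ et0 wb_cvg ria aM wb_span _ val).
by rewrite -wbar0.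
Qed.

Let grad_ae : \forall e \near 0^'+, {ae mu, forall t : R, 0 < t < S ->
  grad l (xb e t) = - G e t /\ colspan M (grad l (xb e t))}.
Proof.
near=> e; have [e0 re] : 0 < e /\ 0 < r e by near: e.
have [_ dGe] : density S (wb e) (G e) by near: e.
apply: aeS2 dGe (primal_variable_rescale hM hp re (hx e0)) => t H1 H2 tS.
have [|dw _ _] := H2; first by case/andP: tS.
by rewrite grad_quad// (is_derive_eqN dw (H1 tS)); split=> //;
  rewrite -(is_derive_eqN dw (H1 tS)); exact: colspan_mulmx.
Unshelve. all: by end_near. Qed.

Let gradb_ae : {ae mu, forall t : R, 0 < t < S ->
  grad l (xbar t) = - Gb t /\ colspan M (grad l (xbar t))}.
Proof.
have [_ dGe] := dGb; apply: aeS2 dGe xbar_ae => t H1 H2 tS.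
have [|dw _ _] := H2; first by case/andP: tS.
by rewrite grad_quad// (is_derive_eqN dw (H1 tS)); split=> //;
  rewrite -(is_derive_eqN dw (H1 tS)); exact: colspan_mulmx.
Qed.

Lemma density_grad_cvg :
  cvg_wLp 2 S 0^'+ (fun e s => grad l (xb e s)) (fun s => grad l (xbar s)).
Proof.
apply: (cvg_wLp_field hM hP MPM S0 (G := G) (Gb := Gb)) => //; last by case: dGb.
by apply: filterS dG => e [].
Qed.

Lemma density_loss_cvg :
  cvg_wLp 1 S 0^'+ (fun e s => const_mx (l (xb e s)) : 'cV[R]_1)
    (fun s => const_mx (l (xbar s))).
Proof.
under eq_fun do under eq_fun do rewrite (quad_grad u0 c hM hP MPM).
under [X in cvg_wLp _ _ _ _ X]eq_fun do rewrite (quad_grad u0 c hM hP MPM).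
apply: (cvg_wLp_energy hP S0 (G := G) (Gb := Gb) (M := M)) => //; last by case: dGb.
by apply: filterS dG => e [].
Qed.

(** The weighted energies of [G - Gb] tend to 0 in mean, so at almost every time they are small for
    infinitely many [k]. The gradients converge pointwise there, hence their limit can only be the
    gradient at [xbar]. *)
Lemma density_cluster_grad (y : R -> 'cV[R]_d) (e_ : nat -> R) :
  (forall k, 0 < e_ k) -> e_ k @[k --> \oo] --> 0 ->
  {ae mu, forall s : R, 0 < s < S -> xb (e_ k) s @[k --> \oo] --> y s} ->
  {ae mu, forall s : R, 0 < s < S -> grad l (y s) = grad l (xbar s)}.
Proof.
move=> e0 e_cvg ycvg.
have e_right := cvg_seq_right e0 e_cvg.
have good : \forall e \near 0^'+, density S (wb e) (G e) /\
    {ae mu, forall t : R, 0 < t < S ->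
      grad l (xb e t) = - G e t /\ colspan M (grad l (xb e t))}.
  by apply: filterS2 dG grad_ae => e; split.
(* Dropping the first [N] terms gives the properties for every index, so countably many null sets
   can be discarded together. *)
have [N _ HN] := e_right _ good.
pose e' k := e_ (k + N)%N.
have e'_right : e' @ \oo --> 0^'+ by exact: cvg_comp (cvg_addnr N) e_right.
have HN' k := HN (k + N)%N (leq_addl k N).
have bf k := bmeas_tpform P (vbmeasB (HN' k).1.1 dGb.1) (vbmeasB (HN' k).1.1 dGb.1).
have f0 k (t : R) : 0 <= t <= S -> 0 <= t * Q (G (e' k) t - Gb t).
  by move=> /andP[t0 _]; rewrite mulr_ge0// pform_ge0.
have If : \int[mu]_(t in `[0, S]) (t * Q (G (e' k) t - Gb t)) @[k --> \oo] --> 0.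
  apply/cvgrPdist_le => eta eta0.
  have small : \forall k \near \oo,
      \int[mu]_(t in `[0, S]) (t * Q (G (e' k) t - Gb t)) <= eta.
    exact: e'_right _ (energy_cvg eta0).
  apply: filterS small => k Ik.
  rewrite sub0r normrN ger0_norm//; apply: Rintegral_ge0 => t /=.
  by rewrite in_itv/=; exact: f0.
have lim0 := ae_liminf0 bf f0 If.
have gk := ae_foralln (fun k => (HN' k).2).
have pair1 := aeS2 (fun t h1 h2 => conj h1 h2) ycvg gk.
have pair2 := aeS2 (fun t h1 h2 => conj h1 h2) lim0 gradb_ae.
apply: aeS2 pair1 pair2 => t [Yt gkt] [Lt gbt] tS.
have [Eb Mb] := gbt tS; have Ek k := gkt k tS.
have c1 : (fun k => grad l (xb (e' k) t)) @ \oo --> grad l (y t).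
  rewrite grad_quad//; under eq_fun do rewrite grad_quad//.
  apply: cvg_mulmx; apply: cvgB (cvg_cst _).
  by have := Yt tS; apply: cvg_comp; exact: cvg_addnr.
have My : colspan M (grad l (y t)) by rewrite grad_quad//; exact: colspan_mulmx.
apply/eqP; rewrite -subr_eq0; apply/eqP.
apply: (pform_colspan_eq0 hM hP MPM (colspanB My Mb)).
have c2 : (fun k => Q (grad l (xb (e' k) t) - grad l (xbar t))) @ \oo -->
    Q (grad l (y t) - grad l (xbar t)).
  by apply: cvg_pform; apply: cvgB => //; exact: cvg_cst.
rewrite leNgt; apply/negP; set q0 := Q _ => q0_gt0.
have q2 : q0 / 2 < q0 by lra.
have [k0 _ hk0] := cvgr_gt _ c2 _ q2.
have t0 : 0 < t by case/andP: tS.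
have [|k k0k] := Lt tS (t * (q0 / 2)) _ k0; first by rewrite mulr_gt0// divr_gt0.
have := hk0 k k0k; rewrite /= (Ek k).1 Eb -opprB opprK pformNl pformNr opprK [- Gb t + _]addrC => h1.
by rewrite ltr_pM2l// => h2; have := lt_trans h1 h2; rewrite ltxx.
Qed.

End Densities.

Lemma rescaled_grad_cvg :
  cvg_wLp 2 S 0^'+ (fun e s => grad l (xb e s)) (fun s => grad l (xbar s)).
Proof. by have [G [Gb [dG dGb]]] := densities; exact: density_grad_cvg dG dGb. Qed.

Lemma rescaled_loss_cvg :
  cvg_wLp 1 S 0^'+ (fun e s => const_mx (l (xb e s)) : 'cV[R]_1)
    (fun s => const_mx (l (xbar s))).
Proof. by have [G [Gb [dG dGb]]] := densities; exact: density_loss_cvg dG dGb. Qed.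

Lemma limit_is_min : {ae mu, forall s : R, 0 <= s <= S ->
  is_min (subdiff (support_fun C) (wbar s)) l (l (xbar s))}.
Proof.
apply: ae_itv_closed.
apply: aeS2 xbar_ae (flow_subdiff_min c hM hP MPM C0 wbar_flow) => t H1 H2 /andP[t0 _].
have [dw Cx nx] := H1 t0; split.
  by exists (xbar t) => //; exact: normal_subdiff_support.
by move=> _ [y yw <-]; exact: H2 t0 _ _ dw yw.
Qed.

(** The limit point lies in C by closedness and is normal to C because the potential terms fade. It
    has the same gradient as [xbar], hence the same loss, which is already minimal. *)
Lemma cluster_argmin (y : R -> 'cV[R]_d) (e_ : nat -> R) :
  (forall k, 0 < e_ k) -> e_ k @[k --> \oo] --> 0 ->
  {ae mu, forall s : R, 0 <= s <= S -> xb (e_ k) s @[k --> \oo] --> y s} ->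
  {ae mu, forall s : R, 0 <= s <= S ->
    argmin (subdiff (support_fun C) (wbar s)) l (y s)}.
Proof.
move=> e0 e_cvg ycvg; have [G [Gb [dG dGb]]] := densities.
have e_right := cvg_seq_right e0 e_cvg.
have [N _ HN] := e_right _ scale_pos.
pose e' k := e_ (k + N)%N.
have e'_right : e' @ \oo --> 0^'+ by exact: cvg_comp (cvg_addnr N) e_right.
have HN' k := HN (k + N)%N (leq_addl k N).
have [m m0 hm] := conjugate_lower_bound hp hconj.
have ycvg' : {ae mu, forall s : R, 0 < s < S -> xb (e_ k) s @[k --> \oo] --> y s}.
  apply: aeS ycvg => s H /andP[s0 sS]; apply: H; by rewrite !ltW.
have gy := density_cluster_grad dG dGb e0 e_cvg ycvg'.
have pk := ae_foralln (fun k => primal_variable_rescale hM hp (HN' k).2 (hx (HN' k).1)).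
apply: ae_itv_closed.
have pair1 := aeS2 (fun t h1 h2 => conj h1 h2) ycvg' gy.
have pair2 := aeS2 (fun t h1 h2 => conj h1 h2) pk
  (aeS2 (fun t h1 h2 => conj h1 h2) xbar_ae (flow_subdiff_min c hM hP MPM C0 wbar_flow)).
apply: aeS2 pair1 pair2 => t [Yt gyt] [Pt [xbt mint]] tS.
have t0 : 0 < t by case/andP: tS.
have c1 : xb (e' k) t @[k --> \oo] --> y t.
  by have := Yt tS; apply: cvg_comp; exact: cvg_addnr.
have Cy : C (y t).
  have Cx : \forall k \near \oo, C (xb (e' k) t).
    by apply: nearW => k; have [_ + _] := Pt k t0.
  exact: closed_cvg hC Cx _ c1.
have ny z : C z -> dot (wbar t) (z - y t) <= 0.
  move=> Cz.
  have cw : wb (e' k) t @[k --> \oo] --> wbar t.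
    apply/cvgrPdist_le => eta eta0.
    have unif : \forall k \near \oo,
        forall s, 0 <= s <= S -> `|wb (e' k) s - wbar s| < eta.
      exact: e'_right _ (wbar_unif eta0).
    apply: filterS unif => k H.
    by rewrite distrC; apply: ltW; apply: H; case/andP: tS => h1 h2; rewrite !ltW.
  have cl : dot (wb (e' k) t) (z - xb (e' k) t) @[k --> \oo] --> dot (wbar t) (z - y t).
    by apply: cvg_dot => //; apply: cvgB => //; exact: cvg_cst.
  (* The values of [h] at the moving points need not converge; only their lower bound [- m] is used,
     and it fades after division by the scale. *)
  have cr : (fine (h z) + m) * (r (e' k))^-1 @[k --> \oo] --> 0.
    exact: cvg_comp e'_right (kV_cvg _).
  apply: (ler_cvg_to cl cr); apply: nearW => k; have [_ Cx /(_ z Cz) H] := Pt k t0.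
  apply: (le_trans H); rewrite mulrDl lerD2l -mulNr ler_pM2r ?invr_gt0//.
    by rewrite lerNl hm.
  by case: (HN' k).
have [dw Cx nx] := xbt t0.
split; first exact: normal_subdiff_support.
move=> z zw; apply: le_trans (mint t0 _ _ dw zw).
by rewrite (quad_grad u0 c hM hP MPM (y t)) (quad_grad u0 c hM hP MPM (xbar t)) gyt.
Qed.

End RescaledMirrorFlows.

Lemma uniform_cvg_norm {R : realType} {d : nat} (F : set_system R) {FF : Filter F}
    (A : set R) (f : R -> R -> 'cV[R]_d) (g : R -> 'cV[R]_d) :
  (forall e, 0 < e -> \forall i \near F, forall s, A s -> `|f i s - g s| < e) ->
  {uniform A, f @ F --> g}.
Proof.
move=> fg B /uniform_nbhs[E [entE sub]].
move: entE; rewrite -entourage_from_ballE => -[e /= e0 He].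
suff : \forall i \near F, B (f i) by [].
apply: filterS (fg e e0) => i Hi; apply: sub => s As; apply: He.
by rewrite /= -ball_normE /ball_/= distrC; exact: Hi.
Qed.

Theorem theorem3p8 (R : realType) (d : nat) (hd : (1 <= d)%N)
  (M : 'M[R]_d) (q : 'cV[R]_d) (c : R)
  (hM : psd_mx M) (hq : colspan M q)
  (h : 'cV[R]_d -> \bar R) (hh : Gamma0 h)
  (hC : closed (dom h)) (hconj : dom (conjugate h) = [set: 'cV[R]_d])
  (w0 : R -> 'cV[R]_d) (w x : R -> R -> 'cV[R]_d)
  (hw : forall e : R, 0 < e -> lipschitz_mirror_flow h (quad M q c) (w e))
  (hw0 : forall e : R, 0 < e -> w e 0 = w0 e)
  (hx : forall e : R, 0 < e -> primal_variable h (quad M q c) (w e) (x e))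
  (hmu : enorm (w0 e) @[e --> 0^'+] --> +oo)
  (wb0 : 'cV[R]_d) :
  let C := dom h in
  let l := quad M q c in
  let mu := fun e : R => enorm (w0 e) in
  let wb := fun e s : R => (mu e)^-1 *: w e (mu e * s) in
  let xb := fun e s : R => x e (mu e * s) in
  wb e 0 @[e --> 0^'+] --> wb0 ->
  dom_subdiff (support_fun C) wb0 ->
  [set a + b | a in ri (dom (support_fun C)) & b in colspan M] wb0 ->
  (\forall e \near 0^'+, aff (dom (support_fun C)) (wb e 0 - wb0)) ->
  exists wbar : R -> 'cV[R]_d,
    [/\ lipschitz_mirror_flow (indicator_fun C) l wbar,
        wbar 0 = wb0,
        forall w' : R -> 'cV[R]_d,
          lipschitz_mirror_flow (indicator_fun C) l w' -> w' 0 = wb0 ->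
          forall s : R, 0 <= s -> w' s = wbar s
      & forall (xbar : R -> 'cV[R]_d) (S : R),
          primal_variable (indicator_fun C) l wbar xbar -> 0 < S ->
        [/\ {uniform `[0, S]%classic, wb @ 0^'+ --> wbar},
            cvg_wLp 2 S 0^'+ (fun e s => grad l (xb e s))
              (fun s => grad l (xbar s)),
            cvg_wLp 1 S 0^'+ (fun e s => const_mx (l (xb e s)) : 'cV[R]_1)
              (fun s => const_mx (l (xbar s))),
            {ae (@lebesgue_measure R), forall s : R, 0 <= s <= S ->
              is_min (subdiff (support_fun C) (wbar s)) l (l (xbar s))}
          & forall (y : R -> 'cV[R]_d) (e_ : nat -> R),
              (forall k, 0 < e_ k) -> e_ k @[k --> \oo] --> 0 ->
              {ae (@lebesgue_measure R), forall s : R, 0 <= s <= S ->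
                xb (e_ k) s @[k --> \oo] --> y s} ->
              {ae (@lebesgue_measure R), forall s : R, 0 <= s <= S ->
                argmin (subdiff (support_fun C) (wbar s)) l (y s)}]].
Proof.
have [P hP MPM] := psd_pinv hM; have [u0 _ qE] := hq; subst q.
move=> C l mu wb xb wb_cvg wb0_dom [a ria [b bM ab]] wb_span.
have aM : colspan M (a - wb0) by rewrite -ab opprD addrA subrr add0r; exact: colspanN.
have hconj0 : dom (conjugate h) 0 by rewrite hconj.
have [hp hc _] := hh; have C0 : C !=set0 by case: hp.
have vC : segment_closed C by exact: segment_closed_dom.
have [wbar [wf wbar0 wbar_unif]] :=
  rescaled_limit_exists hM hP MPM hh hconj0 hw hmu wb_cvg wb0_dom ria aM wb_span.
exists wbar; split.
- by apply: (abstract_flow_primal c hM hP MPM C0 hC vC wf ria); rewrite wbar0.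
- exact: wbar0.
- move=> w' /(indicator_abstract_flow hM C0) wf' w'0 s s0.
  by apply: (abstract_flow_unique hM hP MPM C0 wf' wf _ s0); rewrite w'0 wbar0.
move=> xbar S xbarP S0.
have unif e : 0 < e -> \forall i \near 0^'+, forall s, 0 <= s <= S -> `|wb i s - wbar s| < e.
  exact: wbar_unif (ltW S0).
split.
- by apply: uniform_cvg_norm => e /unif.
- exact: (rescaled_grad_cvg hM hP MPM hh hconj0 hw hx hmu wb_cvg ria aM wb_span S0 wf).
- exact: (rescaled_loss_cvg hM hP MPM hh hconj0 hw hx hmu wb_cvg ria aM wb_span S0 wf).
- exact: (limit_is_min hM hP MPM hh S wf xbarP).
- move=> y e_ e0 e_cvg ycvg; exact: (cluster_argmin hM hP MPM hh hC hconj0 hw hx hmu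
    wb_cvg ria aM wb_span S0 wf wbar0 unif xbarP e0 e_cvg ycvg).
Qed.
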